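(* Let $A,B\in\mathbb{Z}$ be non-zero integers and let $r$ be the rank of the group $E_{A,B}(\mathbb{Q}(t))$, where $E_{A,B}$ is the elliptic curve over $\mathbb{Q}(t)$ given by $y^2=x^3+At^6+B$. Then $r=3$ if there exist $\alpha,\beta\in\mathbb{Z}$ such that one of the following holds: (a) $A=\alpha^6$ and $B=2^4\beta^6$; (b) $A=-3^3\alpha^6$ and $B=2^4\beta^6$; (c) $A=-3^3\alpha^6$ and $B=-3^3 2^4\beta^6$; (d) $A=\alpha^6$ and $B=-2^4 3^3\beta^6$; (e) one of the four cases (a)--(d) with the roles of $A$ and $B$ interchanged. Otherwise, $r\le 2$. *)

(* Defs.v *)
From HB Require Import structures.
From mathcomp Require Import all_boot all_algebra ring.

Set Implicit Arguments.
Unset Strict Implicit.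
Unset Printing Implicit Defensive.

Import GRing.Theory.
Local Open Scope ring_scope.

(* Elliptic curves y^2 = x^3 + a x + b in short Weierstrass form.  The
   discriminant condition forces the characteristic to be different from 2. *)

Record elliptic_curve (K : fieldType) := EllipticCurve {
  ec_a : K;
  ec_b : K;
  ec_disc : - 16%:R * (4%:R * ec_a ^+ 3 + 27%:R * ec_b ^+ 2) != 0
}.

Section RawPoints.

Variables (K : fieldType) (E : elliptic_curve K).
Local Notation a := (ec_a E).
Local Notation b := (ec_b E).

(* None is the point at infinity. *)
Definition on_curve (P : option (K * K)) : bool :=
  if P is Some (x, y) then y ^+ 2 == x ^+ 3 + a * x + b else true.

Definition ec_opp (P : option (K * K)) : option (K * K) :=
  if P is Some (x, y) then Some (x, - y) else None.

(* The reflection of the third intersection point of the curve with the line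
   of slope l through p and q. *)
Definition ec_line (l : K) (p q : K * K) : K * K :=
  let x := l ^+ 2 - p.1 - q.1 in (x, l * (p.1 - x) - p.2).

Definition ec_chord (p q : K * K) : K * K :=
  ec_line ((p.2 - q.2) / (p.1 - q.1)) p q.

Definition ec_tangent (p : K * K) : K * K :=
  ec_line ((3%:R * p.1 ^+ 2 + a) / (2%:R * p.2)) p p.

Definition ec_add (P Q : option (K * K)) : option (K * K) :=
  match P, Q with
  | None, _ => Q
  | _, None => P
  | Some p, Some q =>
      if p.1 != q.1 then Some (ec_chord p q)
      else if p.2 == - q.2 then None
      else Some (ec_tangent p)
  end.

Arguments ec_add : simpl never.

Local Notation ch := ec_chord.
Local Notation tg := ec_tangent.
Local Notation on p := (p.2 ^+ 2 = p.1 ^+ 3 + a * p.1 + b).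

Lemma nz2 : 2%:R != 0 :> K.
Proof.
apply: contra (ec_disc E) => /eqP n2; apply/eqP.
by have -> : 16%:R = 2%:R * 8%:R :> K; [ring | rewrite n2; ring].
Qed.

Lemma nz_scale (m d d' : K) : d != 0 -> m != 0 -> d' = d * m -> d' != 0.
Proof. by move=> d0 m0 ->; rewrite mulf_neq0. Qed.

Ltac nz := repeat (first [assumption | exact: nz2 | apply: expf_neq0 | apply: mulf_neq0]).
Ltac side n m :=
  apply: (@nz_scale m _ _ n);
  [ by nz
  | rewrite ?/ec_chord ?/ec_tangent ?/ec_line /=; field;
    by rewrite ?andbT; repeat (apply/andP; split); nz ].

Lemma assoc_chords p q r : on p -> on q -> on r ->
  p.1 - q.1 != 0 -> q.1 - r.1 != 0 ->
  (ch p q).1 - r.1 != 0 -> p.1 - (ch q r).1 != 0 ->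
  ch (ch p q) r = ch p (ch q r).
Proof.
case: p q r => [x1 y1] [x2 y2] [x3 y3].
rewrite /ec_chord /ec_line /= => H1 H2 H3 n1 n2 n3 n4.
congr pair; field: H1 H2 H3; rewrite ?n1 ?n2 /=; apply/andP; split;
  [ side n4 ((x2 - x3) ^+ 2) | side n3 ((x1 - x2) ^+ 2)
  | side n4 ((x2 - x3) ^+ 2) | side n3 ((x1 - x2) ^+ 2) ].
Qed.

Lemma assoc_tangent p r : on p -> on r ->
  p.2 != 0 -> p.1 - r.1 != 0 ->
  (tg p).1 - r.1 != 0 -> p.1 - (ch p r).1 != 0 ->
  ch (tg p) r = ch p (ch p r).
Proof.
case: p r => [x1 y1] [x3 y3].
rewrite /ec_chord /ec_tangent /ec_line /= => H1 H3 n1 n2 n3 n4.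
congr pair; field: H1 H3; rewrite ?nz2 ?n1 ?n2 /=; apply/andP; split;
  [ side n4 ((x1 - x3) ^+ 2) | side n3 ((2 * y1) ^+ 2)
  | side n4 ((x1 - x3) ^+ 2) | side n3 ((2 * y1) ^+ 2) ].
Qed.

Lemma assoc_quadruple p : on p ->
  p.2 != 0 -> p.1 - (tg p).1 != 0 ->
  (tg p).2 != 0 -> p.1 - (ch p (tg p)).1 != 0 ->
  tg (tg p) = ch p (ch p (tg p)).
Proof.
case: p => [x1 y1].
rewrite /ec_chord /ec_tangent /ec_line /= => H1 n1 n2 n3 n4.
have c : x1 * (4 * y1 ^+ 2) -
    ((3 * x1 ^+ 2 + a) ^+ 2 + - x1 * (4 * y1 ^+ 2) + - x1 * (4 * y1 ^+ 2)) != 0.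
  by side n2 ((2 * y1) ^+ 2).
congr pair; field: H1; rewrite ?nz2 ?n1 /=.
- apply/and3P; split; [exact: c | | side n3 ((2 * y1) ^+ 3)].
  side n4 ((x1 - (tg (x1, y1)).1) ^+ 2 * (2 * y1) ^+ 6).
- apply/and3P; split; [exact: c | | side n3 ((2 * y1) ^+ 3)].
  side n4 ((x1 - (tg (x1, y1)).1) ^+ 2 * (2 * y1) ^+ 6).
Qed.

Lemma double_chord s q : on s -> on q ->
  s.1 - q.1 != 0 -> s.2 != 0 ->
  (ch s (q.1, - q.2)).1 - (ch q s).1 != 0 ->
  tg s = ch (ch s (q.1, - q.2)) (ch q s).
Proof.
case: s q => [x1 y1] [x2 y2].
rewrite /ec_chord /ec_tangent /ec_line /= => H1 H2 n1 n2 n3.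
have n1' : x2 - x1 != 0 by rewrite -opprB oppr_eq0.
congr pair; field: H1 H2; rewrite ?n1 ?n1' ?n2 ?nz2 ?andbT /=;
  side n3 ((x1 - x2) ^+ 2 * (x2 - x1) ^+ 2).
Qed.

Lemma double_2torsion p q : on p -> on q -> q.2 = 0 ->
  p.1 - q.1 != 0 -> p.2 != 0 -> (ch p q).2 != 0 ->
  tg (ch p q) = tg p.
Proof.
case: p q => [x1 y1] [x2 y2].
rewrite /ec_chord /ec_tangent /ec_line /= => H1 H2 H n1 n2 n3.
move: H1 H2 n3; rewrite H => H1 H2 n3.
have Eb : b = - x2 ^+ 3 - a * x2.
  by apply: (addrI (x2 ^+ 3 + a * x2)); rewrite -H2; ring.
have {}H1 : y1 ^+ 2 = x1 ^+ 3 + a * x1 - x2 ^+ 3 - a * x2 by ring: H1 Eb.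
congr pair; field: H1; rewrite ?n2 ?n1 ?nz2 /=; side n3 ((x1 - x2) ^+ 3).
Qed.

Lemma on_chord p q : on p -> on q -> p.1 - q.1 != 0 -> on (ch p q).
Proof.
case: p q => [x1 y1] [x2 y2]; rewrite /ec_chord /ec_line /= => H1 H2 n.
by field: H1 H2.
Qed.

Lemma on_tangent p : on p -> p.2 != 0 -> on (tg p).
Proof.
case: p => [x y]; rewrite /ec_tangent /ec_line /= => H n.
by field: H; rewrite n nz2.
Qed.

Variant ec_add_spec : option (K * K) -> option (K * K) -> option (K * K) -> Prop :=
| EcAdd0p Q : ec_add_spec None Q Q
| EcAddp0 P : ec_add_spec P None P
| EcAddpN x y : ec_add_spec (Some (x, y)) (Some (x, - y)) None
| EcAddpp p of on p & p.2 != 0 : ec_add_spec (Some p) (Some p) (Some (tg p))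
| EcAddpq p q of on p & on q & p.1 - q.1 != 0 :
    ec_add_spec (Some p) (Some q) (Some (ch p q)).

Lemma ec_addP P Q : on_curve P -> on_curve Q -> ec_add_spec P Q (ec_add P Q).
Proof.
rewrite /ec_add; case: P => [[x1 y1]|] /=; last by move=> *; constructor.
case: Q => [[x2 y2]|] /=; last by move=> *; constructor.
move=> /eqP H1 /eqP H2; case: eqP => /= [ex|/eqP n]; last first.
  by constructor=> //; rewrite subr_eq0.
case: eqP => [-> | /eqP ny].
  by rewrite ex -{2}[y2]opprK; constructor.
have ey : y1 = y2.
  apply/eqP; rewrite -subr_eq0 -(mulIr_eq0 _ (mulIf _ : GRing.rreg (y1 + y2))).
    by rewrite -subr_sqr H1 H2 ex subrr.
  by rewrite -[y2]opprK subr_eq0.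
rewrite ex ey in H1 ny *; constructor=> //=.
apply: contraNneq ny => ->; by rewrite oppr0.
Qed.

Lemma on_curve_opp P : on_curve P -> on_curve (ec_opp P).
Proof. by case: P => [[x y]|] //=; rewrite sqrrN. Qed.

Lemma on_curve_add P Q : on_curve P -> on_curve Q -> on_curve (ec_add P Q).
Proof.
move=> oP oQ; have [oP' oQ'] := (oP, oQ).
case: (ec_addP oP oQ) oP' oQ' => // [p op n|p q op oq n] _ _.
  by have := on_tangent op n; case: (tg p) => x y /= ->.
by have := on_chord op oq n; case: (ch p q) => x y /= ->.
Qed.

Lemma ec_oppK : involutive ec_opp.
Proof. by case=> [[x y]|] //=; rewrite opprK. Qed.

Lemma ec_add_chord p q : p.1 - q.1 != 0 ->
  ec_add (Some p) (Some q) = Some (ch p q).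
Proof. by rewrite subr_eq0 /ec_add => ->. Qed.

Lemma ec_add_tangent p : p.2 != 0 -> ec_add (Some p) (Some p) = Some (tg p).
Proof.
move=> n; rewrite /ec_add eqxx /= -addr_eq0 -mulr2n -mulr_natl mulf_eq0.
by rewrite (negPf n) (negPf nz2).
Qed.

Lemma ec_addC P Q : on_curve P -> on_curve Q -> ec_add P Q = ec_add Q P.
Proof.
move=> oP oQ.
case: (ec_addP oP oQ) => [Q'|P'|x y|p _ n|[x1 y1] [x2 y2] /= _ _ n].
- by case: Q'.
- by case: P'.
- by rewrite /ec_add /= !eqxx.
- by rewrite ec_add_tangent.
have n' : x2 - x1 != 0 by rewrite -opprB oppr_eq0.
rewrite ec_add_chord // /ec_chord /ec_line /=.
by congr (Some (_, _)); field; rewrite n n'.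
Qed.

Lemma ec_addNp P : ec_add (ec_opp P) P = None.
Proof. by case: P => [[x y]|] //=; rewrite /ec_add /= !eqxx. Qed.

Lemma ec_add_eq0 P Q : on_curve P -> on_curve Q ->
  ec_add P Q = None -> Q = ec_opp P.
Proof. by move=> oP oQ; case: (ec_addP oP oQ) => // P' ->. Qed.

Lemma ec_oppD P Q : on_curve P -> on_curve Q ->
  ec_opp (ec_add P Q) = ec_add (ec_opp P) (ec_opp Q).
Proof.
move=> oP oQ.
case: (ec_addP oP oQ) => [Q'|P'|x y|[x y] /= _ n|[x1 y1] [x2 y2] /= _ _ n].
- by [].
- by case: P' => [[]|].
- by rewrite /ec_add /= !opprK !eqxx.
- rewrite ec_add_tangent /= ?oppr_eq0 //.
  by rewrite /ec_tangent /ec_line; congr (Some (_, _)) => /=; field;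
    rewrite ?oppr_eq0 n nz2.
rewrite ec_add_chord // /ec_chord /ec_line /=.
by congr (Some (_, _)); field.
Qed.

(* Smoothness: a line through another point cannot be tangent at a point of
   order 2. *)
Lemma ec_chord_2torsion p q : on p -> on q -> p.1 - q.1 != 0 ->
  (ch p q).1 = p.1 -> p.2 != 0.
Proof.
case: p q => [x1 y1] [x2 y2]; rewrite /ec_chord /ec_line /= => H1 H2 n Ex.
apply: contraNneq (ec_disc E) => y0; rewrite y0 in H1 Ex *.
have Hb : b = - x1 ^+ 3 - a * x1.
  by apply: (addrI (x1 ^+ 3 + a * x1)); rewrite -H1; ring.
have Hy : y2 ^+ 2 = (2%:R * x1 + x2) * (x1 - x2) ^+ 2.
  have <- : ((0 - y2) / (x1 - x2)) ^+ 2 = 2%:R * x1 + x2.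
    by apply: (addIr (- x1 - x2)); rewrite addrA Ex; ring.
  by field.
have Ha : a = - 3%:R * x1 ^+ 2.
  apply: (mulfI n); apply/eqP; rewrite -subr_eq0; apply/eqP.
  rewrite (_ : _ - _ = (2%:R * x1 + x2) * (x1 - x2) ^+ 2 - (x2 ^+ 3 + a * x2 + b)).
    by rewrite -Hy H2 subrr.
  by rewrite Hb; ring.
by rewrite Hb Ha; apply/eqP; ring.
Qed.

Lemma ec_addKN P Q : on_curve P -> on_curve Q ->
  ec_add (ec_opp P) (ec_add P Q) = Q.
Proof.
move=> oP oQ; have [oP' oQ'] := (oP, oQ).
case: (ec_addP oP oQ) oP' oQ' => // {oP oQ}.
- by move=> P' _ _; rewrite ec_addNp.
- move=> [x y] /= op n _ _.
  have [ex|nx] := eqVneq (tg (x, y)).1 x.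
    have et : tg (x, y) = (x, - y).
      by move: ex; rewrite /ec_tangent /ec_line /= => ->; congr pair; ring.
    have oc : on_curve (Some (x, y)) by rewrite /= op.
    have := ec_oppD oc oc; rewrite ec_add_tangent // et => D.
    by rewrite -[Some (x, - y)]/(ec_opp (Some (x, y))) -D /= opprK.
  rewrite ec_add_chord /= -1?opprB ?oppr_eq0 ?subr_eq0 //.
  rewrite eq_sym -subr_eq0 in nx.
  move: nx; rewrite /ec_chord /ec_tangent /ec_line /= => nx.
  congr (Some (_, _)); field: op; rewrite n nz2 /=;
    side nx ((2 * y) ^+ 2).
move=> [x1 y1] [x2 y2] /= op oq n _ _.
have [ex|nx] := eqVneq (ch (x1, y1) (x2, y2)).1 x1.
  have y0 := @ec_chord_2torsion (x1, y1) (x2, y2) op oq n ex.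
  have et : ch (x1, y1) (x2, y2) = (x1, - y1).
    by move: ex; rewrite /ec_chord /ec_line /= => ->; congr pair; ring.
  rewrite et ec_add_tangent /= ?oppr_eq0 //; move: ex y0 n op oq {et}.
  rewrite /ec_tangent /ec_chord /ec_line /= => ex y0 n op oq.
  set l := (y1 - y2) / (x1 - x2) in ex *.
  have El : l ^+ 2 = 2%:R * x1 + x2.
    by apply: (addIr (- x1 - x2)); rewrite addrA ex; ring.
  have Es : 3%:R * x1 ^+ 2 + a = 2%:R * y1 * l.
    apply: (mulfI n).
    have -> : (x1 - x2) * (2%:R * y1 * l) =
              l ^+ 2 * (x1 - x2) ^+ 2 + y1 ^+ 2 - y2 ^+ 2 by rewrite /l; field.
    by rewrite El op oq; ring.
  have -> : (3%:R * x1 ^+ 2 + a) / (2%:R * - y1) = - l.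
    by rewrite Es; field; rewrite oppr_eq0 y0 nz2.
  have -> : (- l) ^+ 2 - x1 - x1 = x2 by rewrite sqrrN El; ring.
  by congr (Some (_, _)); rewrite /l; field.
rewrite ec_add_chord /= -1?opprB ?oppr_eq0 ?subr_eq0 //.
rewrite eq_sym -subr_eq0 in nx.
move: nx; rewrite /ec_chord /ec_tangent /ec_line /= => nx.
congr (Some (_, _)); field: op oq; rewrite n /=; side nx ((x1 - x2) ^+ 2).
Qed.

End RawPoints.

Arguments ec_add : simpl never.

Section Associativity.

Variables (K : fieldType) (E : elliptic_curve K).
Local Notation a := (ec_a E).
Local Notation b := (ec_b E).

Local Notation ch := ec_chord.
Local Notation tg := (ec_tangent E).
Local Notation on p := (p.2 ^+ 2 = p.1 ^+ 3 + a * p.1 + b).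
Local Notation on_curve := (on_curve E).
Local Notation ec_add := (ec_add E).
Lemma ec_addNK P Q : on_curve P -> on_curve Q ->
  ec_add P (ec_add (ec_opp P) Q) = Q.
Proof.
by move=> oP oQ; rewrite -{1}[P]ec_oppK ec_addKN ?on_curve_opp.
Qed.

Lemma ec_addrK P Q : on_curve P -> on_curve Q ->
  ec_add (ec_add P Q) (ec_opp Q) = P.
Proof.
move=> oP oQ; rewrite ec_addC ?on_curve_add ?on_curve_opp //.
by rewrite [ec_add P Q]ec_addC // ec_addKN.
Qed.

Lemma ec_add_idr P Q : on_curve P -> on_curve Q -> ec_add P Q = P -> Q = None.
Proof. by move=> oP oQ e; rewrite -(ec_addKN oP oQ) e ec_addNp. Qed.

Lemma ec_add_idl P Q : on_curve P -> on_curve Q -> ec_add P Q = Q -> P = None.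
Proof. by move=> oP oQ; rewrite ec_addC //; apply: ec_add_idr. Qed.

Lemma on_curveE (p : K * K) : on_curve (Some p) -> on p.
Proof. by case: p => x y /eqP. Qed.

Lemma ec_neq_x (p q : K * K) : on_curve (Some p) -> on_curve (Some q) ->
  Some p != Some q -> Some p != ec_opp (Some q) -> p.1 - q.1 != 0.
Proof.
case: p q => [x1 y1] [x2 y2] /eqP op /eqP oq /= n1 n2.
rewrite subr_eq0; apply/negP => /eqP ex; rewrite ex in op n1 n2.
have /eqP : y1 ^+ 2 = y2 ^+ 2 by rewrite op oq.
by rewrite eqf_sqr => /orP[] /eqP ey; [case/eqP: n1 | case/eqP: n2]; rewrite ey.
Qed.

Lemma ec_neq_y (p : K * K) : Some p != ec_opp (Some p) -> p.2 != 0.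
Proof. by case: p => x y; apply: contraNneq => /= ->; rewrite oppr0. Qed.

Lemma ec_add_neq0 P Q : on_curve P -> on_curve Q -> P != ec_opp Q ->
  ec_add P Q != None.
Proof.
move=> oP oQ; apply: contraNneq => /(ec_add_eq0 oP oQ) ->.
by rewrite ec_oppK.
Qed.

Lemma ec_addp0 P : ec_add P None = P.
Proof. by case: P. Qed.

Lemma ec_addpN P : on_curve P -> ec_add P (ec_opp P) = None.
Proof. by move=> oP; rewrite ec_addC ?on_curve_opp // ec_addNp. Qed.

Lemma ec_addA_double P R : on_curve P -> on_curve R ->
  ec_add (ec_add P P) R = ec_add P (ec_add P R).
Proof.
move=> oP oR; have oPP := on_curve_add oP oP; have oPR := on_curve_add oP oR.
have oNP := on_curve_opp oP; have oNR := on_curve_opp oR.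
have [eP|nPN] := eqVneq P (ec_opp P).
  have -> : ec_add P P = None by rewrite {1}eP ec_addNp.
  by rewrite {1}eP ec_addKN.
have [eR|nPNR] := eqVneq R (ec_opp P).
  by rewrite eR ec_addrK // ec_addpN // ec_addp0.
have [eR|nPPR] := eqVneq R (ec_opp (ec_add P P)).
  by rewrite eR ec_addpN // ec_oppD // ec_addNK // ec_addpN.
have [eP|nPPR'] := eqVneq P (ec_opp (ec_add P R)).
  have {}eP : R = ec_add (ec_opp P) (ec_opp P).
    have eN : ec_add P R = ec_opp P by rewrite {2}eP ec_oppK.
    by rewrite -{1}(ec_addKN oP oR) eN.
  by case/eqP: nPPR; rewrite ec_oppD.
have [<-|nPR] := eqVneq P R; first exact: ec_addC.
have [P0|nP0] := eqVneq P None; first by rewrite P0.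
have [R0|nR0] := eqVneq R None; first by rewrite R0 !ec_addp0.
have nPP : P != ec_add P P.
  by apply: contraNneq nP0 => /esym/(ec_add_idr oP oP) ->.
have nPPR1 : P != ec_add P R.
  by apply: contraNneq nR0 => /esym/(ec_add_idr oP oR) ->.
case: P => [p|//] in oP oPP oPR oNP nPN nPNR nPPR nPPR' nPR nP0 nPP nPPR1 *.
have np := ec_neq_y nPN; have op := on_curveE oP.
rewrite ec_add_tangent // in oPP nPPR nPP *.
have [eR|nPPR2] := eqVneq (Some (tg p)) R.
  subst R; have n1 := ec_neq_x oP oPP nPP.
  have {}n1 : p.1 - (tg p).1 != 0.
    by apply: n1; apply: contraNneq nPNR => ->; rewrite ec_oppK.
  rewrite ec_add_chord // in oPR nPPR' nPPR1 *.
  have n2 := ec_neq_x oP oPR nPPR1 nPPR'.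
  have n3 := ec_neq_y nPPR.
  by rewrite (ec_add_chord E n2) (ec_add_tangent E n3) assoc_quadruple.
case: R => [r|//] in oR oPR oNR nPNR nPPR nPPR' nPR nR0 nPPR1 nPPR2 *.
have oR' := on_curveE oR.
have n1 : p.1 - r.1 != 0.
  by apply: ec_neq_x => //; apply: contraNneq nPNR => ->; rewrite ec_oppK.
rewrite ec_add_chord // in oPR nPPR' nPPR1 *.
have n2 : (tg p).1 - r.1 != 0.
  by apply: (ec_neq_x oPP) => //; apply: contraNneq nPPR => ->; rewrite ec_oppK.
have n3 := ec_neq_x oP oPR nPPR1 nPPR'.
by rewrite (ec_add_chord E n2) (ec_add_chord E n3) assoc_tangent.
Qed.

(* P + (Q + S) = 2 S for S = P + Q. *)
Lemma ec_addA_sum P Q : on_curve P -> on_curve Q -> 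
  ec_add P (ec_add Q (ec_add P Q)) = ec_add (ec_add P Q) (ec_add P Q).
Proof.
move=> oP oQ; have oS := on_curve_add oP oQ; have oNQ := on_curve_opp oQ.
set S := ec_add P Q in oS *; have eP : P = ec_add S (ec_opp Q) by rewrite ec_addrK.
have [eQ|nQS] := eqVneq S Q.
  by have -> : P = None; [apply: (ec_add_idl oP oQ) | rewrite eQ].
have [S0|nS0] := eqVneq S None.
  by rewrite S0 ec_addp0; exact: S0.
have [Q0|nQ0] := eqVneq Q None.
  by rewrite /S Q0 !ec_addp0.
have [eS|nSNQ] := eqVneq S (ec_opp Q).
  by rewrite {1}eS ec_addpN // ec_addp0 {1}eP -eS.
have [eS|nSNS] := eqVneq S (ec_opp S).
  rewrite [RHS](_ : _ = None); last by rewrite {2}eS ec_addpN.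
  rewrite {1}eP {1}eS ec_addC ?on_curve_add ?on_curve_opp // -ec_oppD //.
  by rewrite [ec_add S Q]ec_addC // ec_addpN ?on_curve_add.
have oQS := on_curve_add oQ oS.
have [e|nPN] := eqVneq P (ec_opp (ec_add Q S)).
  case/eqP: nSNS; rewrite -{1}(ec_addKN oQ oS).
  by rewrite -[ec_add Q S]ec_oppK -e ec_addC ?on_curve_opp // -ec_oppD.
have eSo : ec_opp S = ec_add (ec_opp P) (ec_opp Q) by rewrite ec_oppD.
have nPQ' : P != ec_opp Q.
  by apply: contraNneq nS0 => e; rewrite /S e ec_addNp.
have [e|nPQS] := eqVneq P (ec_add Q S).
  have eQ : ec_opp Q = Q.
    have e2 : ec_add S (ec_opp Q) = ec_add S Q by rewrite -eP e ec_addC.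
    by rewrite -(ec_addKN oS oNQ) e2 ec_addKN.
  have nPQ : P != Q.
    apply: contraNneq nS0 => ePQ; apply/eqP/(ec_add_idr oQ oS).
    by rewrite -e ePQ.
  have nPP : P != ec_opp P.
    by apply: contraNneq nSNS => ePP; rewrite eSo -ePP eQ.
  rewrite -e; rewrite /S in oS nSNS *.
  case: P Q oP oQ {eP e eSo oNQ oQS nPN nSNQ nQS nS0 S}
    => [p|] [q|] //= oP oQ in oS nSNS nPQ nPQ' nPP eQ nQ0 *.
  have n := ec_neq_x oP oQ nPQ nPQ'.
  have np := ec_neq_y nPP.
  rewrite ec_add_chord // in oS nSNS *.
  have ns := ec_neq_y nSNS.
  rewrite !ec_add_tangent // double_2torsion //; try exact: on_curveE.
  apply/eqP; rewrite -(mulrI_eq0 _ (mulfI (nz2 E))).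
  by case: q eQ {oQ oS nSNS nPQ nPQ' nQ0 n ns} => x y [] /eqP; rewrite eq_sym -addr_eq0 mulr_natl.
case: S nPN nPQS oQS oS nS0 nQS nSNQ nSNS eP {eSo} => [s|//].
case: Q oQ oNQ nQ0 nPQ' => [q|//] oQ oNQ _ nPQ'.
move=> nPN nPQS oQS oS _ nSQ nSNQ nSNS eP.
have n1 := ec_neq_x oS oQ nSQ nSNQ.
have n1' : q.1 - s.1 != 0 by rewrite -opprB oppr_eq0.
have ns := ec_neq_y nSNS.
have eNq : ec_opp (Some q) = Some (q.1, - q.2) by case: (q).
rewrite eNq ec_add_chord // in eP.
rewrite ec_add_chord // in oQS nPN nPQS *.
subst P.
have n2 := ec_neq_x oP oQS nPQS nPN.
by rewrite (ec_add_chord E n2) (ec_add_tangent E ns) -(double_chord (E := E)) //; exact: on_curveE.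
Qed.

Lemma ec_addA P Q R : on_curve P -> on_curve Q -> on_curve R ->
  ec_add P (ec_add Q R) = ec_add (ec_add P Q) R.
Proof.
move=> oP oQ oR.
have oPQ := on_curve_add oP oQ; have oQR := on_curve_add oQ oR.
have [[oNP oNQ] oNR] := (on_curve_opp oP, on_curve_opp oQ, on_curve_opp oR).
have [eP|nPN] := eqVneq P (ec_opp Q).
  by rewrite eP ec_addNp ec_addKN.
have [eR|nRN] := eqVneq R (ec_opp Q).
  by rewrite eR ec_addpN // ec_addrK // ec_addp0.
have [eR|nR] := eqVneq R (ec_opp (ec_add P Q)).
  rewrite [in RHS]eR ec_addpN // eR ec_oppD // [ec_add (ec_opp P) _]ec_addC //.
  by rewrite ec_addNK // ec_addpN.
have [eP|nP] := eqVneq P (ec_opp (ec_add Q R)).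
  rewrite {1}eP ec_addNp eP ec_oppD // [ec_add (ec_opp Q) _]ec_addC //.
  by rewrite -{2}[Q]ec_oppK ec_addrK // ec_addNp.
have [ePQ|nPQ] := eqVneq P Q; first by rewrite -ePQ ec_addA_double.
have [eQR|nQR] := eqVneq Q R.
  rewrite -eQR ec_addC ?on_curve_add // ec_addA_double // [ec_add P Q]ec_addC //.
  by rewrite [RHS]ec_addC ?on_curve_add.
have [ePR|nPR] := eqVneq P R.
  by rewrite -ePR ec_addC ?on_curve_add // [ec_add P Q]ec_addC.
have [eR|nR'] := eqVneq (ec_add P Q) R.
  by rewrite -eR ec_addA_sum.
have [eP|nP'] := eqVneq P (ec_add Q R).
  rewrite [in LHS]eP [ec_add P Q]ec_addC // [RHS]ec_addC ?on_curve_add // eP.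
  by rewrite [ec_add Q R]ec_addC // ec_addA_sum.
case: P oP oPQ oNP nPN nR nP nPQ nPR nR' nP' => [p|//] oP oPQ oNP nPN nR nP nPQ nPR nR' nP'.
case: Q oQ oPQ oQR oNQ nPN nRN nR nP nPQ nQR nR' nP' => [q|]; last first.
  by rewrite ec_addp0.
move=> oQ oPQ oQR oNQ nPN nRN nR nP nPQ nQR nR' nP'.
case: R oR oQR oNR nRN nR nP nQR nPR nR' nP' => [r|]; last by rewrite !ec_addp0.
move=> oR oQR oNR nRN nR nP nQR nPR nR' nP'.
have n1 := ec_neq_x oP oQ nPQ nPN.
have n2 : q.1 - r.1 != 0.
  by apply: (ec_neq_x oQ oR) => //; apply: contraNneq nRN => ->; rewrite ec_oppK.
rewrite (ec_add_chord E n1) (ec_add_chord E n2) in oPQ oQR nP nR nR' nP' *.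
have n3 := ec_neq_x oP oQR nP' nP.
have n4 : (ch p q).1 - r.1 != 0.
  by apply: (ec_neq_x oPQ oR) => //; apply: contraNneq nR => ->; rewrite ec_oppK.
rewrite (ec_add_chord E n3) (ec_add_chord E n4) (assoc_chords (E := E)) //;
  exact: on_curveE.
Qed.

End Associativity.

Section PointGroup.

Variables (K : fieldType) (E : elliptic_curve K).

Record ec_point := EcPoint {
  ec_coords : option (K * K);
  ec_coordsP : on_curve E ec_coords
}.

HB.instance Definition _ := [isSub for ec_coords].
HB.instance Definition _ := [Choice of ec_point by <:].

Definition ec_point_zero : ec_point := @EcPoint None isT.
Definition ec_point_opp (P : ec_point) : ec_point :=
  EcPoint (on_curve_opp (ec_coordsP P)).
Definition ec_point_add (P Q : ec_point) : ec_point :=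
  EcPoint (on_curve_add (ec_coordsP P) (ec_coordsP Q)).

Fact ec_point_addA : associative ec_point_add.
Proof.
by move=> [P oP] [Q oQ] [R oR]; apply: val_inj; rewrite /= ec_addA.
Qed.

Fact ec_point_addC : commutative ec_point_add.
Proof. by move=> [P oP] [Q oQ]; apply: val_inj; rewrite /= ec_addC. Qed.

Fact ec_point_add0 : left_id ec_point_zero ec_point_add.
Proof. by move=> [P oP]; apply: val_inj. Qed.

Fact ec_point_addN : left_inverse ec_point_zero ec_point_opp ec_point_add.
Proof. by move=> [P oP]; apply: val_inj; rewrite /= ec_addNp. Qed.

HB.instance Definition _ := GRing.isZmodule.Build ec_point
  ec_point_addA ec_point_addC ec_point_add0 ec_point_addN.

End PointGroup.

Section Rank.

Variable M : zmodType.

Definition Z_independent (n : nat) (v : 'I_n -> M) : Prop :=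
  forall c : 'I_n -> int, \sum_(i < n) v i *~ c i = 0 -> forall i, c i = 0.

(* The rank of M is finite and equal to r. *)
Definition has_rank (r : nat) : Prop :=
  (exists v : 'I_r -> M, Z_independent v) /\
  (forall (n : nat) (v : 'I_n -> M), Z_independent v -> (n <= r)%N).

End Rank.

Definition Qt : fieldType := {fraction {poly rat}}.

Definition Qt_var : Qt := @FracField.tofrac {poly rat} 'X.

Fact E_AB_disc (A B : int) (hA : A != 0) :
  - 16%:R * (4%:R * 0 ^+ 3 +
             27%:R * (A%:~R * Qt_var ^+ 6 + B%:~R) ^+ 2) != 0 :> Qt.
Proof.
set q : {poly rat} := A%:~R * 'X^6 + B%:~R.
have -> : A%:~R * Qt_var ^+ 6 + B%:~R = @FracField.tofrac {poly rat} q.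
  by rewrite rmorphD rmorphM rmorphXn !rmorph_int.
have q0 : q != 0.
  apply/eqP => /(congr1 (fun p : {poly rat} => p`_6)) /eqP.
  rewrite /q -!(rmorph_int (@polyC rat)) coefD coefCM coefXn coefC coef0 /=.
  by rewrite mulr1 addr0 intr_eq0 (negPf hA).
have -> : - 16%:R * (4%:R * 0 ^+ 3 + 27%:R * @FracField.tofrac {poly rat} q ^+ 2)
    = @FracField.tofrac {poly rat} (- 432%:R * q ^+ 2).
  by rewrite rmorphM rmorphN rmorphXn rmorph_nat; ring.
rewrite tofrac_eq0 mulf_neq0 ?expf_neq0 // oppr_eq0 -polyC_natr polyC_eq0.
by rewrite Num.Theory.pnatr_eq0.
Qed.

Definition E_AB (A B : int) (hA : A != 0) : elliptic_curve Qt :=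
  @EllipticCurve Qt 0 (A%:~R * Qt_var ^+ 6 + B%:~R) (E_AB_disc B hA).

Definition rank3_case (A B alpha beta : int) : Prop :=
  [\/ A = alpha ^+ 6 /\ B = 2%:R ^+ 4 * beta ^+ 6,
      A = - (3%:R ^+ 3 * alpha ^+ 6) /\ B = 2%:R ^+ 4 * beta ^+ 6,
      A = - (3%:R ^+ 3 * alpha ^+ 6) /\ B = - (3%:R ^+ 3 * 2%:R ^+ 4 * beta ^+ 6)
    | A = alpha ^+ 6 /\ B = - (2%:R ^+ 4 * 3%:R ^+ 3 * beta ^+ 6)].

(* Main.v *)
Require Import Defs.
From HB Require Import structures.
From mathcomp Require Import all_boot all_order all_algebra all_field ring zify.
From Stdlib Require Import Classical.

(* Write D = A t^6 + B and w = exp (2 i pi / 3).  The map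
   delta (x, y) = (3 D x' - x D') / (3 D y) is additive on the points over any
   differential field.  Over C(t), up to multiplication by 6 a point splits
   into components on which the substitutions t -> -t and t -> w t act like
   elements of Z[w]; after the exchange t -> 1/t of A and B for the odd part,
   they come from points of y^2 = u^m x^3 + A u + B over C(u), u = t^6.  A
   descent along phi = [w] - [w^2], using that y - v is a cube up to an explicit
   factor over C(v), v^2 = A u + B, shows that such points form 0 for m = 0 and
   the Z[w]-module spanned by one explicit point for m = 1, 2.  Hence
     6 D delta (P) = sum_(i < 4) m_i kappa_i t^i,  m_i in Z[w],
   with explicit algebraic constants kappa_i, and delta (P) = 0 forces 6 P = 0.
   When P is defined over Q the coefficients are rational, so the i-th one
   vanishes unless kappa_i lies in Q(sqrt (-3)); when it does, the i-th generator
   or its image by phi is defined over Q.  The rank is therefore the number of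
   such i.  Three of these conditions amount to one of the cases (a)-(e), and
   all four would make 4 a rational cube. *)

Set Implicit Arguments.
Unset Strict Implicit.
Unset Printing Implicit Defensive.

Import GRing.Theory Num.Theory.
Local Open Scope ring_scope.

Local Open Scope quotient_scope.

Notation frac := (@FracField.tofrac _).

(** The passage to u = t^6 is what makes the descent explicit. The kernel of phi is {O, (0, sqrt D),
    (0, - sqrt D)}, so classes modulo cubes live in the field generated by sqrt D. Over C(t) the
    curve v^2 = D has genus 2; over C(u) the curve v^2 = A u + B is rational with parameter v. Cubic
    classes are then read off from multiplicities of roots of polynomials in v, and only the points
    v = z and v = - z above u = 0, where z^2 = B, can contribute.

    The roots of D are simple, so nothing cancels in the formula for phi: dividing by phi divides a
    height bound by 3, while adding a fixed point costs a factor 2 and a constant. The descent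
    therefore ends at points of very small degree, which are found by hand.

    The factor 6 is 2, for the splitting into even and odd parts, times 3, for the splitting into
    eigenspaces of t -> w t.

    delta turns dependence over Z, up to torsion, into linear algebra over Q on four coefficients,
    and rationality of a point into rationality of these coefficients. *)

Lemma frac_reprE (R : idomainType) (x : {fraction R}) :
  x = frac \n_(repr x) / frac \d_(repr x).
Proof.
have d0 := denom_ratioP (repr x).
apply: (mulIf (_ : frac \d_(repr x) != 0)); first by rewrite tofrac_eq0.
rewrite divfK ?tofrac_eq0 // -{1}[x]reprK; unlock FracField.tofrac.
rewrite -[LHS]FracField.pi_mul; apply/eqmodP.
rewrite /= FracField.equivfE /FracField.mulf.
by rewrite !numden_Ratio ?mulf_neq0 ?oner_neq0 // !mulr1 mulrC.
Qed.

Lemma frac_ex (R : idomainType) (x : {fraction R}) :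
  exists a b : R, b != 0 /\ x = frac a / frac b.
Proof.
by exists \n_(repr x), \d_(repr x); split; [exact: denom_ratioP | exact: frac_reprE].
Qed.

Fact frac_lift_key : unit. Proof. by []. Qed.

Section Lift.

Variables (R : idomainType) (K : fieldType) (f : {rmorphism R -> K}).

(* Locked, lest unification see a product in every value. *)
Definition frac_lift (_ : forall a, a != 0 -> f a != 0) : {fraction R} -> K :=
  locked_with frac_lift_key (fun x => f \n_(repr x) / f \d_(repr x)).

Hypothesis f0 : forall a, a != 0 -> f a != 0.

Lemma frac_liftE a b : b != 0 -> frac_lift f0 (frac a / frac b) = f a / f b.
Proof.
move=> b0; rewrite /frac_lift unlock; set x := frac a / frac b.
have d0 := denom_ratioP (repr x).
apply/eqP; rewrite eqr_div ?f0 // -!rmorphM; apply/eqP; congr (f _).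
have /eqP := frac_reprE x; rewrite {1}/x eqr_div ?tofrac_eq0 //.
by rewrite -!rmorphM tofrac_eq => /eqP ->.
Qed.

Lemma frac_lift_frac a : frac_lift f0 (frac a) = f a.
Proof. by rewrite -[frac a]divr1 -tofrac1 frac_liftE ?oner_neq0 // rmorph1 divr1. Qed.

Lemma frac_lift_is_zmod : zmod_morphism (frac_lift f0).
Proof.
move=> x y; have [a [b [b0 ->]]] := frac_ex x; have [c [d [d0 ->]]] := frac_ex y.
rewrite !frac_liftE // -mulNr addf_div ?tofrac_eq0 //.
rewrite -rmorphN -!rmorphM -rmorphD frac_liftE ?mulf_neq0 //.
rewrite -mulNr addf_div ?f0 //; congr (_ / _); last exact: rmorphM.
by rewrite rmorphD !rmorphM rmorphN.
Qed.

Lemma frac_lift_is_monoid : monoid_morphism (frac_lift f0).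
Proof.
split; first by rewrite -tofrac1 frac_lift_frac rmorph1.
move=> x y; have [a [b [b0 ->]]] := frac_ex x; have [c [d [d0 ->]]] := frac_ex y.
have -> : frac a / frac b * (frac c / frac d) = frac (a * c) / frac (b * d).
  by rewrite mulf_div !rmorphM.
by rewrite !frac_liftE ?mulf_neq0 // mulf_div !rmorphM.
Qed.

HB.instance Definition _ := GRing.isZmodMorphism.Build _ _ _ frac_lift_is_zmod.
HB.instance Definition _ := GRing.isMonoidMorphism.Build _ _ _ frac_lift_is_monoid.

End Lift.
Arguments frac_lift : simpl never.

(* Packed as a [fieldType], so that structure inference never looks inside. *)
Definition RF (k : closedFieldType) : fieldType := {fraction {poly k}}.

Section RatFun.

Variable k : closedFieldType.
Local Notation F := (RF k).

Definition pf : {poly k} -> F := @FracField.tofrac {poly k}.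
Arguments pf : simpl never.
HB.instance Definition _ :=
  GRing.isZmodMorphism.Build {poly k} F pf (@tofrac_is_zmod_morphism {poly k}).
HB.instance Definition _ :=
  GRing.isMonoidMorphism.Build {poly k} F pf (@tofrac_is_monoid_morphism {poly k}).

Lemma pf_ex (x : F) : exists a b : {poly k}, b != 0 /\ x = pf a / pf b.
Proof. exact: frac_ex. Qed.

Lemma pf_eq p q : (pf p == pf q) = (p == q).
Proof. exact: tofrac_eq. Qed.

Lemma pf_eq0 p : (pf p == 0) = (p == 0).
Proof. exact: tofrac_eq0. Qed.

Lemma pf_inj : injective pf.
Proof. by move=> p q /eqP; rewrite pf_eq => /eqP. Qed.

Definition cst : k -> F := fun c => pf c%:P.
HB.instance Definition _ := GRing.RMorphism.copy cst (pf \o @polyC k).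
Arguments cst : simpl never.

Definition tv : F := pf 'X.

Lemma pfC c : pf c%:P = cst c. Proof. by []. Qed.
Lemma pfX : pf 'X = tv. Proof. by []. Qed.

Lemma cst_eq0 c : (cst c == 0) = (c == 0).
Proof. exact: fmorph_eq0. Qed.

Lemma tv0 : tv != 0.
Proof. by rewrite pf_eq0 polyX_eq0. Qed.

(** The constants being algebraically closed, every element outside them is transcendental; this is
    the form in which the injectivity of a substitution is checked. *)
Definition transc (g : F) := forall c, g != cst c.

Definition evp (g : F) : {poly k} -> F := fun p => (map_poly cst p).[g].
Arguments evp : simpl never.
HB.instance Definition _ (g : F) :=
  GRing.RMorphism.copy (evp g) (horner_eval g \o map_poly cst).

Lemma evpX g : evp g 'X = g.
Proof. by rewrite /evp map_polyX hornerX. Qed.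

Lemma evpC g c : evp g c%:P = cst c.
Proof. by rewrite /evp map_polyC hornerC. Qed.

(** p splits into linear factors, and [g - cst x] is nonzero for each root x. *)
Lemma evp_neq0 g : transc g -> forall p, p != 0 -> evp g p != 0.
Proof.
move=> gt p p0; have [r ->] := closed_field_poly_normal p.
rewrite -mul_polyC rmorphM rmorph_prod mulf_neq0 //=.
  by rewrite evpC cst_eq0 lead_coef_eq0.
elim: r => [|x r IH]; first by rewrite big_nil oner_neq0.
rewrite big_cons; apply: mulf_neq0; last exact: IH.
have -> : evp g ('X - x%:P) = g - cst x by rewrite rmorphB /= evpX evpC.
by rewrite subr_eq0; exact: gt.
Qed.

Definition sub (g : F) (gt : transc g) : F -> F := frac_lift (evp_neq0 gt).
Arguments sub : simpl never.
HB.instance Definition _ (g : F) (gt : transc g) :=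
  GRing.isZmodMorphism.Build F F (sub gt) (frac_lift_is_zmod (evp_neq0 gt)).
HB.instance Definition _ (g : F) (gt : transc g) :=
  GRing.isMonoidMorphism.Build F F (sub gt) (frac_lift_is_monoid (evp_neq0 gt)).

Lemma sub_pf g (gt : transc g) p : sub gt (pf p) = evp g p.
Proof. exact: frac_lift_frac. Qed.

Lemma sub_cst g (gt : transc g) c : sub gt (cst c) = cst c.
Proof. by rewrite -pfC sub_pf evpC. Qed.

Lemma sub_tv g (gt : transc g) : sub gt tv = g.
Proof. by rewrite -pfX sub_pf evpX. Qed.

Lemma evp_pf p q : evp (pf q) p = pf (p \Po q).
Proof.
elim/poly_ind: p => [|p c IH]; first by rewrite comp_poly0 !rmorph0.
by rewrite comp_polyD comp_polyM comp_polyX comp_polyC !rmorphD !rmorphM /= IH evpX evpC.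
Qed.

Lemma RF_morph_eq (K : fieldType) (f1 f2 : {rmorphism F -> K}) :
  (forall c, f1 (cst c) = f2 (cst c)) -> f1 tv = f2 tv -> f1 =1 f2.
Proof.
move=> Hc Ht x; have [a [b [b0 ->]]] := pf_ex x.
suff H p : f1 (pf p) = f2 (pf p) by rewrite !fmorph_div !H.
elim/poly_ind: p => [|p c IH]; first by rewrite !rmorph0.
by rewrite !rmorphD !rmorphM /= IH pfX pfC Ht Hc.
Qed.

Lemma transc_pf (p : {poly k}) : (1 < size p)%N -> transc (pf p).
Proof.
move=> sp c; rewrite -pfC pf_eq; apply/eqP => E.
by move: sp; rewrite E size_polyC; case: (c != 0).
Qed.

Lemma transc_tv : transc tv.
Proof. by apply: transc_pf; rewrite size_polyX. Qed.

Lemma transcV g : transc g -> transc g^-1.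
Proof.
move=> gt c; apply: contra (gt c^-1) => /eqP E.
by rewrite fmorphV /= -E invrK.
Qed.

End RatFun.
Arguments pf {k}.
Arguments cst {k}.
Arguments tv {k}.
Global Opaque RF pf cst evp sub tv.

(** * Twisted base change and the homomorphism delta *)

Section Twist.

Variables (K K' : fieldType) (f : {rmorphism K -> K'}) (s : K').
Variables (E : elliptic_curve K) (E' : elliptic_curve K').
Hypothesis s0 : s != 0.
Hypothesis Ha : ec_a E' = s ^+ 4 * f (ec_a E).
Hypothesis Hb : ec_b E' = s ^+ 6 * f (ec_b E).

(** Base change along [f] followed by the sextic twist by [s]. This one construction yields the
    action of w ([s] = w^2), the action of field automorphisms and the inclusion of Q(t) in C(t)
    ([s] = 1), and the inversion t -> 1/t ([s] = t). *)
Definition tw_coords (P : option (K * K)) : option (K' * K') :=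
  if P is Some (x, y) then Some (s ^+ 2 * f x, s ^+ 3 * f y) else None.

Lemma tw_on P : on_curve E P -> on_curve E' (tw_coords P).
Proof.
case: P => [[x y]|] //= /eqP H; rewrite Ha Hb.
have -> : (s ^+ 3 * f y) ^+ 2 = s ^+ 6 * f (y ^+ 2) by rewrite rmorphXn; ring.
by rewrite H !rmorphD rmorphM rmorphXn; apply/eqP; ring.
Qed.

Lemma tw_add P Q : tw_coords (ec_add E P Q) = ec_add E' (tw_coords P) (tw_coords Q).
Proof.
case: P Q => [[x1 y1]|] [[x2 y2]|] //; rewrite /ec_add /=.
have s2 : s ^+ 2 != 0 by rewrite expf_neq0.
have s3 : s ^+ 3 != 0 by rewrite expf_neq0.
rewrite (inj_eq (mulfI s2)) fmorph_eq -mulrN -rmorphN (inj_eq (mulfI s3)) fmorph_eq.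
case: eqVneq => [->|n] /=.
  case: eqVneq => [//|ny] /=; congr Some; rewrite /ec_tangent /ec_line /=.
  set l := _ / _; set l' := _ / _.
  have -> : l' = s * f l.
    rewrite /l /l' Ha !(rmorphM, rmorphD, fmorphV, rmorphXn, rmorph_nat) /=.
    (* For arbitrary coordinates the tangent may be vertical; as 0^-1 = 0, both slopes are then
       0. *)
    have [z|y0] := eqVneq (2%:R * f y1) 0.
      by rewrite [2%:R * (_ * _)]mulrCA z mulr0 invr0 !mulr0.
    by field; move: y0; rewrite mulf_eq0 negb_or s0 => /andP[-> ->].
  by congr pair; rewrite !(rmorphB, rmorphM, rmorphXn) /=; ring.
congr Some; rewrite /ec_chord /ec_line /=.
set l := _ / _; set l' := _ / _.
have -> : l' = s * f l.
  rewrite /l /l' !(rmorphM, rmorphB, fmorphV) /=.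
  have n' : f x1 - f x2 != 0 by rewrite subr_eq0 fmorph_eq.
  by field; rewrite n' -mulrBr mulf_neq0.
by congr pair; rewrite !(rmorphB, rmorphM, rmorphXn) /=; ring.
Qed.

Definition tw (_ : s != 0) (P : ec_point E) : ec_point E' :=
  EcPoint (tw_on (ec_coordsP P)).

Lemma tw_is_zmod : zmod_morphism (tw s0).
Proof.
move=> P Q; apply: val_inj => /=; rewrite tw_add; congr ec_add.
by case: (ec_coords Q) => [[x y]|] //=; rewrite rmorphN mulrN.
Qed.

HB.instance Definition _ := GRing.isZmodMorphism.Build _ _ _ tw_is_zmod.

End Twist.

Section Delta.

Variables (K : fieldType) (d : K -> K) (E : elliptic_curve K).
Local Notation b := (ec_b E).
Hypothesis dD : {morph d : x y / x + y}.
Hypothesis dM : forall x y, d (x * y) = d x * y + x * d y.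
Hypothesis a0 : ec_a E = 0.

Lemma der0 : d 0 = 0.
Proof. by apply: (addrI (d 0)); rewrite -dD !addr0. Qed.

Lemma derN x : d (- x) = - d x.
Proof. by apply/eqP; rewrite -subr_eq0 opprK -dD addNr der0. Qed.

Lemma derX2 x : d (x ^+ 2) = 2%:R * x * d x.
Proof. by rewrite expr2 dM; ring. Qed.

Lemma derX3 x : d (x ^+ 3) = 3%:R * x ^+ 2 * d x.
Proof. by rewrite exprS dM derX2; ring. Qed.

Lemma ec_b_neq0 : b != 0.
Proof. by apply: contraNneq (ec_disc E) => ->; rewrite a0; apply/eqP; ring. Qed.

Lemma ec_3_neq0 : 3%:R != 0 :> K.
Proof.
apply: contraNneq (ec_disc E) => n3; rewrite a0.
have -> : 27%:R = 3%:R * 9%:R :> K by ring.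
by rewrite n3; apply/eqP; ring.
Qed.

(** This is the invariant differential in disguise. Once D^(1/6) is adjoined, with D = b, the point
    X = x / D^(1/3), Y = y / D^(1/2) lies on the constant curve Y^2 = X^3 + 1, and X' / Y is D^(1/6)
    times this expression. *)
Definition delta_coords (P : option (K * K)) : K :=
  if P is Some (x, y) then (3%:R * b * d x - x * d b) / (3%:R * b * y) else 0.

Definition delta (P : ec_point E) := delta_coords (ec_coords P).

Hypothesis y0 : forall x y, on_curve E (Some (x, y)) -> y != 0.

Lemma der_curve x y : y ^+ 2 = x ^+ 3 + b -> 2%:R * y * d y = 3%:R * x ^+ 2 * d x + d b.
Proof. by move=> H; rewrite -derX2 H dD derX3. Qed.

Lemma der_div x y : y != 0 -> d (x / y) = (d x * y - x * d y) / y ^+ 2.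
Proof.
move=> yn; have H : d x = d (x / y) * y + x / y * d y by rewrite -dM divfK.
by rewrite H; field.
Qed.

(** Additivity is that of the invariant differential. Differentiating the equation of the curve
    eliminates the derivatives of the ordinates; those of the abscissas and of b then act as free
    variables, and a rational identity modulo the equation of the curve remains. *)
Lemma delta_coords_add P Q : on_curve E P -> on_curve E Q ->
  delta_coords (ec_add E P Q) = delta_coords P + delta_coords Q.
Proof.
move=> oP oQ; have := on_curve_add oP oQ.
have [[b0 n3] n2] := (ec_b_neq0, ec_3_neq0, nz2 E).
case: (ec_addP oP oQ) => {P Q oP oQ} /=.
- by move=> Q' *; rewrite add0r.
- by move=> P' *; rewrite addr0.
- by move=> x y *; rewrite mulrN invrN mulrN subrr.
- move=> [x y] H /= yn oS; have := y0 oS; move: {oS} H.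
  rewrite /= a0 mul0r addr0 => H; have Hd := der_curve H.
  rewrite /ec_tangent /ec_line /= addr0; set l := _ / _ => y3.
  rewrite !(dD, derN, derX2).
  have -> : d l = (6%:R * x * d x * y - 3%:R * x ^+ 2 * d y) / (2%:R * y ^+ 2).
    rewrite der_div ?mulf_neq0 //.
    have E2 : d 2%:R = 0.
      have -> : 2%:R = 1 + 1 :> K by ring.
      have d1 : d 1 = 0 by apply: (addrI (d 1)); rewrite addr0 -{3}(mulr1 1) dM; ring.
      by rewrite dD d1 addr0.
    have E3 : d (3%:R * x ^+ 2) = 6%:R * x * d x.
      have -> : 3%:R * x ^+ 2 = x ^+ 2 + x ^+ 2 + x ^+ 2 by ring.
      by rewrite !dD derX2; ring.
    by rewrite E3 dM E2; field; rewrite yn.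
  have Ey : d y = (3%:R * x ^+ 2 * d x + d b) / (2%:R * y) by rewrite -Hd; field; rewrite yn.
  have Eb : b = y ^+ 2 - x ^+ 3 by rewrite H; ring.
  move: b0 y3; rewrite Ey /l; move: (d x) (d b) => x' b'; rewrite Eb => b0 y3.
  field. rewrite yn n2 n3 b0 /=.
  by apply: (nz_scale (m := (2 * y) ^+ 3) y3); [rewrite !(expf_neq0, mulf_neq0) | field; rewrite yn n2].
move=> [x1 y1] [x2 y2] H1 H2 /= n oS; have := y0 oS; move: {oS} H1 H2.
rewrite /= a0 !mul0r !addr0 => H1 H2; have Hd1 := der_curve H1; have Hd2 := der_curve H2.
have yn1 : y1 != 0 by apply: (y0 (x := x1)); rewrite /= H1 a0 mul0r addr0.
have yn2 : y2 != 0 by apply: (y0 (x := x2)); rewrite /= H2 a0 mul0r addr0.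
rewrite /ec_chord /ec_line /=; set l := _ / _ => y3.
rewrite !(dD, derN, derX2).
have -> : d l = ((d y1 - d y2) * (x1 - x2) - (y1 - y2) * (d x1 - d x2)) / (x1 - x2) ^+ 2.
  by rewrite der_div // !(dD, derN).
have -> : d y1 = (3%:R * x1 ^+ 2 * d x1 + d b) / (2%:R * y1) by rewrite -Hd1; field; rewrite yn1.
have -> : d y2 = (3%:R * x2 ^+ 2 * d x2 + d b) / (2%:R * y2) by rewrite -Hd2; field; rewrite yn2.
move: (d x1) (d x2) (d b) => x1' x2' b'.
rewrite /l in y3 *; field: H1 H2; rewrite yn1 yn2 n2 n3 b0 n /= andbT.
by apply: (nz_scale (m := (x1 - x2) ^+ 3) y3); [rewrite !(expf_neq0, mulf_neq0) | field; rewrite n].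
Qed.

Lemma deltaD : {morph delta : P Q / P + Q}.
Proof. by move=> [P oP] [Q oQ]; exact: delta_coords_add. Qed.

Lemma delta_is_zmod : zmod_morphism delta.
Proof.
move=> P Q; apply: (addIr (delta Q)); rewrite subrK -deltaD subrK //.
Qed.

HB.instance Definition _ := GRing.isZmodMorphism.Build _ _ _ delta_is_zmod.

End Delta.

(** The quotient x / y scales by 1 / s, and the terms in the derivative of s cancel between 3 b x'
    and x b'; the factor c comes from the chain rule. *)
Lemma delta_tw (K K' : fieldType) (f : {rmorphism K -> K'}) (s : K')
    (E : elliptic_curve K) (E' : elliptic_curve K') (s0 : s != 0)
    (Ha : ec_a E' = s ^+ 4 * f (ec_a E)) (Hb : ec_b E' = s ^+ 6 * f (ec_b E))
    (d : K -> K) (d' : K' -> K') (c : K') :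
  {morph d' : x y / x + y} -> (forall x y, d' (x * y) = d' x * y + x * d' y) ->
  (forall x, d' (f x) = c * f (d x)) -> ec_a E = 0 ->
  (forall x y, on_curve E' (Some (x, y)) -> y != 0) ->
  forall P, delta d' (tw Ha Hb s0 P) = c / s * f (delta d P).
Proof.
move=> dD dM Hc a0 y0 [[[x y]|] oP]; rewrite /delta /=; last by rewrite rmorph0 mulr0.
have a0' : ec_a E' = 0 by rewrite Ha a0 rmorph0 mulr0.
have yn : f y != 0.
  by have := y0 _ _ (tw_on Ha Hb oP); rewrite mulf_eq0 negb_or => /andP[].
have bn : f (ec_b E) != 0 by rewrite fmorph_eq0; exact: ec_b_neq0.
have n3 := ec_3_neq0 a0'.
have d6 : d' (s ^+ 6) = 6%:R * s ^+ 5 * d' s.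
  have -> : s ^+ 6 = s ^+ 3 * s ^+ 3 by ring.
  by rewrite dM (derX3 dM); ring.
rewrite Hb [d' (s ^+ 6 * _)]dM [d' (s ^+ 2 * _)]dM d6 (derX2 dM) !Hc !(rmorphM, fmorphV, rmorphB, rmorph_nat) /=.
by field; rewrite n3 bn yn s0.
Qed.

(** * The cubic class of y - w *)

Section PolyCube.

Variable k : closedFieldType.
Implicit Types (p q s : {poly k}) (a b c : k).

Lemma closed_root n a : (0 < n)%N -> exists b, b ^+ n = a.
Proof.
move=> n0; have [b Hb] := solve_monicpoly (fun i => if i == 0 then a else 0) n0.
exists b; rewrite Hb; case: n n0 {Hb} => // n _; rewrite big_ord_recl /= expr0 mulr1.
by rewrite big1 ?addr0 // => i _; rewrite mul0r.
Qed.

Lemma mupX x p n : p != 0 -> mup x (p ^+ n) = (n * mup x p)%N.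
Proof.
move=> p0; elim: n => [|n IH]; first by rewrite expr0 mupNroot ?root1.
by rewrite exprS mupM ?expf_neq0 // IH mulSn.
Qed.

Lemma mup_split x p : p != 0 ->
  exists q, [/\ q != 0, p = ('X - x%:P) ^+ mup x p * q & ~~ root q x].
Proof.
move=> p0; have [m [q]] := multiplicity_XsubC p x; rewrite p0 /= => rq E.
have q0 : q != 0 by apply: contraNneq rq => ->; rewrite root0.
exists q; split=> //; rewrite mulrC E; congr (_ * _ ^+ _).
by rewrite mupMr // mup_XsubCX eqxx.
Qed.

Lemma poly_cube p : p != 0 -> (forall x, 3 %| mup x p)%N -> exists s, p = s ^+ 3.
Proof.
have [n] := ubnP (size p); elim: n p => // n IH p sp p0 Hp.
have [sp1|sp1] := leqP (size p) 1.
  have [c Ec] := closed_root p`_0 (isT : 0 < 3)%N; exists c%:P.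
  by rewrite {1}(size1_polyC sp1) -Ec rmorphXn.
have /closed_rootP [x rx] : size p != 1 by rewrite gtn_eqF.
have [q [q0 E rq]] := mup_split x p0.
have mx : (0 < mup x p)%N by rewrite -XsubC_dvd // dvdp_XsubCl.
have [||s Es] := IH q _ q0.
- rewrite E size_mul ?expf_neq0 ?polyXsubC_eq0 // size_exp_XsubC addSn /= in sp.
  by rewrite -ltnS (leq_trans _ sp) // ltnS -[X in (X <= _)%N]add1n leq_add2r.
- move=> y; have [->|ny] := eqVneq y x; first by rewrite mupNroot.
  move: (Hp y); rewrite E mupM ?expf_neq0 ?polyXsubC_eq0 // mup_XsubCX.
  by rewrite eq_sym (negPf ny).
have /dvdnP [j Ej] := Hp x.
by exists (('X - x%:P) ^+ j * s); rewrite exprMn -exprM -Ej -Es -E.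
Qed.

Lemma compNK p : (p \Po - 'X) \Po - 'X = p.
Proof. by rewrite -comp_polyA raddfN /= comp_polyX opprK comp_polyXr. Qed.

Lemma compN_neq0 p : p != 0 -> p \Po - 'X != 0.
Proof. by apply: contraNneq => E; rewrite -(compNK p) E comp_poly0. Qed.

Lemma mup_compN x p : p != 0 -> mup x (p \Po - 'X) = mup (- x) p.
Proof.
have H q y : q != 0 -> (mup y q <= mup (- y) (q \Po - 'X))%N.
  move=> q0; rewrite mup_geq ?compN_neq0 //.
  have /(dvdp_comp_poly (- 'X)) : ('X - y%:P) ^+ mup y q %| q by rewrite -mup_geq.
  apply: dvdp_trans; rewrite rmorphXn /= comp_polyB comp_polyX comp_polyC.
  by rewrite polyCN opprK -opprD exprNn dvdp_mull.
move=> p0; apply/eqP; rewrite eqn_leq.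
have := H _ x (compN_neq0 p0); rewrite compNK => ->.
by have := H _ (- x) p0; rewrite opprK.
Qed.

(** Congruences modulo 3 between multiplicities: a, a' are those of b - e w at x and - x, and e, c,
    d those of the denominator and of the two parts of the abscissa at x. The booleans say whether x
    is z or - z. *)
Fact ar_out (a a' e c d m : nat) :
  (a + a' + 3 * c = 2 * e + m * (false + false) + 3 * d)%N ->
  a = a' \/ (e = 0%N /\ (a = 0%N \/ a' = 0%N)) \/ (a = 0%N /\ a' = 0%N) ->
  (3 %| a + 2 * e)%N.
Proof. rewrite muln0; lia. Qed.

Fact ar_pole (e c d m : nat) :
  (0 + 0 + 3 * c = 2 * e + m * (true + false) + 3 * d)%N -> (3 %| 0 + 2 * e + m * 1)%N.
Proof. lia. Qed.

Fact ar_in (a a' c d m : nat) : (m < 3)%N ->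
  (a + a' + 3 * c = 2 * 0 + m * (true + false) + 3 * d)%N ->
  a = 0%N \/ a' = 0%N ->
  (3 %| a)%N /\ (a' %% 3)%N = m \/ (3 %| a')%N /\ (a %% 3)%N = m.
Proof. lia. Qed.

Fact ar_mod (a m : nat) : (a %% 3 = m)%N -> (m <= a)%N /\ (3 %| a - m)%N.
Proof. lia. Qed.

(** With y = b / e, the polynomial (b - e w) e^2 is y - w up to a cube. Its conjugate under w -> - w
    is b + e w, and the two have a common root only at w = 0, where their multiplicities agree by
    symmetry. Hence every multiplicity away from z and - z is divisible by 3. At these two points
    the factor (w^2 - z^2)^m leaves m modulo 3: on both sides if y has poles there, on exactly one
    side otherwise. *)
Lemma selmer_poly (z c : k) (m : nat) (b e x1 x2 : {poly k}) :
    z != 0 -> c != 0 -> (m < 3)%N -> 2%:R != 0 :> k ->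
    b \Po - 'X = b -> e \Po - 'X = e -> coprimep b e -> e != 0 ->
    x1 != 0 -> x2 != 0 ->
    (b - e * 'X) * (b + e * 'X) * x2 ^+ 3 =
      c *: (e ^+ 2 * ('X ^+ 2 - (z ^+ 2)%:P) ^+ m * x1 ^+ 3) ->
  exists s, [\/ (b - e * 'X) * e ^+ 2 * ('X ^+ 2 - (z ^+ 2)%:P) ^+ m = s ^+ 3,
     (b - e * 'X) * e ^+ 2 = ('X - z%:P) ^+ m * s ^+ 3
   | (b - e * 'X) * e ^+ 2 = ('X + z%:P) ^+ m * s ^+ 3].
Proof.
move=> z0 c0 m3 n2 Eb Ee cop e0 x10 x20 E.
have Nz : z != - z by rewrite -addr_eq0 -mulr2n -mulr_natl mulf_neq0.
have Eth : 'X ^+ 2 - (z ^+ 2)%:P = ('X - z%:P) * ('X - (- z)%:P) :> {poly k}.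
  by rewrite polyCN rmorphXn /=; ring.
set th := 'X ^+ 2 - _ in E Eth *; set p := b - _ in E *; set pb := b + _ in E *.
have th0 : th != 0 by rewrite Eth mulf_neq0 ?polyXsubC_eq0.
have : p * pb * x2 ^+ 3 != 0.
  by rewrite E scaler_eq0 negb_or c0 !mulf_neq0 ?expf_neq0.
rewrite !mulf_eq0 !negb_or => /andP[/andP[p0 pb0] _].
have Epb : pb = p \Po - 'X.
  by rewrite /p comp_polyB comp_polyM comp_polyX Eb Ee mulrN opprK.
have mpb x : mup x pb = mup (- x) p by rewrite Epb mup_compN.
have me x : mup (- x) e = mup x e by rewrite -{2}Ee mup_compN.
have mth x : mup x th = ((x == z)%R + (x == - z)%R)%N.
  rewrite Eth mupM ?polyXsubC_eq0 // !(@mup_XsubCX _ 1) ![_ == x]eq_sym.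
  by do 2!case: (_ == _).
have mE x : (mup x p + mup (- x) p + 3 * mup x x2 =
             2 * mup x e + m * ((x == z)%R + (x == - z)%R) + 3 * mup x x1)%N.
  have := congr1 (mup x) E.
  rewrite -mul_polyC [mup x (c%:P * _)]mupMr ?rootC //.
  do 2!rewrite mupM ?mulf_neq0 ?expf_neq0 //; rewrite [mup x (_ * x1 ^+ 3)]mupM ?mulf_neq0 ?expf_neq0 //.
  rewrite [mup x (_ * th ^+ m)]mupM ?expf_neq0 //.
  by rewrite !mupX // mpb mth !mulSn !mul0n !addn0.
have pe x : (0 < mup x e)%N -> mup x p = 0%N.
  rewrite -XsubC_dvd // dvdp_XsubCl => rx; apply: mupNroot.
  rewrite /p /root !hornerE (eqP rx) mul0r subr0.
  by apply: (coprimep_root _ rx); rewrite coprimep_sym.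
have pp x : x != 0 -> mup x e = 0%N -> mup x p = 0%N \/ mup (- x) p = 0%N.
  move=> xn ex; have [//|mx] := posnP (mup x p); first by left.
  right; rewrite -mpb; apply: mupNroot.
  move: mx; rewrite -XsubC_dvd // dvdp_XsubCl /root /p /pb !hornerE subr_eq0 => /eqP ->.
  rewrite -mulr2n -mulr_natl !mulf_neq0 //.
  by rewrite -[_ == 0]/(root e x) -dvdp_XsubCl XsubC_dvd // ex.
have q0 : p * e ^+ 2 != 0 by rewrite mulf_neq0 ?expf_neq0.
have mq x : mup x (p * e ^+ 2) = (mup x p + 2 * mup x e)%N.
  by rewrite mupM ?expf_neq0 // mupX.
have gen x : x != z -> x != - z -> (3 %| mup x p + 2 * mup x e)%N.
  move=> /negPf xz /negPf xnz; have := mE x; rewrite xz xnz => /ar_out; apply.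
  have [->|xn] := eqVneq x 0; first by left; rewrite oppr0.
  right; have [ex|ex] := posnP (mup x e); first by left; split; last exact: pp.
  by right; split; apply: pe; rewrite ?me.
have := mE z; rewrite eqxx (negPf Nz) => mz.
(* If e vanishes at z, it vanishes at - z by parity, and p at neither: this is the first
   alternative. Otherwise p cannot vanish at both z and - z, since z is nonzero. *)
have [ez|ez] := posnP (mup z e); last first.
  have pz := pe _ ez; have pnz := pe (- z); rewrite me in pnz; have {}pnz := pnz ez.
  have mz' := mz; rewrite pz pnz in mz'.
  suff [s Es] : exists s, p * e ^+ 2 * th ^+ m = s ^+ 3 by exists s; apply: Or31.
  apply: poly_cube => [|x]; first by rewrite mulf_neq0 ?expf_neq0.
  rewrite mupM ?expf_neq0 // mupX // mth mq.
  have [->|xz] := eqVneq x z; first by rewrite pz (negPf Nz); exact: (ar_pole mz').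
  have [->|xnz] := eqVneq x (- z); first by rewrite me pnz; exact: (ar_pole mz').
  by rewrite muln0 addn0; exact: gen.
have onep y : y ^+ 2 = z ^+ 2 -> (3 %| mup (- y) p)%N -> (mup y p %% 3 = m)%N -> 
    exists s, p * e ^+ 2 = ('X - y%:P) ^+ m * s ^+ 3.
  move=> /eqP; rewrite eqf_sqr => yz d1 d2.
  have ey : mup y e = 0%N by case/orP: yz => /eqP ->; rewrite ?me.
  have [my dy] := ar_mod d2.
  have : (m <= mup y (p * e ^+ 2))%N by rewrite mq ey addn0.
  rewrite mup_geq // => /dvdpP [q Eq].
  have qn0 : q != 0 by apply: contraNneq q0 => qz; rewrite Eq qz mul0r.
  suff [s Es] : exists s, q = s ^+ 3 by exists s; rewrite Eq Es mulrC.
  apply: poly_cube => // x; have := mq x.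
  rewrite Eq mupM ?expf_neq0 ?polyXsubC_eq0 // mup_XsubCX.
  have [<-|ny] := eqVneq y x.
    by rewrite ey addn0 => Em; move: dy; rewrite -Em addnK.
  rewrite addn0 => ->.
  have [->|xny] := eqVneq x (- y); first by rewrite me ey addn0.
  rewrite eq_sym in ny; case/orP: yz => /eqP yz; first by apply: gen; rewrite -yz.
  by apply: gen; rewrite -?yz //; move: xny; rewrite yz opprK.
rewrite ez in mz; case: (ar_in m3 mz (pp _ z0 ez)) => -[d1 d2].
  have [|||s Es] := onep (- z); rewrite ?sqrrN ?opprK //.
  by exists s; apply: Or33; rewrite Es polyCN opprK.
by have [|||s Es] := onep z => //; exists s; apply: Or32.
Qed.

End PolyCube.

(** The product of y + w over the three points of a line y = l x + n is (n + w)^3: eliminate x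
    between the line and the curve, and evaluate the resulting cubic in y at - w. The third point is
    the opposite of the sum, whence the sign. This is the multiplicativity of the cubic class. *)
Lemma collinear_cube (K : fieldType) (U x1 y1 x2 y2 w : K) :
  U != 0 -> x1 - x2 != 0 ->
  y1 ^+ 2 = U * x1 ^+ 3 + w ^+ 2 -> y2 ^+ 2 = U * x2 ^+ 3 + w ^+ 2 ->
  let l := (y1 - y2) / (x1 - x2) in let x3 := l ^+ 2 / U - x1 - x2 in
  (y1 + w) * (y2 + w) * (w - (l * (x1 - x3) - y1)) = (y1 - l * x1 + w) ^+ 3.
Proof.
move=> U0 n H1 H2 /=.
have EU : U * x1 ^+ 3 = y1 ^+ 2 - w ^+ 2 by rewrite H1 addrK.
by field: H1 H2; rewrite U0 n.
Qed.

Lemma quad_div (K : fieldType) (a1 a2 b1 b2 w : K) :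
  b1 + b2 * - w != 0 -> b1 + b2 * w != 0 ->
  (a1 + a2 * w) / (b1 + b2 * w) =
  (a1 * b1 - a2 * b2 * w ^+ 2) / ((b1 + b2 * - w) * (b1 + b2 * w)) +
  (a2 * b1 - a1 * b2) / ((b1 + b2 * - w) * (b1 + b2 * w)) * w.
Proof. by move=> n1 n3; field; rewrite n1 n3. Qed.

Lemma selmer_clear (K : fieldType) (U b e x1 x2 w : K) : e != 0 -> x2 != 0 ->
  (b / e) ^+ 2 = U * (x1 / x2) ^+ 3 + w ^+ 2 ->
  (b - e * w) * (b + e * w) * x2 ^+ 3 = e ^+ 2 * U * x1 ^+ 3.
Proof.
move=> e0 x20 H; have -> : b = e * (b / e) by rewrite mulrCA mulfV // mulr1.
set v := b / e in H *.
have -> : x1 = x2 * (x1 / x2) by rewrite mulrCA mulfV // mulr1.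
set x := x1 / x2 in H *.
rewrite (_ : _ * _ * _ = e ^+ 2 * (v ^+ 2 - w ^+ 2) * x2 ^+ 3); last by ring.
by rewrite H; ring.
Qed.

Lemma selmer_div (K : fieldType) (b e w V s : K) : e != 0 ->
  (b - e * w) * e ^+ 2 * V = s ^+ 3 -> (b / e - w) * V = (s / e) ^+ 3.
Proof. by move=> e0 H; rewrite exprMn -H; field. Qed.

Lemma selmer_div2 (K : fieldType) (b e w V s : K) : e != 0 ->
  (b - e * w) * e ^+ 2 = V * s ^+ 3 -> b / e - w = V * (s / e) ^+ 3.
Proof. by move=> e0 H; rewrite exprMn mulrA -H; field. Qed.

Lemma pf_coprime_ex (k : closedFieldType) (x : RF k) :
  exists a b : {poly k}, [/\ b != 0, coprimep a b & x = pf a / pf b].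
Proof.
have [a [b [b0 ->]]] := pf_ex x; pose g := gcdp a b.
have g0 : g != 0 by rewrite gcdp_eq0 negb_and b0 orbT.
have Ea : a = a %/ g * g by rewrite divpK ?dvdp_gcdl.
have Eb : b = b %/ g * g by rewrite divpK ?dvdp_gcdr.
have b1 : b %/ g != 0 by apply: contraNneq b0 => E; rewrite Eb E mul0r.
exists (a %/ g), (b %/ g); split=> //; first by rewrite coprimep_div_gcd ?b0 ?orbT.
by rewrite {1}Ea {1}Eb !rmorphM /= -mulf_div divff ?mulr1 // pf_eq0.
Qed.

Lemma cubic_sum_alg (K : fieldType) (y w P Q S G C : K) : G != 0 -> C != 0 ->
  (y - w) * (S * (P * Q)) = - (S * C^-1) * (P * G ^+ 3 * (C * Q) * (w - y)) / G ^+ 3.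
Proof. by move=> G0 C0; field; rewrite C0 G0. Qed.

Section Conj.

Variable k : closedFieldType.
Hypothesis n2 : 2%:R != 0 :> k.
Variables A B : k.
Hypothesis A0 : A != 0.
Local Notation F := (RF k).
Local Notation w := (@tv k).
Local Notation u := (@tv k).

(* Here the variable of [RF k] is [w] with [w^2 = A u + B]; [iw] embeds k(u), and [cw] is w -> - w. *)
Definition qAB : {poly k} := A^-1 *: ('X ^+ 2 - B%:P).

Lemma size_qAB : size qAB = 3.
Proof. by rewrite size_scale ?invr_eq0 // size_XnsubC. Qed.

Lemma transc_qAB : transc (pf qAB).
Proof. by apply: transc_pf; rewrite size_qAB. Qed.

Definition iw : F -> F := sub transc_qAB.
Arguments iw : simpl never.
HB.instance Definition _ := GRing.RMorphism.copy iw (sub transc_qAB).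

Lemma transc_Nw : transc (- w).
Proof. by move=> c; rewrite eqr_oppLR -rmorphN; exact: transc_tv. Qed.

Definition cw : F -> F := sub transc_Nw.
Arguments cw : simpl never.
HB.instance Definition _ := GRing.RMorphism.copy cw (sub transc_Nw).

Lemma cw_w : cw w = - w. Proof. exact: sub_tv. Qed.
Lemma cw_cst c : cw (cst c) = cst c. Proof. exact: sub_cst. Qed.
Lemma iw_cst c : iw (cst c) = cst c. Proof. exact: sub_cst. Qed.

Lemma iw_pf p : iw (pf p) = pf (p \Po qAB).
Proof. by rewrite /iw sub_pf evp_pf. Qed.

Lemma pf_qAB : pf qAB = cst A^-1 * (w ^+ 2 - cst B).
Proof. by rewrite /qAB -mul_polyC rmorphM rmorphB rmorphXn. Qed.

Lemma iw_u : cst A * iw u = w ^+ 2 - cst B.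
Proof.
rewrite /iw sub_tv /qAB -mul_polyC !rmorphM rmorphB rmorphXn /= ?pfC ?pfX.
by rewrite mulrA -rmorphM mulfV // rmorph1 mul1r.
Qed.

Lemma iw_W : iw (cst A * u + cst B) = w ^+ 2.
Proof. by rewrite rmorphD rmorphM /= !iw_cst iw_u subrK. Qed.

Lemma cw_iw x : cw (iw x) = iw x.
Proof.
apply: (RF_morph_eq (f1 := cw \o iw) (f2 := iw)) => [c|] /=.
  by rewrite iw_cst cw_cst.
have A0' : cst A != 0 by rewrite cst_eq0.
apply: (mulfI A0'); rewrite -{1}(cw_cst A) -rmorphM iw_u rmorphB rmorphXn /= cw_w.
by rewrite cw_cst sqrrN.
Qed.

Lemma n2F : 2%:R != 0 :> F.
Proof. by rewrite -(rmorph_nat cst) cst_eq0. Qed.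

Lemma iw_indep p q : iw p + iw q * w = 0 -> p = 0 /\ q = 0.
Proof.
move=> E; have := congr1 cw E; rewrite rmorphD rmorphM rmorph0 /= !cw_iw cw_w => E'.
have Ep : 2%:R * iw p = 0 by rewrite -(addr0 0) -{1}E -E'; ring.
have Eq : 2%:R * w * iw q = 0 by rewrite -(subr0 0) -{1}E -E'; ring.
split; apply/eqP; rewrite -(fmorph_eq0 iw); apply/eqP.
  by apply: (mulfI n2F); rewrite Ep mulr0.
by apply: (mulfI (mulf_neq0 n2F (tv0 k))); rewrite Eq mulr0.
Qed.

Lemma iw_sqr p : pf (p \Po 'X^2) = iw (pf (p \Po (A *: 'X + B%:P))).
Proof.
rewrite iw_pf -comp_polyA; congr (pf (_ \Po _)).
rewrite comp_polyD comp_polyZ comp_polyX comp_polyC /qAB scalerA mulfV // scale1r.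
by rewrite subrK.
Qed.

Lemma iw_decomp_poly (p : {poly k}) : exists a b, pf p = iw a + iw b * w.
Proof.
have -> : p = even_poly p \Po 'X^2 + (odd_poly p \Po 'X^2) * 'X.
  by rewrite poly_even_odd.
by rewrite rmorphD rmorphM /= !iw_sqr; do 2!eexists.
Qed.

Lemma iw_decomp (g : F) : exists p q, g = iw p + iw q * w.
Proof.
have [a [b [b0 ->]]] := pf_ex g.
have [a1 [a2 ->]] := iw_decomp_poly a; have [b1 [b2 Eb]] := iw_decomp_poly b.
have : pf b != 0 by rewrite pf_eq0.
have : cw (pf b) != 0 by rewrite fmorph_eq0 pf_eq0.
rewrite Eb rmorphD rmorphM /= !cw_iw cw_w => n1 n3.
have nn := mulf_neq0 n1 n3.
set W := cst A * u + cst B; have EW : w ^+ 2 = iw W by rewrite iw_W.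
have EN : (iw b1 + iw b2 * - w) * (iw b1 + iw b2 * w) = iw (b1 ^+ 2 - b2 ^+ 2 * W).
  by rewrite rmorphB !rmorphM /= -EW; ring.
exists ((a1 * b1 - a2 * b2 * W) / (b1 ^+ 2 - b2 ^+ 2 * W)).
exists ((a2 * b1 - a1 * b2) / (b1 ^+ 2 - b2 ^+ 2 * W)).
rewrite !fmorph_div /= -EN !rmorphB !rmorphM /= -EW.
exact: (quad_div (iw a1) (iw a2) n1 n3).
Qed.

(* The class of [y - w] is trivial: [(y - w) (A u)^m] is the cube of [p + q w]. *)
Definition cubic_class (m : nat) (Y : F) : Prop := exists p q : F,
  Y * (cst A * u) ^+ m = p ^+ 3 + 3%:R * p * q ^+ 2 * (cst A * u + cst B) /\
  - (cst A * u) ^+ m = 3%:R * p ^+ 2 * q + q ^+ 3 * (cst A * u + cst B).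

Lemma cubic_classI m Y g :
  (iw Y - w) * (w ^+ 2 - cst B) ^+ m = g ^+ 3 -> cubic_class m Y.
Proof.
have [p [q ->]] := iw_decomp g => E; exists p, q.
set W := cst A * u + cst B; have EW : w ^+ 2 = iw W by rewrite iw_W.
set V := (cst A * u) ^+ m.
have EV : (w ^+ 2 - cst B) ^+ m = iw V by rewrite -iw_u rmorphXn rmorphM /= iw_cst.
clearbody W V; have [] := @iw_indep (Y * V - (p ^+ 3 + 3%:R * p * q ^+ 2 * W))
                     (- V - (3%:R * p ^+ 2 * q + q ^+ 3 * W)).
  rewrite !(rmorphB, rmorphD, rmorphN, rmorphM, rmorphXn, rmorph_nat) /= -EW -EV.
  rewrite -(subrr ((iw p + iw q * w) ^+ 3)) -{1}E; ring.
by move=> /subr0_eq E1 /subr0_eq E2; exact: (conj E1 E2).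
Qed.

(** In terms of w, the function Y of u has even numerator and denominator and u is a multiple of w^2
    - z^2, so [selmer_poly] applies. Its symmetric alternative is precisely the trivial class. *)
Lemma selmer (z : k) (m : nat) (X Y : F) : (m < 3)%N -> z != 0 -> B = z ^+ 2 ->
  X != 0 -> Y ^+ 2 = u ^+ m * X ^+ 3 + (cst A * u + cst B) ->
  cubic_class m Y \/ exists z' g, z' ^+ 2 = B /\ iw Y - w = (w - cst z') ^+ m * g ^+ 3.
Proof.
move=> m3 z0 Bz X0 H.
have [b0 [e0 [e0n cop EY]]] := pf_coprime_ex Y.
have [x1 [x2 [x2n EX]]] := pf_ex X.
have x1n : x1 != 0 by apply: contraNneq X0 => E; rewrite EX E rmorph0 mul0r.
have sq : (1 < size qAB)%N by rewrite size_qAB.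
have qN : qAB \Po - 'X = qAB.
  by rewrite /qAB comp_polyZ comp_polyB comp_polyC rmorphXn /= comp_polyX sqrrN.
have cN p : (p \Po qAB) \Po - 'X = p \Po qAB by rewrite -comp_polyA qN.
pose b := b0 \Po qAB; pose e := e0 \Po qAB.
have en : e != 0 by rewrite comp_poly_eq0.
have EiY : iw Y = pf b / pf e by rewrite EY fmorph_div /= !iw_pf.
have pen : pf e != 0 by rewrite pf_eq0.
have px2n : pf (x2 \Po qAB) != 0 by rewrite pf_eq0 comp_poly_eq0.
have bN : b \Po - 'X = b := cN b0; have eN : e \Po - 'X = e := cN e0.
have cop' : coprimep b e by exact: coprimep_comp_poly.
have : (pf b / pf e) ^+ 2 = pf qAB ^+ m * (pf (x1 \Po qAB) / pf (x2 \Po qAB)) ^+ 3 + w ^+ 2.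
  rewrite -EiY -rmorphXn H rmorphD /= iw_W rmorphM !rmorphXn /= EX fmorph_div /= !iw_pf.
  by rewrite comp_polyX.
have : x1 \Po qAB != 0 by rewrite comp_poly_eq0.
have : x2 \Po qAB != 0 by rewrite comp_poly_eq0.
move: (x1 \Po qAB) (x2 \Po qAB) px2n => x1' x2' px2n x2n' x1n'.
clearbody b e; move/(selmer_clear pen px2n); rewrite pf_qAB => E.
have Hpoly : (b - e * 'X) * (b + e * 'X) * x2' ^+ 3 =
  A^-1 ^+ m *: (e ^+ 2 * ('X ^+ 2 - (z ^+ 2)%:P) ^+ m * x1' ^+ 3).
  apply: pf_inj; rewrite -mul_polyC.
  rewrite !(rmorphXn, rmorphM, rmorphB, rmorphD) /= !pfX !pfC E.
  rewrite Bz rmorphXn /= exprMn; move: (_ ^+ m) ((_ - _) ^+ m) => S T.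
  by ring.
have An : A^-1 ^+ m != 0 by rewrite expf_neq0 ?invr_eq0.
have [s Hs] := selmer_poly z0 An m3 n2 bN eN cop' en x1n' x2n' Hpoly.
case: Hs => /(congr1 pf).

- rewrite !(rmorphXn, rmorphM, rmorphB, rmorphD) /= pfX pfC -[cst z ^+ 2]rmorphXn -Bz.
  move/(selmer_div pen) => E'; left; apply: (cubic_classI (g := pf s / pf e)).
  by rewrite EiY E'.
- rewrite !(rmorphXn, rmorphM, rmorphB, rmorphD) /= pfX pfC.
  by move/(selmer_div2 pen) => E'; right; exists z, (pf s / pf e); rewrite EiY.
rewrite !(rmorphXn, rmorphM, rmorphB, rmorphD) /= pfX pfC.
move/(selmer_div2 pen) => E'; right; exists (- z), (pf s / pf e).
by rewrite EiY sqrrN rmorphN opprK.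
Qed.

Lemma cst_cube_root c : exists e : F, e ^+ 3 = cst c.
Proof. by have [e Ee] := closed_root c (isT : 0 < 3)%N; exists (cst e); rewrite -rmorphXn Ee. Qed.

(** By conjugation Y1 + w is (- w - z)^m times a cube. Multiplied by Y2 + w = c (w - z)^m it
    becomes, up to constants and cubes, (w^2 - B)^m, and [collinear_cube] transfers this to the
    third point: the class of the second point cancels that of the first. *)
Lemma cubic_class_sum (z : k) (m : nat) (X1 Y1 X2 Y2 g : F) (c : k) :
  let l := (Y1 - Y2) / (X1 - X2) in let X3 := l ^+ 2 / u ^+ m - X1 - X2 in
  X1 - X2 != 0 -> c != 0 -> z ^+ 2 = B -> Y1 ^+ 2 != cst A * u + cst B ->
  Y1 ^+ 2 = u ^+ m * X1 ^+ 3 + (cst A * u + cst B) ->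
  Y2 ^+ 2 = u ^+ m * X2 ^+ 3 + (cst A * u + cst B) ->
  iw Y1 - w = (w - cst z) ^+ m * g ^+ 3 ->
  iw Y2 + w = cst c * (w - cst z) ^+ m ->
  cubic_class m (l * (X1 - X3) - Y1).
Proof.
move=> l X3 n c0 Ez nY H1 H2 E1 E2.
have un : iw u ^+ m != 0 by rewrite expf_neq0 ?fmorph_eq0 ?tv0.
have E1' : iw Y1 + w = (- w - cst z) ^+ m * cw g ^+ 3.
  have := congr1 cw E1; rewrite rmorphB !rmorphM !rmorphXn rmorphB /= cw_iw cw_w cw_cst.
  by rewrite opprK.
have n' : iw X1 - iw X2 != 0 by rewrite subr_eq0 fmorph_eq -subr_eq0; exact: n.
have H1' : iw Y1 ^+ 2 = iw u ^+ m * iw X1 ^+ 3 + w ^+ 2.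
  by rewrite -rmorphXn H1 rmorphD /= iw_W rmorphM !rmorphXn.
have H2' : iw Y2 ^+ 2 = iw u ^+ m * iw X2 ^+ 3 + w ^+ 2.
  by rewrite -rmorphXn H2 rmorphD /= iw_W rmorphM !rmorphXn.
have /= := collinear_cube un n' H1' H2'; rewrite E1' E2.
set Y3 := l * _ - _.
have -> : (iw Y1 - iw Y2) / (iw X1 - iw X2) *
   (iw X1 - (((iw Y1 - iw Y2) / (iw X1 - iw X2)) ^+ 2 / iw u ^+ m - iw X1 - iw X2)) -
   iw Y1 = iw Y3.
  by rewrite /Y3 /X3 /l !(rmorphB, rmorphM, fmorphV, rmorphXn).
set mu := (_ + w) ^+ 3 => E3.
(* Constants are cubes, so c and the signs can be absorbed. *)
have [d Ed] := cst_cube_root (- ((-1) ^+ m * c^-1)).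
have g0 : cw g != 0.
  apply: contraNneq nY => g0; move: E1'; rewrite g0 expr0n mulr0 => E.
  rewrite -(fmorph_eq iw) /= iw_W rmorphXn /=.
  by move/eqP: E; rewrite addr_eq0 => /eqP ->; rewrite sqrrN.
apply: (cubic_classI (g := d * (iw Y1 - (iw Y1 - iw Y2) / (iw X1 - iw X2) * iw X1 + w) / cw g)).
rewrite !exprMn -/mu -E3 Ed exprVn rmorphN rmorphM rmorphXn rmorphN rmorph1 fmorphV /=.
rewrite -Ez rmorphXn /= (_ : w ^+ 2 - _ = - ((- w - cst z) * (w - cst z))); last by ring.
rewrite [in LHS]exprNn exprMn.
have cn : cst c != 0 by rewrite cst_eq0.
exact: (cubic_sum_alg _ _ _ _ _ g0 cn).
Qed.

End Conj.

(** * Complex multiplication and heights *)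

Section Eisenstein.

Variables (K : fieldType) (E : elliptic_curve K) (w : K).
Local Notation D := (ec_b E).
Hypothesis a0 : ec_a E = 0.
Hypothesis Hw : w ^+ 2 + w + 1 = 0.

Lemma w2E : w ^+ 2 = - w - 1.
Proof. by apply/eqP; rewrite -subr_eq0 opprD !opprK addrA Hw. Qed.

Lemma w_neq0 : w != 0.
Proof. by apply: contra_eq_neq Hw => ->; rewrite expr0n !add0r oner_neq0. Qed.

Lemma w3E : w ^+ 3 = 1.
Proof. by rewrite exprS w2E mulrBr mulrN -expr2 w2E; ring. Qed.

Lemma r2E : (w - w ^+ 2) ^+ 2 = - 3%:R.
Proof. by ring: w2E. Qed.

Lemma r_neq0 : w - w ^+ 2 != 0.
Proof.
have := ec_3_neq0 a0; apply: contraNneq => /(congr1 (fun x => x ^+ 2)).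
by rewrite r2E expr0n /= => /eqP; rewrite oppr_eq0.
Qed.

Lemma w_neq1 : w != 1.
Proof. by have := r_neq0; apply: contraNneq => ->; rewrite expr1n subrr. Qed.

Lemma cube_root1 (x : K) : x ^+ 3 = 1 -> [\/ x = 1, x = w | x = w ^+ 2].
Proof.
move=> H; have : (x - 1) * ((x - w) * (x - w ^+ 2)) = 0.
  by rewrite -(subrr (x ^+ 3)) {2}H; ring: w2E.
move/eqP; rewrite !mulf_eq0 !subr_eq0 => /or3P[] /eqP; [exact: Or31|exact: Or32|exact: Or33].
Qed.

Lemma cube_eq (x y : K) : x ^+ 3 = y ^+ 3 -> [\/ x = y, x = w * y | x = w ^+ 2 * y].
Proof.
have [->|y0] := eqVneq y 0.
  by rewrite expr0n => /eqP; rewrite expf_eq0 => /eqP ->; exact: Or31.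
move=> H; have : (x / y) ^+ 3 = 1 by rewrite expr_div_n H divff ?expf_neq0.
have Ex z : x / y = z -> x = z * y by move=> <-; rewrite divfK.
by case/cube_root1 => /Ex ->; [apply: Or31; rewrite mul1r | exact: Or32 | exact: Or33].
Qed.

Lemma om_s0 : w ^+ 2 != 0. Proof. by rewrite expf_neq0 ?w_neq0. Qed.

Lemma om_a : ec_a E = (w ^+ 2) ^+ 4 * idfun (ec_a E).
Proof. by rewrite /= a0 mulr0. Qed.

Lemma om_b : D = (w ^+ 2) ^+ 6 * idfun D.
Proof. by rewrite -exprM (exprM w 3 4) w3E expr1n mul1r. Qed.

(** With s = w^2 one has s^2 = w and s^3 = 1, so the twist is (x, y) -> (w x, y). *)
Definition om : ec_point E -> ec_point E := tw om_a om_b om_s0.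
HB.instance Definition _ := GRing.Additive.copy om (tw om_a om_b om_s0).

Lemma omE P x y : ec_coords P = Some (x, y) -> ec_coords (om P) = Some (w * x, y).
Proof.
move=> H; rewrite /= H /=; congr (Some (_, _)).
  by rewrite -exprM (exprD w 3 1) w3E mul1r expr1.
by rewrite -exprM (exprM w 3 2) w3E expr1n mul1r.
Qed.

Lemma coords0 (P : ec_point E) : ec_coords P = None -> P = 0.
Proof. by move=> H; apply: val_inj. Qed.

Hypothesis x0 : forall x y, on_curve E (Some (x, y)) -> x != 0.
Hypothesis y0 : forall x y, on_curve E (Some (x, y)) -> y != 0.

Lemma on_coords (P : ec_point E) p : ec_coords P = Some p -> on_curve E (Some p).
Proof. by move=> <-; exact: ec_coordsP. Qed.

Lemma on_eq x y : on_curve E (Some (x, y)) -> y ^+ 2 = x ^+ 3 + D.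
Proof. by move/eqP ->; rewrite a0 mul0r addr0. Qed.

Lemma addE (P Q : ec_point E) x1 y1 x2 y2 :
  ec_coords P = Some (x1, y1) -> ec_coords Q = Some (x2, y2) -> x1 != x2 ->
  ec_coords (P + Q) = Some (let l := (y1 - y2) / (x1 - x2) in
    let x3 := l ^+ 2 - x1 - x2 in (x3, l * (x1 - x3) - y1)).
Proof. by move=> HP HQ n; rewrite /= HP HQ /ec_add /= n. Qed.

Lemma oppE (P : ec_point E) x y :
  ec_coords P = Some (x, y) -> ec_coords (- P) = Some (x, - y).
Proof. by move=> H; rewrite /= H. Qed.

(** The three points lie on a horizontal line. *)
Lemma om_sum P : P + om P + om (om P) = 0.
Proof.
case HP: (ec_coords P) => [[x y]|]; last by rewrite (coords0 HP) !raddf0 !addr0.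
have xn := x0 (on_coords HP); have H1 := omE HP; have H2 := omE H1.
have n : x != w * x.
  by rewrite -subr_eq0 -{1}[x]mul1r -mulrBl mulf_neq0 // subr_eq0 eq_sym w_neq1.
have -> : P + om P = - om (om P); last by rewrite addNr.
apply: val_inj; rewrite -[val _]/(ec_coords _) -[RHS]/(ec_coords _).
rewrite (oppE H2) (addE HP H1 n) /= subrr mul0r expr0n /=.
by congr (Some (_, _)); rewrite ?mul0r ?sub0r // mulrA -expr2 w2E; ring.
Qed.

Lemma omK P : om (om (om P)) = P.
Proof.
apply: (addrI (om P + om (om P))); rewrite om_sum addrC addrA om_sum //.
Qed.

(** Multiplication by w - w^2, a square root of - 3: an endomorphism of degree 3 whose kernel
    consists of O and the points with x = 0. *)
Definition phi (P : ec_point E) : ec_point E := om P - om (om P).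

Lemma phi_is_zmod : zmod_morphism phi.
Proof. by move=> P Q; rewrite /phi !(raddfB om) !opprD !opprK addrACA. Qed.

HB.instance Definition _ := GRing.isZmodMorphism.Build _ _ _ phi_is_zmod.

Lemma phi_om P : phi (om P) = om (phi P).
Proof. by rewrite /phi raddfB. Qed.

(** This is the classical 3-isogeny from y^2 = x^3 + D to y^2 = x^3 - 27 D, followed by the
    isomorphism back that divides the coordinates by r^2 and r^3, where r = w - w^2 and r^6 = -
    27. *)
Lemma phiE P x y : ec_coords P = Some (x, y) ->
  ec_coords (phi P) = Some (- (x ^+ 3 + 4%:R * D) / (3%:R * x ^+ 2),
     y * (x ^+ 3 - 8%:R * D) / ((w - w ^+ 2) ^+ 3 * x ^+ 3)).
Proof.
move=> HP; have oP := on_coords HP; have xn := x0 oP; have H := on_eq oP.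
have H1 := omE HP; have H2 := oppE (omE H1).
have rn := r_neq0.
have n : w * x != w * (w * x).
  rewrite -subr_eq0; have -> : w * x - w * (w * x) = (w - w ^+ 2) * x by ring.
  exact: mulf_neq0.
have n3 := ec_3_neq0 a0.
rewrite /phi (addE H1 H2 n) /= opprK.
have -> : w * x - w * (w * x) = (w - w ^+ 2) * x by ring.
have E1 : ((y + y) / ((w - w ^+ 2) * x)) ^+ 2 - w * x - w * (w * x) =
    - (x ^+ 3 + 4%:R * D) / (3%:R * x ^+ 2).
  rewrite expr_div_n exprMn r2E.
  have -> : (y + y) ^+ 2 = 4%:R * (x ^+ 3 + D) by rewrite -H; ring.
  rewrite -addrA; have -> : - (w * x) - w * (w * x) = x by ring: w2E.
  by field; rewrite xn oppr_eq0 n3.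
rewrite E1; congr (Some (_, _)).
have -> : (w - w ^+ 2) ^+ 3 = - 3%:R * (w - w ^+ 2) by rewrite exprSr r2E.
have Er : 2%:R * w = (w - w ^+ 2) - 1 by ring: w2E.
move: (w - w ^+ 2) rn Er => r rn Er.
rewrite (_ : (y + y) = 2%:R * y); last by ring.
rewrite (_ : 2%:R * y / (r * x) * _ - y =
  (2%:R * w - r) * y / r + 2%:R * y * (x ^+ 3 + 4%:R * D) / (3%:R * r * x ^+ 3)).
  by rewrite Er; field; rewrite rn xn oppr_eq0 n3.
by field; rewrite rn xn n3.
Qed.

End Eisenstein.

Fact ar_pred (a b s t : nat) : (s <= a.+1)%N -> (t <= b.+1)%N -> ((s + t).-1 <= (a + b).+1)%N.
Proof. lia. Qed.

Section DegreeBound.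
Variable R : idomainType.
Implicit Types p q : {poly R}.

Definition dle p d := (size p <= d.+1)%N.

Lemma dleW p a b : dle p a -> (a <= b)%N -> dle p b.
Proof. by move=> H ab; apply: leq_trans H _. Qed.

Lemma dleD p q a b c : dle p a -> dle q b -> (a <= c)%N -> (b <= c)%N -> dle (p + q) c.
Proof.
move=> H1 H2 ac bc; apply: leq_trans (size_polyD _ _) _; rewrite geq_max.
by rewrite (dleW H1 ac : is_true (_ <= _)%N); exact: dleW H2 bc.
Qed.

Lemma dleN p a : dle p a -> dle (- p) a.
Proof. by rewrite /dle size_polyN. Qed.

Lemma dleM p q a b : dle p a -> dle q b -> dle (p * q) (a + b).
Proof. by move=> H1 H2; apply: leq_trans (size_polyMleq _ _) _; exact: ar_pred. Qed.

Lemma dleX p a n : dle p a -> dle (p ^+ n) (n * a).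
Proof.
move=> H; elim: n => [|n IH]; first by rewrite expr0 /dle size_poly1.
by rewrite exprS mulSn; exact: dleM.
Qed.

Lemma dleMn p a n : dle p a -> dle (p *+ n) a.
Proof.
move=> H; elim: n => [|n IH]; first by rewrite mulr0n /dle size_poly0.
by rewrite mulrS; apply: dleD H IH _ _.
Qed.

Lemma dle_sqr p a : dle (p ^+ 2) (2 * a) -> dle p a.
Proof.
have [->|p0] := eqVneq p 0; first by rewrite /dle size_poly0.
by rewrite /dle expr2 size_mul //; lia.
Qed.

Lemma size_cube p : p != 0 -> (size (p ^+ 3) + 2 = 3 * size p)%N.
Proof.
move=> p0; have := size_exp p 3.
have : (0 < size p)%N by rewrite size_poly_gt0.
have : (0 < size (p ^+ 3)%R)%N by rewrite size_poly_gt0 expf_neq0.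
by move: (size p) (size _) => a b; lia.
Qed.

End DegreeBound.

(** Degree counts for [hle_phi] in terms of sizes, according to whether the degree of a^3 exceeds,
    is below or equals that of D g^3. *)
Fact ar_phi1 (a g a3 g3 s N : nat) : (0 < a)%N -> (0 < g)%N ->
  (a3 + 2 = 3 * a)%N -> (g3 + 2 = 3 * g)%N -> (g + 2 < a)%N -> s = a3 -> (s <= N.+1)%N ->
  (a <= (N %/ 3).+1)%N /\ (g.+1 <= N %/ 3)%N.
Proof. lia. Qed.
Fact ar_phi2 (a g a3 g3 s N : nat) : (0 < a)%N -> (0 < g)%N ->
  (a3 + 2 = 3 * a)%N -> (g3 + 2 = 3 * g)%N -> (a < g + 2)%N -> s = (6 + g3)%N -> (s <= N.+1)%N ->
  (a <= (N %/ 3).+1)%N /\ (g.+1 <= N %/ 3)%N.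
Proof. lia. Qed.
Fact ar_phi3 (a g s N : nat) : (0 < a)%N -> (0 < g)%N ->
  (a = g + 2)%N -> s = ((a + a).-1 + g).-1 -> (s.+1 <= N)%N ->
  (a <= (N %/ 3).+1)%N /\ (g.+1 <= N %/ 3)%N.
Proof. lia. Qed.
Fact ar_cmp1 (a g a3 g3 : nat) : (0 < g)%N -> (a3 + 2 = 3 * a)%N -> (g3 + 2 = 3 * g)%N ->
  (g + 2 < a)%N -> (6 + g3 < a3)%N.
Proof. lia. Qed.
Fact ar_cmp2 (a g a3 g3 : nat) : (0 < a)%N -> (a3 + 2 = 3 * a)%N -> (g3 + 2 = 3 * g)%N ->
  (a < g + 2)%N -> (a3 < 6 + g3)%N.
Proof. lia. Qed.

Fact ar_pow (n a b : nat) : (1 < n)%N -> (n * a)%N = (1 + n * b)%N -> False.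
Proof.
move=> n1 /(congr1 (modn^~ n)); rewrite /= modnMr addnC [(n * b)%N]mulnC modnMDl.
by rewrite modn_small.
Qed.

Lemma clear_sq (K : fieldType) (y D a g : K) : g != 0 -> y ^+ 2 = (a / g) ^+ 3 + D ->
  (y * g ^+ 2) ^+ 2 = (a ^+ 3 + D * g ^+ 3) * g.
Proof. by move=> g0 H; rewrite exprMn H; field. Qed.

Lemma clear_phi (K : fieldType) (D a g p q : K) : 3%:R != 0 :> K -> a != 0 -> g != 0 -> q != 0 ->
  - ((a / g) ^+ 3 + 4%:R * D) / (3%:R * (a / g) ^+ 2) = p / q ->
  p * (3%:R * (a ^+ 2 * g)) = - (a ^+ 3 + 4%:R * D * g ^+ 3) * q.
Proof.
move=> n3 a0 g0 q0 E; have -> : p = p / q * q by rewrite divfK.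
by rewrite -E; field; rewrite g0 a0 n3.
Qed.

Lemma clear_zero (K : fieldType) (D a g : K) : g != 0 ->
  a ^+ 3 + 4%:R * D * g ^+ 3 = 0 -> (a / g) ^+ 3 = - 4%:R * D.
Proof.
move=> g0 /eqP; rewrite addr_eq0 => /eqP E; rewrite expr_div_n E.
by field.
Qed.

Lemma clear_add (K : fieldType) (D a g y1 x2 y2 : K) : g != 0 -> a - x2 * g != 0 ->
  y1 ^+ 2 = (a / g) ^+ 3 + D -> y2 ^+ 2 = x2 ^+ 3 + D ->
  ((y1 - y2) / (a / g - x2)) ^+ 2 - a / g - x2 =
  (a * x2 * (a + x2 * g) + (D * g ^+ 2) *+ 2 - (y1 * g ^+ 2 * y2) *+ 2) / (a - x2 * g) ^+ 2.
Proof.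
move=> g0 n H1 H2; rewrite expr_div_n sqrrB H1 H2.
by field; rewrite n g0.
Qed.

Fact ar_add0 (n : nat) : (1 < n)%N -> n = (n - 2).+2.
Proof. lia. Qed.
Fact ar_add1 (n : nat) : (1 < n)%N -> (2 * (2 * n - 1) = 3 * n + (n - 2))%N.
Proof. lia. Qed.
Fact ar_add2 (n : nat) : (1 < n)%N -> (6 + 3 * (n - 2) <= 3 * n)%N.
Proof. lia. Qed.
Fact ar_add3 (n h : nat) : (1 < n)%N -> (0 < h)%N ->
  [/\ n <= n + h, h + (n - 2) <= n + h & n + h + (n + h) <= 2 * n + 2 * h]%N.
Proof. by move=> *; split; lia. Qed.
Fact ar_add4 (n h : nat) : (1 < n)%N -> (0 < h)%N ->
  (6 + 2 * (n - 2) <= 2 * n + 2 * h /\ 2 * n - 1 + 2 * h <= 2 * n + 2 * h)%N.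
Proof. by move=> *; split; lia. Qed.
Fact ar_add5 (n h : nat) : (1 < n)%N -> (0 < h)%N ->
  [/\ n <= n + h - 1, h + (n - 2) <= n + h - 1 & (2 * (n + h - 1)).+1 < 2 * n + 2 * h]%N.
Proof. by move=> *; split; lia. Qed.

Section Height.

Variable k : closedFieldType.
Hypothesis n2 : 2%:R != 0 :> k.
Hypothesis n3 : 3%:R != 0 :> k.
Variables A B : k.
Hypothesis A0 : A != 0.
Hypothesis B0 : B != 0.
Local Notation F := (RF k).

Definition pD : {poly k} := locked (A *: 'X^6 + B%:P).
Local Notation D := (pf pD).

Lemma size_pD : size pD = 7.
Proof.
have s6 : size (A *: 'X^6 : {poly k}) = 7 by rewrite size_scale ?size_polyXn.
by rewrite /pD -lock size_polyDl s6 // size_polyC; case: (_ != _).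
Qed.

Lemma pD_neq0 : pD != 0.
Proof. by rewrite -size_poly_gt0 size_pD. Qed.

(** The derivative 6 A t^5 vanishes only at 0, where D takes the value B. *)
Lemma mup_pD x : root pD x -> mup x pD = 1%N.
Proof.
move=> rx; have m1 : (0 < mup x pD)%N by rewrite -XsubC_dvd ?pD_neq0 // dvdp_XsubCl.
apply/eqP; rewrite eqn_leq m1 andbT mup_leq ?pD_neq0 //; apply/negP => /dvdpP [q Eq].
have : (pD^`()).[x] = 0.
  rewrite Eq expr2 !derivM derivXsubC !(hornerXsubC, hornerD, hornerM) subrr.
  by rewrite !(mulr0, mul0r, addr0).
rewrite /pD -lock derivD derivZ derivXn derivC addr0 hornerZ hornerMn hornerXn /=.
move/eqP; rewrite mulf_eq0 (negPf A0) /= -mulr_natl mulf_eq0.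
have -> : 6%:R = 2%:R * 3%:R :> k by ring.
rewrite mulf_eq0 (negPf n2) (negPf n3) expf_eq0 /= => /eqP x0.
move: rx; rewrite /root x0 /pD -lock hornerD hornerZ hornerXn hornerC expr0n mulr0 add0r.
by rewrite (negPf B0).
Qed.

Lemma pf_pD : D = cst A * tv ^+ 6 + cst B.
Proof. by rewrite /pD -lock -mul_polyC rmorphD rmorphM rmorphXn /= pfX !pfC. Qed.

(** At a root of D the multiplicity would be both a multiple of n and 1 modulo n. In particular the
    curve has no point with x = 0 or y = 0. *)
Lemma pD_no_power n (c : k) (y : F) : (1 < n)%N -> c != 0 -> y ^+ n != cst c * D.
Proof.
move=> n1 c0; have [a [b [b0 ->]]] := pf_ex y.
have [x rx] : exists x, root pD x by apply/closed_rootP; rewrite size_pD.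
rewrite expr_div_n -!rmorphXn /=.
have bn : pf (b ^+ n) != 0 by rewrite pf_eq0 expf_neq0.
apply/eqP => E; have {}E : pf (a ^+ n) = pf (c%:P * pD * b ^+ n).
  by rewrite !rmorphM /= pfC -E divfK.
move/pf_inj/(congr1 (mup x)): E; rewrite mul_polyC.
have cD0 : c *: pD != 0 by rewrite scaler_eq0 negb_or c0 pD_neq0.
rewrite mupM ?expf_neq0 // [mup x (b ^+ n)]mupX // -mul_polyC mupMr ?rootC // (mup_pD rx).
have [->|a0] := eqVneq a 0.
  rewrite expr0n (gtn_eqF (ltnW n1)).
  (* By convention the multiplicity of the zero polynomial is 0, which also contradicts the
     equation. *)
  have -> : mup x (0 : {poly k}) = 0%N.
    by apply/eqP; rewrite -leqn0 /mup; case: arg_maxnP => [|[i Hi]] //= _ _; move: Hi; rewrite size_poly0.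
  by [].
by rewrite mupX //; exact: ar_pow.
Qed.

(** Polynomials form an integrally closed ring: in lowest terms the denominator divides the square
    of the numerator, hence is constant. *)
Lemma pf_sqr (y : F) p : y ^+ 2 = pf p -> exists q, y = pf q.
Proof.
have [a [b [b0 cab ->]]] := pf_coprime_ex y; rewrite expr_div_n -!rmorphXn /= => E.
have bn : pf (b ^+ 2) != 0 by rewrite pf_eq0 expf_neq0.
have /pf_inj Ea : pf (a ^+ 2) = pf (p * b ^+ 2) by rewrite [RHS]rmorphM /= -E divfK.
have : b %| a ^+ 2 by rewrite Ea expr2 mulrA dvdp_mull.
rewrite -[a ^+ 2]mulr1 Gauss_dvdpr ?coprimep_expr 1?coprimep_sym // dvdp1.
case/size_poly1P => c c0 Eb; exists (c^-1 *: a).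
rewrite Eb -mul_polyC rmorphM /= !pfC fmorphV mulrC //.
Qed.

(* In lowest terms [x = a / d^2] this reads [max (deg a) (2 deg d + 2) <= n],
   a bound on the canonical height since [y^2 = x^3 + D] has no reducible fibre. *)
Definition hle (x : F) (n : nat) := exists a g : {poly k},
  [/\ g != 0, x = pf a / pf g, (size a <= n.+1)%N & ((size g).+1 <= n)%N].

(** At a common root of a and D, simple for D, the polynomial a^3 + D g^3 would have multiplicity
    exactly 1 and g would not vanish; but (a^3 + D g^3) g is a square. *)
Lemma curve_coprime x y a g : y ^+ 2 = x ^+ 3 + D -> g != 0 -> coprimep a g ->
  x = pf a / pf g -> a != 0 -> coprimep a pD.
Proof.
move=> H g0 cag Ex a0; apply: Pdiv.ClosedField.root_coprimep => t ra; apply/negP => rD.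
have gt : ~~ root g t by exact: (coprimep_root cag).
have gn : pf g != 0 by rewrite pf_eq0.
have : (y * pf g ^+ 2) ^+ 2 = pf ((a ^+ 3 + pD * g ^+ 3) * g).
  rewrite Ex in H; rewrite (clear_sq gn H).
  by rewrite !(rmorphXn, rmorphM, rmorphD).
move=> E; have [z Ez] := pf_sqr E; move: E; rewrite Ez -rmorphXn /=.
move/eqP; rewrite pf_eq => /eqP E.
have dN : dvdp ('X - t%:P) (a ^+ 3 + pD * g ^+ 3).
  rewrite dvdp_XsubCl /root hornerD horner_exp hornerM.
  by rewrite (rootP ra) (rootP rD) expr0n mul0r addr0.
have N2 : ~~ (('X - t%:P) ^+ 2 %| a ^+ 3 + pD * g ^+ 3).
  rewrite dvdp_addr; last first.
    by rewrite [a ^+ 3]exprSr dvdp_mulr // dvdp_exp2r // dvdp_XsubCl.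
  rewrite Gauss_dvdpl -?mup_geq ?pD_neq0 ?(mup_pD rD) //.
  by rewrite coprimep_expl // coprimep_sym coprimep_XsubC; apply: contra gt; rewrite /root hornerE expf_eq0.
have n0 : a ^+ 3 + pD * g ^+ 3 != 0 by apply: contraNneq N2 => ->; rewrite dvdp0.
have m1 : mup t (a ^+ 3 + pD * g ^+ 3) = 1%N.
  by apply/eqP; rewrite eqn_leq mup_leq // N2 mup_geq // expr1.
have z0 : z != 0 by move: (mulf_neq0 n0 g0); rewrite -E expf_eq0.
have := congr1 (mup t) E; rewrite mupX // mupM // m1 (mupNroot gt) addn0.
by move/(congr1 odd); rewrite oddM.
Qed.

(** For x = a / g the image has numerator P = a^3 + 4 D g^3 and denominator 3 a^2 g up to sign, and
    these are coprime because a is prime to D. Hence P divides p and a^2 g divides q. If a^3 and D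
    g^3 have the same degree, leading terms may cancel in P, and the bound is read off from the
    denominator. *)
Lemma hle_phi x y N : y ^+ 2 = x ^+ 3 + D -> x != 0 ->
  hle (- (x ^+ 3 + 4%:R * D) / (3%:R * x ^+ 2)) N -> hle x (N %/ 3).
Proof.
move=> H x0 [p [q [q0 E sp sq]]].
have [a [g [g0 cag Ex]]] := pf_coprime_ex x.
have a0 : a != 0 by apply: contraNneq x0 => E0; rewrite Ex E0 rmorph0 mul0r.
have caD := curve_coprime H g0 cag Ex a0.
have [an gn qn] : [/\ pf a != 0, pf g != 0 & pf q != 0] by rewrite !pf_eq0.
pose P := a ^+ 3 + 4%:R * pD * g ^+ 3.
have n4 : 4%:R != 0 :> k by rewrite (_ : 4%:R = 2%:R * 2%:R :> k) ?mulf_neq0 //; ring.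
have e4 : 4%:R * pD = 4%:R *: pD by rewrite -mul_polyC polyCMn.
have eqP' : p * (3%:R * (a ^+ 2 * g)) = - P * q.
  apply: pf_inj; rewrite !(rmorphXn, rmorph_nat, rmorphM, rmorphN, rmorphD) /=.
  have n3F : 3%:R != 0 :> F by rewrite -(rmorph_nat cst) cst_eq0.
  by rewrite Ex in E; exact: (clear_phi n3F an gn qn E).
have cPa : coprimep a P.
  rewrite /P exprSr coprimep_addl_mul coprimepMr e4 coprimepZr // caD.
  by rewrite coprimep_expr.
have cPg : coprimep g P.
  rewrite /P addrC exprSr mulrA coprimep_addl_mul.
  by rewrite coprimep_expr // coprimep_sym.
have cP : coprimep P (a ^+ 2 * g).
  by rewrite coprimepMr coprimep_expr 1?coprimep_sym // coprimep_sym cPg.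
have P0 : P != 0.
  have := @pD_no_power 3 (- 4%:R) x isT; rewrite oppr_eq0 n4 => /(_ isT).
  apply: contraNneq => PE; have := congr1 pf PE.
  rewrite /P !(rmorphXn, rmorph_nat, rmorphM, rmorphD) rmorph0 /= Ex => E0.
  by rewrite (clear_zero gn E0) rmorphN rmorph_nat.
have {}eqP' : 3%:R *: (p * (a ^+ 2 * g)) = - P * q.
  by rewrite -eqP' scaler_nat [RHS]mulrCA mulr_natl.
have p0 : p != 0.
  apply: contraNneq P0 => pz; move/eqP: eqP'; rewrite pz mul0r scaler0 eq_sym mulf_eq0.
  by rewrite oppr_eq0 (negPf q0) orbF.
have dP : P %| p.
  by rewrite -(Gauss_dvdpl _ cP) -(dvdpZr _ _ n3) eqP' mulNr -mulrN dvdp_mulr.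
have dq : a ^+ 2 * g %| q.
  rewrite -(Gauss_dvdpr _ (_ : coprimep _ (- P))); last first.
    by rewrite -scaleN1r coprimepZr ?oppr_eq0 ?oner_neq0 // coprimep_sym.
  by rewrite -eqP' dvdpZr // dvdp_mull.
have sP := leq_trans (dvdp_leq p0 dP) sp.
have sQ : ((size (a ^+ 2 * g)%R).+1 <= N)%N.
  by apply: leq_trans sq; rewrite ltnS dvdp_leq.
exists a, g; rewrite g0 Ex.
have sa : (0 < size a)%N by rewrite size_poly_gt0.
have sg : (0 < size g)%N by rewrite size_poly_gt0.
have [sa3 sg3] := (size_cube a0, size_cube g0).
have s4 : size (4%:R * pD * g ^+ 3)%R = (6 + size (g ^+ 3)%R)%N.
  by rewrite e4 size_mul ?scaler_eq0 ?negb_or ?n4 ?pD_neq0 ?expf_neq0 // size_scale // size_pD.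
have [lt|lt|eq] := ltngtP (size a) (size g + 2).
- have [] // := ar_phi2 sa sg sa3 sg3 lt _ sP.
  by rewrite /P addrC size_polyDl ?s4 // (ar_cmp2 sa sa3 sg3 lt).
- have [] // := ar_phi1 sa sg sa3 sg3 lt _ sP.
  by rewrite /P size_polyDl // s4 (ar_cmp1 sg sa3 sg3 lt).
have [] // := ar_phi3 sa sg eq _ sQ.
by rewrite size_mul ?expf_neq0 // expr2 size_mul.
Qed.

(** The abscissa of the sum is (x1 x2 (x1 + x2) + 2 D - 2 y1 y2) / (x1 - x2)^2. For x1 = a / g,
    multiplying both terms by g^2 makes them polynomials: y1 g^2 is one, its square being a
    polynomial. *)
Lemma hle_add (h n : nat) (x1 y1 : F) (x2 y2 : {poly k}) :
  (0 < h)%N -> dle x2 h -> dle y2 (2 * h) -> hle x1 n ->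
  y1 ^+ 2 = x1 ^+ 3 + D -> pf y2 ^+ 2 = pf x2 ^+ 3 + D -> x1 - pf x2 != 0 ->
  hle (((y1 - pf y2) / (x1 - pf x2)) ^+ 2 - x1 - pf x2) (2 * n + 2 * h).
Proof.
move=> h0 sx2 sy2 [a [g [g0 Ex sa sg]]] H1 H2 nx.
have gn : pf g != 0 by rewrite pf_eq0.
have n2' : (1 < n)%N by apply: leq_trans sg; rewrite ltnS size_poly_gt0.
have sg' : dle g (n - 2) by rewrite /dle -ltnS; apply: leq_trans sg _; rewrite -(ar_add0 n2').
have Hz : (y1 * pf g ^+ 2) ^+ 2 = pf ((a ^+ 3 + pD * g ^+ 3) * g).
  by rewrite Ex in H1; rewrite (clear_sq gn H1) !(rmorphXn, rmorphM, rmorphD).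
have [z Ez] := pf_sqr Hz; move: Hz; rewrite Ez -rmorphXn /= => /pf_inj Hz.
have sD : dle pD 6 by rewrite /dle size_pD.
have sz : dle z (2 * n - 1).
  apply: dle_sqr; rewrite Hz.
  rewrite (ar_add1 n2'); apply: (dleM _ sg').
  apply: (dleD (dleX 3 sa) (dleM sD (dleX 3 sg')) (leqnn _)); exact: ar_add2.
exists (a * x2 * (a + x2 * g) + (pD * g ^+ 2) *+ 2 - (z * y2) *+ 2), ((a - x2 * g) ^+ 2).
have dn : a - x2 * g != 0.
  apply: contraNneq nx => E; apply/eqP.
  have := congr1 pf E; rewrite rmorphB rmorphM rmorph0 /= Ex => E'.
  by apply: (mulIf gn); rewrite mul0r -E' mulrBl divfK.
split; first by rewrite expf_neq0.
- rewrite !(rmorphB, rmorphD, rmorphM, rmorphMn, rmorphXn) /= -Ez.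
  have dn' : pf a - pf x2 * pf g != 0 by rewrite -rmorphM -rmorphB pf_eq0.
  rewrite Ex in H1 nx *; exact: (clear_add gn dn' H1 H2).
- apply: (dleD (a := 2 * n + 2 * h) (b := 2 * n + 2 * h)) => //.
    apply: (dleD (a := 2 * n + 2 * h) (b := 2 * n + 2 * h)) => //.
      have E : dle (a + x2 * g) (n + h) by apply: (dleD sa (dleM sx2 sg')); have [] := ar_add3 n2' h0.
      apply: (dleW (dleM (dleM sa sx2) E)); have [] := ar_add3 n2' h0 => //.
    by apply: dleMn; apply: (dleW (dleM sD (dleX 2 sg'))); have [] := ar_add4 n2' h0.
  by apply: dleN; apply: dleMn; apply: (dleW (dleM sz sy2)); have [] := ar_add4 n2' h0.
have E : dle (a - x2 * g) (n + h - 1) by apply: (dleD sa (dleN (dleM sx2 sg'))); have [] := ar_add5 n2' h0.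
by apply: (leq_ltn_trans (dleX 2 E)); have [] := ar_add5 n2' h0.
Qed.

End Height.

(** The hypotheses say (Y - v) V = (p + q v)^3 for v^2 = W. The point whose abscissa has cube V /
    q^3 and whose ordinate is r p / q is then on the curve, and phi sends it to a point of ordinate
    Y. *)
Lemma cubic_preimage (K : fieldType) (r p q V W Y : K) : 
  r ^+ 2 = - 3%:R -> 3%:R != 0 :> K -> r != 0 -> V != 0 -> q != 0 ->
  Y * V = p ^+ 3 + 3%:R * p * q ^+ 2 * W ->
  - V = 3%:R * p ^+ 2 * q + q ^+ 3 * W ->
  (r * p / q) ^+ 2 = V / q ^+ 3 + W /\
  r * p / q * (V / q ^+ 3 - 8%:R * W) / (r ^+ 3 * (V / q ^+ 3)) = Y.
Proof.
move=> r2 n3 r0 V0 q0 E1 E2; have EV : V = - (3%:R * p ^+ 2 * q + q ^+ 3 * W) by rewrite -E2 opprK.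
have -> : Y = (p ^+ 3 + 3%:R * p * q ^+ 2 * W) / V by rewrite -E1 mulfK.
split; first by rewrite !exprMn r2 EV; field.
have key : p * (V - 8%:R * W * q ^+ 3) = - (3%:R * q) * (p ^+ 3 + 3%:R * p * q ^+ 2 * W).
  by rewrite EV; ring.
have -> : r * p / q * (V / q ^+ 3 - 8%:R * W) / (r ^+ 3 * (V / q ^+ 3)) =
    p * (V - 8%:R * W * q ^+ 3) / (r ^+ 2 * q * V).
  by field; rewrite V0 q0 r0.
by rewrite key r2; field; rewrite V0 q0 oppr_eq0 n3.
Qed.

Lemma sum_model (K : fieldType) (s X1 Y1 X2 Y2 : K) : s != 0 -> X1 - X2 != 0 ->
  let l := (Y1 - Y2) / (X1 - X2) in let X3 := l ^+ 2 / s ^+ 3 - X1 - X2 in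
  let l' := (Y1 - Y2) / (s * X1 - s * X2) in
  l' ^+ 2 - s * X1 - s * X2 = s * X3 /\ l' * (s * X1 - s * X3) - Y1 = l * (X1 - X3) - Y1.
Proof.
move=> s0 n /=; have -> : s * X1 - s * X2 = s * (X1 - X2) by ring.
by split; field; rewrite n s0.
Qed.

(** * Descent along phi *)

Section Descent.

Variable k : closedFieldType.
Hypothesis n2 : 2%:R != 0 :> k.
Hypothesis n3 : 3%:R != 0 :> k.
Variables (A B om0 : k).
Hypothesis A0 : A != 0.
Hypothesis B0 : B != 0.
Hypothesis Hom0 : om0 ^+ 2 + om0 + 1 = 0.
Local Notation F := (RF k).
Local Notation t := (@tv k).
Local Notation u := (@tv k).
Local Notation D := (pf (pD A B)).
Variable E : elliptic_curve F.
Hypothesis Ea : ec_a E = 0.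
Hypothesis Eb : ec_b E = D.

Local Notation w := (cst om0).
Lemma Hw : w ^+ 2 + w + 1 = 0.
Proof. by rewrite -rmorphXn -rmorphD -(rmorph1 cst) -rmorphD Hom0 rmorph0. Qed.

Local Notation om := (om Ea Hw).
Local Notation phi := (phi Ea Hw).

Lemma transc_t6 : transc (t ^+ 6).
Proof.
have -> : t ^+ 6 = pf 'X^6 by rewrite rmorphXn.
by apply: transc_pf; rewrite size_polyXn.
Qed.

Definition it : F -> F := sub transc_t6.
HB.instance Definition _ := GRing.RMorphism.copy it (sub transc_t6).

Lemma it_u : it u = t ^+ 6. Proof. exact: sub_tv. Qed.
Lemma it_cst c : it (cst c) = cst c. Proof. exact: sub_cst. Qed.

Local Notation W := (cst A * u + cst B).
Lemma it_W : it W = D.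
Proof. by rewrite rmorphD rmorphM /= it_u !it_cst pf_pD. Qed.

Lemma on_E x y : on_curve E (Some (x, y)) -> y ^+ 2 = x ^+ 3 + D.
Proof. by move/(on_eq Ea); rewrite Eb. Qed.

Lemma E_x0 x y : on_curve E (Some (x, y)) -> x != 0.
Proof.
move/on_E => H; apply: contraTneq isT => x0.
have := pD_no_power n2 n3 A0 B0 y (isT : 1 < 2)%N (oner_neq0 k).
by rewrite H x0 expr0n add0r rmorph1 mul1r eqxx.
Qed.

Lemma E_y0 x y : on_curve E (Some (x, y)) -> y != 0.
Proof.
move/on_E => H; apply: contraTneq isT => y0.
have n1 : - 1 != 0 :> k by rewrite oppr_eq0 oner_neq0.
have := pD_no_power n2 n3 A0 B0 x (isT : 1 < 3)%N n1.
rewrite rmorphN rmorph1 mulN1r -addr_eq0 -H y0 expr0n eqxx //.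
Qed.

Lemma mkP x y : y ^+ 2 = x ^+ 3 + D -> on_curve E (Some (x, y)).
Proof. by move=> H; rewrite /= Ea mul0r addr0 Eb H. Qed.

(* The points coming from [Y^2 = u^m X^3 + A u + B] over k(u); the values of [it] are the functions of t^6. *)
Definition inM m (R : ec_point E) : Prop := R = 0 \/
  exists X Y, ec_coords R = Some (t ^+ (2 * m) * it X, it Y).

Lemma inM_om m R : inM m R -> inM m (om R).
Proof.
case=> [->|[X [Y H]]]; first by rewrite raddf0; left.
right; exists (w * X), Y; rewrite (omE _ _ H) rmorphM /= it_cst.
by congr (Some (_, _)); rewrite mulrCA.
Qed.

Lemma t2m_neq0 m : t ^+ (2 * m) != 0.
Proof. by rewrite expf_neq0 ?tv0. Qed.

Lemma t2m_cube m : (t ^+ (2 * m)) ^+ 3 = it (u ^+ m).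
Proof. by rewrite rmorphXn /= it_u -!exprM; congr (_ ^+ _); rewrite mulnAC. Qed.

Lemma inM_curve m (R : ec_point E) X Y : ec_coords R = Some (t ^+ (2 * m) * it X, it Y) ->
  Y ^+ 2 = u ^+ m * X ^+ 3 + W /\ X != 0.
Proof.
move=> H; have o := on_coords H; split; last first.
  by have := E_x0 o; rewrite mulf_eq0 negb_or fmorph_eq0 => /andP[].
have := on_E o; rewrite exprMn t2m_cube -it_W -!rmorphXn -rmorphM -rmorphD => /eqP.
by rewrite fmorph_eq => /eqP.
Qed.

Lemma inM_sum m (R P : ec_point E) X1 Y1 X2 Y2 :
  ec_coords R = Some (t ^+ (2 * m) * it X1, it Y1) ->
  ec_coords P = Some (t ^+ (2 * m) * it X2, it Y2) -> X1 - X2 != 0 ->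
  let l := (Y1 - Y2) / (X1 - X2) in let X3 := l ^+ 2 / u ^+ m - X1 - X2 in
  ec_coords (R + P) = Some (t ^+ (2 * m) * it X3, it (l * (X1 - X3) - Y1)).
Proof.
move=> HR HP n l X3.
have n' : it X1 - it X2 != 0 by rewrite subr_eq0 fmorph_eq -subr_eq0; exact: n.
have nx : t ^+ (2 * m) * it X1 != t ^+ (2 * m) * it X2.
  by rewrite (inj_eq (mulfI (t2m_neq0 m))) -subr_eq0; exact: n'.
have := sum_model (it Y1) (it Y2) (t2m_neq0 m) n'.
rewrite (addE HR HP nx) t2m_cube /= => -[-> ->].
by rewrite /X3 /l !(rmorphB, rmorphM, fmorphV, rmorphXn).
Qed.

(** [cubic_preimage] gives a point whose image has the ordinate of R. The abscissas then agree up to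
    a cube root of unity, which is corrected by [om]. *)
Lemma phi_pre m (R : ec_point E) X Y : ec_coords R = Some (t ^+ (2 * m) * it X, it Y) ->
  cubic_class A B m Y -> exists R', inM m R' /\ R = phi R'.
Proof.
move=> HR [p [q [E1 E2]]].
have [a1 Ha1] := closed_root A (isT : 0 < 3)%N.
set V := (cst A * u) ^+ m in E1 E2.
have V0 : V != 0 by apply: expf_neq0; apply: mulf_neq0 (tv0 k); rewrite cst_eq0.
have q0 : q != 0.
  by apply: contraNneq V0 => q0; rewrite -oppr_eq0 E2 q0 expr0n /= mulr0 mul0r addr0.
have r2 := r2E Hw; have r0 := r_neq0 Ea Hw.
have n3F : 3%:R != 0 :> F by rewrite -(rmorph_nat cst) cst_eq0.
have itr : it (w - w ^+ 2) = w - w ^+ 2 by rewrite rmorphB rmorphXn /= it_cst.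
have [C1 C2] := cubic_preimage r2 n3F r0 V0 q0 E1 E2.
(* Under u = t^6 the element (A u)^m is the cube of a1^m t^(2m), so V / q^3 has this cube root, and
   it has the shape demanded by [inM]. *)
set x' := t ^+ (2 * m) * it (cst a1 ^+ m / q); set y' := it ((w - w ^+ 2) * p / q).
have Hx' : x' ^+ 3 = it (V / q ^+ 3).
  rewrite exprMn t2m_cube -(rmorphXn it) -(rmorphM it) /= expr_div_n -exprM mulnC exprM.
  by rewrite -(rmorphXn cst) /= Ha1 mulrA /V exprMn [u ^+ m * _]mulrC.
have oR' : on_curve E (Some (x', y')).
  by apply: mkP; rewrite Hx' -(rmorphXn it) /= C1 rmorphD /= it_W.
pose R' := EcPoint oR'.
have cR' : ec_coords R' = Some (x', y') by [].
have mR' : inM m R' by right; do 2!eexists; exact: cR'.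
have := phiE Ea Hw E_x0 cR'.
have -> : y' * (x' ^+ 3 - 8%:R * ec_b E) / ((w - w ^+ 2) ^+ 3 * x' ^+ 3) = it Y.
  by rewrite -C2 Hx' Eb -it_W -{1}itr /y' !(fmorph_div, rmorphM, rmorphB, rmorphXn, rmorph_nat).
move=> HphiR.
have := on_E (on_coords HphiR); rewrite (on_E (on_coords HR)) => /addIr /(cube_eq Hw) Hx.
set x'' := _ / _ in HphiR Hx.
case: Hx => Hx; [exists R' | exists (om R') | exists (om (om R'))]; split=> //.
- by apply: val_inj; rewrite [LHS]HR [RHS]HphiR Hx.
- exact: inM_om.
- by rewrite phi_om; apply: val_inj; rewrite [LHS]HR [RHS](omE Ea Hw HphiR) Hx.
- by do 2!apply: inM_om.
rewrite !phi_om; apply: val_inj.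
by rewrite [LHS]HR [RHS](omE Ea Hw (omE Ea Hw HphiR)) Hx expr2 mulrA.
Qed.

(* No condition at the point at infinity. *)
Definition hR (R : ec_point E) n := if ec_coords R is Some (x, _) then hle x n else True.

Lemma hRE R x y n : ec_coords R = Some (x, y) -> hR R n -> hle x n.
Proof. by rewrite /hR => ->. Qed.

Lemma hR_phi R N : hR (phi R) N -> hR R (N %/ 3).
Proof.
case HR: (ec_coords R) => [[x y]|]; last by rewrite /hR HR.
have Hphi := phiE Ea Hw E_x0 HR; rewrite /hR HR Hphi Eb.
exact: (hle_phi n2 n3 A0 B0 (on_E (on_coords HR)) (E_x0 (on_coords HR))).
Qed.

Lemma hR_ex R : exists n, hR R n.
Proof.
rewrite /hR; case: (ec_coords R) => [[x y]|]; last by exists 0%N.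
have [a [b [b0 ->]]] := pf_ex x; exists (size a + (size b).+1)%N, a, b; split=> //.
  by rewrite leqW // leq_addr.
by rewrite leq_addl.
Qed.

(** Infinite descent on the height bound n: if n > 2 h then (2 n + 2 h) / 3 < n, so every point
    reduces to points of height at most 2 h. *)
Lemma descent m h (S : ec_point E -> Prop) :
  (forall R P, S R -> S P -> S (phi R - P)) ->
  (forall R, inM m R -> hR R (2 * h) -> S R) ->
  (forall R, inM m R -> S R \/ exists P R', [/\ S P, inM m R', R = phi R' - P &
     forall n, hR R n -> hR R' ((2 * n + 2 * h) %/ 3)]) ->
  forall R, inM m R -> S R.
Proof.
move=> HS Hsmall Hstep R mR; have [n hn] := hR_ex R.
elim/ltn_ind: n R mR hn => n IH R mR hn.
have [le|lt] := leqP n (2 * h).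
  apply: Hsmall => //; move: hn; rewrite /hR; case: (ec_coords R) => [[x y]|//].
  move=> [a [g [g0 Ex sa sg]]]; exists a, g; split=> //; first exact: leq_trans sa _.
  exact: leq_trans sg le.
case: (Hstep R mR) => // -[P [R' [SP mR' ER Hn]]]; rewrite ER; apply: HS => //.
apply: (IH _ _ _ mR' (Hn _ hn)); rewrite ltn_divLR //.
by move: lt; clear; lia.
Qed.

End Descent.

(** * The components m = 0, 1, 2 *)

Fact ar_step (n h : nat) : (n %/ 3 <= (2 * n + 2 * h) %/ 3)%N.
Proof. lia. Qed.

Section Lines.

Variable k : closedFieldType.
Hypothesis n2 : 2%:R != 0 :> k.
Hypothesis n3 : 3%:R != 0 :> k.
Variables (A B om0 : k).
Hypothesis A0 : A != 0.
Hypothesis B0 : B != 0.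
Hypothesis Hom0 : om0 ^+ 2 + om0 + 1 = 0.
Local Notation F := (RF k).
Local Notation t := (@tv k).
Local Notation u := (@tv k).
Local Notation D := (pf (pD A B)).
Variable E : elliptic_curve F.
Hypothesis Ea : ec_a E = 0.
Hypothesis Eb : ec_b E = D.
Local Notation w := (cst om0).
Local Notation om := (om Ea (Hw Hom0)).
Local Notation phi := (phi Ea (Hw Hom0)).
Local Notation W := (cst A * u + cst B).
Local Notation inM := (@inM k E).
Local Notation hR := (@hR k E).
Local Notation it := (@it k).

Lemma hR_leq R a b : (a <= b)%N -> hR R a -> hR R b.
Proof.
rewrite /hR; case: (ec_coords R) => [[x y]|//] ab [p [q [q0 Ex sp sq]]].
by exists p, q; split=> //; [exact: leq_trans sp _ | exact: leq_trans sq ab].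
Qed.

Lemma mkM_on m X Y : Y ^+ 2 = u ^+ m * X ^+ 3 + W ->
  on_curve E (Some (t ^+ (2 * m) * it X, it Y)).
Proof.
move=> H; apply: (mkP Ea Eb).
rewrite exprMn t2m_cube -it_W -!(rmorphXn it) -(rmorphM it) -(rmorphD it) /= -H.
by [].
Qed.

Definition mkM m X Y (H : Y ^+ 2 = u ^+ m * X ^+ 3 + W) : ec_point E := EcPoint (mkM_on H).

(** (X2, Y2 z) is the point P whose class cancels the nontrivial one attached to the root z of B. If
    R has trivial class it is in the image of phi; otherwise R + P is. The polynomial coordinates
    x2, y2 of P, of degrees at most h and 2 h, give the height bound. If R and P have the same
    abscissa, R is P or - P and already lies in S. *)
Lemma step (m h : nat) (S : ec_point E -> Prop) (z0 : k) (X2 : F) (Y2 : k -> F) (c : k -> k)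
    (x2 : {poly k}) (y2 : k -> {poly k}) :
  (m < 3)%N -> (0 < h)%N -> z0 ^+ 2 = B ->
  (forall z, z ^+ 2 = B -> Y2 z ^+ 2 = u ^+ m * X2 ^+ 3 + W) ->
  (forall z, z ^+ 2 = B -> c z != 0 /\ iw B A0 (Y2 z) + t = cst (c z) * (t - cst z) ^+ m) ->
  t ^+ (2 * m) * it X2 = pf x2 -> dle x2 h ->
  (forall z, z ^+ 2 = B -> it (Y2 z) = pf (y2 z) /\ dle (y2 z) (2 * h)) ->
  S 0 -> (forall R, S R -> S (- R)) ->
  (forall R z, z ^+ 2 = B -> ec_coords R = Some (t ^+ (2 * m) * it X2, it (Y2 z)) -> S R) ->
  forall R, inM m R -> S R \/ exists P R', [/\ S P, inM m R', R = phi R' - P &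
     forall n, hR R n -> hR R' ((2 * n + 2 * h) %/ 3)].
Proof.
move=> m3 h0 Ez0 HC2 HY2 Hx2 sx2 Hy2 S0 SN SP R [->|[X [Y HR]]]; first by left.
have [HC X0] := inM_curve n2 n3 A0 B0 Ea Eb HR.
have z00 : z0 != 0 by apply: contraNneq B0 => E0; rewrite -Ez0 E0 expr0n.
have [cc|[z [g [Ez Hg]]]] := selmer n2 A0 m3 z00 (esym Ez0) X0 HC.
  have [R' [mR' ER]] := phi_pre n2 n3 A0 B0 Hom0 Ea Eb HR cc.
  right; exists 0, R'; split=> //; first by rewrite subr0.
  move=> n; rewrite {1}ER => /(hR_phi n2 n3 A0 B0 Eb); apply: hR_leq; exact: ar_step.
have [c0 Hc] := HY2 z Ez; have [Ey sy] := Hy2 z Ez.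
pose P := mkM (HC2 z Ez).
have HP : ec_coords P = Some (t ^+ (2 * m) * it X2, it (Y2 z)) by [].
have [EX|nX] := eqVneq (X - X2) 0.
  left; have EX2 : X = X2 by apply/eqP; rewrite -subr_eq0 EX.
  have /eqP : Y ^+ 2 = Y2 z ^+ 2 by rewrite HC (HC2 z Ez) EX2.
  rewrite eqf_sqr => /orP[] /eqP EY.
    by apply: (SP _ z Ez); rewrite HR EX2 EY.
  rewrite -[R]opprK; apply: SN; apply: (SP _ z Ez).
  by rewrite (oppE HR) EX2 EY rmorphN opprK.
have HS := inM_sum HR HP nX.
have nY : Y ^+ 2 != W.
  rewrite HC -subr_eq0 addrK; apply: mulf_neq0 (expf_neq0 3 X0).
  exact: expf_neq0 (tv0 k).
have cs := cubic_class_sum n2 nX c0 Ez nY HC (HC2 z Ez) Hg Hc.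
have [R' [mR' ER]] := phi_pre n2 n3 A0 B0 Hom0 Ea Eb HS cs.
right; exists P, R'; split=> //; first by apply: (SP _ z Ez).
  by rewrite -ER addrK.
move=> n hn; apply: (hR_phi (Hom0 := Hom0) (Ea := Ea) n2 n3 A0 B0 Eb); rewrite -ER.
have nx : t ^+ (2 * m) * it X != t ^+ (2 * m) * it X2.
  by rewrite (inj_eq (mulfI (t2m_neq0 k m))) fmorph_eq -subr_eq0; exact: nX.
rewrite /hR (addE HR HP nx) /=.
have o1 := on_E Ea Eb (on_coords HR); have o2 := on_E Ea Eb (on_coords HP).
rewrite -subr_eq0 in nx; rewrite Hx2 Ey in o2 nx *.
exact: (hle_add A0 h0 sx2 sy (hRE HR hn) o1 o2 nx).
Qed.

(** For m = 0 the exceptional factor (w - z)^m is 1, so every class is trivial and R is divisible by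
    phi again and again. The descent runs with h = 0, and no affine point satisfies [hle] with bound
    0. *)
Lemma M0_trivial R : inM 0 R -> R = 0.
Proof.
move=> mR; have [z0 Ez0] := closed_root B (isT : 0 < 2)%N.
apply: (descent (Hom0 := Hom0) (Ea := Ea) (m := 0) (h := 0) (S := fun R => R = 0) _ _ _ mR).
- by move=> R1 P -> ->; rewrite raddf0 subr0.
- move=> R1 _; rewrite /hR muln0; case HR: (ec_coords R1) => [[x y]|]; last by rewrite (coords0 HR).
  by case=> a [g [_ _ _]].
move=> R1 [->|[X [Y HR]]]; [by left | right].
have [HC X0] := inM_curve n2 n3 A0 B0 Ea Eb HR.
have z00 : z0 != 0 by apply: contraNneq B0 => E0; rewrite -Ez0 E0 expr0n.
have cc : cubic_class A B 0 Y.
  have [//|[z [g [Ez Hg]]]] := selmer n2 A0 (isT : 0 < 3)%N z00 (esym Ez0) X0 HC.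
  by apply: (cubic_classI n2 (A0 := A0) (g := g)); rewrite Hg !expr0 mulr1 mul1r.
have [R' [mR' ER]] := phi_pre n2 n3 A0 B0 Hom0 Ea Eb HR cc.
exists 0, R'; split=> //; first by rewrite subr0.
move=> n; rewrite {1}ER => /(hR_phi n2 n3 A0 B0 Eb); apply: hR_leq; exact: ar_step.
Qed.

End Lines.

Section Small.

Variable k : closedFieldType.
Local Notation F := (RF k).
Local Notation t := (@tv k).
Local Notation it := (@it k).

Lemma it_pf p : it (pf p) = pf (p \Po 'X^6).
Proof. by rewrite /it sub_pf -pfX -rmorphXn evp_pf. Qed.

Lemma size_comp6 (p : {poly k}) : p != 0 -> size (p \Po 'X^6) = (6 * (size p).-1).+1.
Proof.
move=> p0; have := size_comp_poly p 'X^6; rewrite size_polyXn /= mulnC => <-.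
by rewrite prednK // size_poly_gt0 comp_poly_eq0 // size_polyXn.
Qed.

(** Substituting t^6 keeps p and q coprime, so in t^(2m) p(t^6) / q(t^6) only t^(2m) can cancel
    against the denominator, lowering its degree by at most 2m; nothing cancels when q is
    constant. *)
Lemma small_deg m N (p q : {poly k}) : p != 0 -> q != 0 -> coprimep p q ->
  hle (t ^+ (2 * m) * it (pf p / pf q)) N ->
  [/\ 6 * (size p).-1 <= N, 6 * (size q).-1 + 2 <= N + 2 * m &
     size q = 1%N -> 2 * m + 6 * (size p).-1 <= N]%N.
Proof.
move=> p0 q0 cpq [a [g [g0 Ex sa sg]]].
pose p6 := p \Po 'X^6; pose q6 := q \Po 'X^6.
have s6 : (1 < size ('X^6 : {poly k}))%N by rewrite size_polyXn.
have p60 : p6 != 0 by rewrite comp_poly_eq0.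
have q60 : q6 != 0 by rewrite comp_poly_eq0.
have c6 : coprimep p6 q6 by exact: coprimep_comp_poly.
have Eq : 'X^(2 * m) * p6 * g = a * q6.
  apply: pf_inj; rewrite !rmorphM rmorphXn /= pfX.
  have qn : pf q6 != 0 by rewrite pf_eq0.
  have gn : pf g != 0 by rewrite pf_eq0.
  move: Ex; rewrite fmorph_div /= !it_pf mulrA => /eqP.
  by rewrite (eqr_div _ _ qn gn) => /eqP.
have a0 : a != 0.
  apply: contraNneq (mulf_neq0 (mulf_neq0 (_ : 'X^(2 * m) != 0) p60) g0) => [E|].
    by rewrite Eq E mul0r.
  by rewrite monic_neq0 ?monicXn.
have d1 : p6 %| a by rewrite -(Gauss_dvdpl _ c6) -Eq mulrAC dvdp_mulIr.
have d2 : q6 %| 'X^(2 * m) * g.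
  rewrite -(Gauss_dvdpr _ (_ : coprimep q6 p6)) 1?coprimep_sym //.
  by rewrite mulrCA mulrA Eq dvdp_mulIr.
have sp := size_comp6 p0; have sq := size_comp6 q0.
have g1 : (0 < size g)%N by rewrite size_poly_gt0.
have s1 : (size p6 <= size a)%N by exact: dvdp_leq.
have X0 : 'X^(2 * m) != 0 :> {poly k} by rewrite monic_neq0 ?monicXn.
have s2 : (size q6 <= 2 * m + size g)%N.
  by rewrite -size_mulXn // mulrC; apply: dvdp_leq d2; rewrite mulf_neq0.
split.
- by rewrite -ltnS -sp; exact: leq_trans s1 sa.
- rewrite sq in s2; move: s2 sg g1; clear; move: (size g) (_.-1); lia.
move=> q1; have := congr1 (fun p : {poly k} => size p) Eq.
rewrite -mulrA mulrC size_mulXn ?mulf_neq0 // !size_mul // sp sq q1 /= muln0 addn1 /=.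
by move=> E; move: E sa sg g1; clear; move: (size g) (size a) (_.-1); lia.
Qed.

End Small.

(** Origin of the generator for m = 2: a constant abscissa c is sought for which c^3 u^2 + A u + B
    is a perfect square, that is, of zero discriminant, so c^3 = A^2 / (4 B). *)
Lemma yline2_alg (K : fieldType) (z a u : K) : 2%:R != 0 :> K -> z != 0 ->
  ((2%:R * z)^-1 * (a * u + 2%:R * z ^+ 2)) ^+ 2 =
  u ^+ 2 * (a ^+ 2 / (4%:R * z ^+ 2)) + (a * u + z ^+ 2).
Proof.
move=> n2 z0; have n4 : 4%:R != 0 :> K by rewrite (natrM _ 2 2) mulf_neq0.
by field; rewrite z0 n4 n2.
Qed.

Lemma iw_alg (K : fieldType) (z t : K) : 2%:R != 0 :> K -> z != 0 ->
  (2%:R * - z)^-1 * (t ^+ 2 - z ^+ 2 + 2%:R * z ^+ 2) + t = (2%:R * - z)^-1 * (t - z) ^+ 2.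
Proof. by move=> n2 z0; field; rewrite oppr_eq0 z0 n2. Qed.

Lemma clear_pole (K : fieldType) (u a b p q : K) : q != 0 ->
  (u ^+ 2 * (p / q) ^+ 3 + (a * u + b)) * (q ^+ 2) ^+ 2 =
  (u ^+ 2 * p ^+ 3 + (a * u + b) * q ^+ 3) * q.
Proof. by move=> q0; field. Qed.

Section Spans.

Variable k : closedFieldType.
Hypothesis n2 : 2%:R != 0 :> k.
Hypothesis n3 : 3%:R != 0 :> k.
Variables (A B om0 : k).
Hypothesis A0 : A != 0.
Hypothesis B0 : B != 0.
Hypothesis Hom0 : om0 ^+ 2 + om0 + 1 = 0.
Local Notation F := (RF k).
Local Notation t := (@tv k).
Local Notation u := (@tv k).
Local Notation D := (pf (pD A B)).
Variable E : elliptic_curve F.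
Hypothesis Ea : ec_a E = 0.
Hypothesis Eb : ec_b E = D.
Local Notation w := (cst om0).
Local Notation om := (om Ea (Hw Hom0)).
Local Notation phi := (phi Ea (Hw Hom0)).
Local Notation W := (cst A * u + cst B).
Local Notation inM := (@inM k E).
Local Notation hR := (@hR k E).
Local Notation it := (@it k).

Definition eis_span (P R : ec_point E) : Prop := exists a b : int, R = P *~ a + om P *~ b.

Lemma span0 P : eis_span P 0.
Proof. by exists 0, 0; rewrite !mulr0z addr0. Qed.

Lemma spanN P R : eis_span P R -> eis_span P (- R).
Proof. by case=> a [b ->]; exists (- a), (- b); rewrite !mulrNz opprD. Qed.

Lemma spanD P R S : eis_span P R -> eis_span P S -> eis_span P (R + S).
Proof.
case=> a [b ->] [c [d ->]]; exists (a + c), (b + d).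
by rewrite !mulrzDr addrACA.
Qed.

Lemma span_id P : eis_span P P.
Proof. by exists 1, 0; rewrite mulr0z addr0. Qed.

Lemma om2E P : om (om P) = - P - om P.
Proof.
apply: (addrI (P + om P)); rewrite (om_sum _ _ (E_x0 n2 n3 A0 B0 Ea Eb)).
by rewrite addrACA !subrr addr0.
Qed.

Lemma span_om P R : eis_span P R -> eis_span P (om R).
Proof.
case=> a [b ->]; rewrite raddfD !raddfMz /= om2E.
exists (- b), (a - b); rewrite mulrzBl mulNrz mulrNz mulrzBr addrCA; congr (_ + _).
Qed.

Lemma span_phi P R S : eis_span P R -> eis_span P S -> eis_span P (phi R - S).
Proof.
move=> HR HS; apply: spanD (spanN HS); apply: spanD; first exact: span_om.
by apply: spanN; do 2!apply: span_om.
Qed.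

Lemma span_coords m (P R : ec_point E) X Y X' Y' :
  ec_coords P = Some (t ^+ (2 * m) * it X, it Y) ->
  ec_coords R = Some (t ^+ (2 * m) * it X', it Y') ->
  X' ^+ 3 = X ^+ 3 -> Y' ^+ 2 = Y ^+ 2 -> eis_span P R.
Proof.
move=> HP HR EX /eqP; rewrite eqf_sqr.
wlog EY : R Y' HR / Y' = Y => [WL | _].
  case/orP => /eqP EY; first by apply: (WL R Y') => //; rewrite EY eqxx.
  rewrite -[R]opprK; apply: spanN; apply: (WL (- R) Y); rewrite ?eqxx //.
  by rewrite (oppE HR) EY rmorphN opprK.
have C m0 z : it (cst z * m0) = cst z * it m0 by rewrite rmorphM /= it_cst.
case: (cube_eq (Hw Hom0) EX) => E'.
- suff -> : R = P by exact: span_id.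
  by apply: val_inj; rewrite [LHS]HR [RHS]HP E' EY.
- suff -> : R = om P by apply: span_om; exact: span_id.
  by apply: val_inj; rewrite [LHS]HR [RHS](omE _ _ HP) E' EY C mulrCA.
suff -> : R = om (om P) by do 2!apply: span_om; exact: span_id.
apply: val_inj; rewrite [LHS]HR [RHS](omE _ _ (omE _ _ HP)) E' EY expr2 -mulrA !C.
by rewrite !(mulrCA (t ^+ _)).
Qed.

Section LineOne.

Variables (a1 z0 : k) (P : ec_point E).
Hypothesis Ea1 : a1 ^+ 3 = A.
Hypothesis Ez0 : z0 ^+ 2 = B.
Hypothesis HP : ec_coords P = Some (t ^+ (2 * 1) * it (cst (- a1)), it (cst z0)).

(** The bound 4 forces X to be a constant c. Then c^3 u + A u + B is a square of degree at most 1 in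
    u, hence constant: c^3 = - A, which is where the generator (- a1, z0) comes from. *)
Lemma M1_small R : inM 1 R -> hR R 4 -> eis_span P R.
Proof.
case=> [->|[X [Y HR]]]; first by move=> _; exact: span0.
have [HC X0] := inM_curve n2 n3 A0 B0 Ea Eb HR.
move=> /(hRE HR).
have [p [q [q0 cpq EX]]] := pf_coprime_ex X.
have p0 : p != 0 by apply: contraNneq X0 => E0; rewrite EX E0 rmorph0 mul0r.
rewrite EX => /(small_deg p0 q0 cpq) [sp sq _].
have {}sp : (size p <= 1)%N by move: sp; case: (size p) => [|[|n]] //; clear; lia.
have {}sq : (size q <= 1)%N by move: sq; case: (size q) => [|[|n]] //; clear; lia.
have {EX} [c EX] : exists c, X = cst c.
  exists (p`_0 / q`_0); rewrite EX (size1_polyC sp) (size1_polyC sq) !pfC fmorph_div.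
  by rewrite !coefC.
have HY : Y ^+ 2 = pf ((c ^+ 3 + A) *: 'X + B%:P).
  rewrite HC EX -mul_polyC rmorphD rmorphM /= pfX !pfC rmorphD rmorphXn /=.
  by ring.
have cA : c ^+ 3 + A = 0.
  have [y Ey] := pf_sqr HY; move: (HY); rewrite Ey -(rmorphXn pf) => /pf_inj Hy.
  apply/eqP/negPn/negP => nz; have := size_exp y 2.
  rewrite Hy -mul_polyC size_MXaddC polyC_eq0 (negPf nz) size_polyC nz /=.
  by move/(congr1 odd); rewrite oddM andbF.
apply: (span_coords HP HR).
  by rewrite EX -!rmorphXn /= exprNn Ea1 -signr_odd expr1 mulN1r; congr cst; apply/eqP; rewrite -addr_eq0 cA.
by rewrite HY cA scale0r add0r pfC -Ez0 rmorphXn.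
Qed.

Lemma M1_span R : inM 1 R -> eis_span P R.
Proof.
move=> mR; apply: (descent (Hom0 := Hom0) (Ea := Ea) (m := 1) (h := 2) (S := eis_span P) _ _ _ mR).
- by move=> R1 R2; exact: span_phi.
- exact: M1_small.
pose Y2 z : F := cst (- z).
apply: (step n2 n3 (A0 := A0) B0 Hom0 Ea Eb (z0 := z0) (X2 := cst (- a1)) (Y2 := Y2)
  (c := fun=> 1) (x2 := - a1 *: 'X^2) (y2 := fun z => (- z)%:P)) => //.
- move=> z Ez; rewrite /Y2 -!rmorphXn /= sqrrN exprNn Ea1 Ez -signr_odd !expr1 mulN1r.
  by rewrite rmorphN mulrN addrA [_ * u]mulrC addNr add0r.
- by move=> z Ez; rewrite oner_neq0 /Y2 iw_cst rmorphN rmorph1 mul1r expr1 addrC.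
- by rewrite it_cst -mul_polyC rmorphM rmorphXn /= pfX pfC mulrC.
- by rewrite /dle (leq_trans (size_scale_leq _ _)) // size_polyXn.
- by move=> z Ez; rewrite /Y2 it_cst pfC /dle size_polyC; split=> //; case: (_ != _).
- exact: span0.
- by move=> R1; exact: spanN.
move=> R1 z Ez HR1; apply: (span_coords HP HR1) => //.
by rewrite /Y2 -!(rmorphXn cst) /= sqrrN Ez Ez0.
Qed.

End LineOne.

Section LineTwo.

Variables (c0 z0 : k) (P : ec_point E).
Hypothesis Ez0 : z0 ^+ 2 = B.
Hypothesis Ec0 : c0 ^+ 3 = A ^+ 2 / (4%:R * B).
Definition yline2 z : F := cst (2%:R * z)^-1 * (cst A * u + cst (2%:R * B)).
Hypothesis HP : ec_coords P = Some (t ^+ (2 * 2) * it (cst c0), it (yline2 z0)).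

Lemma yline2_sqr z : z ^+ 2 = B -> yline2 z ^+ 2 = u ^+ 2 * cst c0 ^+ 3 + W.
Proof.
move=> Ez; rewrite /yline2 -(rmorphXn cst) /= Ec0 -Ez.
have z00 : z != 0 by apply: contraNneq B0 => E0; rewrite -Ez E0 expr0n.
have n2F : 2%:R != 0 :> F by rewrite -(rmorph_nat cst) cst_eq0.
have zF : cst z != 0 by rewrite cst_eq0.
rewrite !(fmorphV, fmorph_div, rmorphM, rmorphXn, rmorph_nat) /=.
exact: yline2_alg.
Qed.

(** The bound 8 leaves a denominator q of degree at most 1. Degree 1 is excluded by parity: at the
    root of q a square would have odd multiplicity. Then p is constant too, and the vanishing of the
    discriminant of c^3 u^2 + A u + B gives c^3 = c0^3. *)
Lemma M2_small R : inM 2 R -> hR R 8 -> eis_span P R.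
Proof.
case=> [->|[X [Y HR]]]; first by move=> _; exact: span0.
have [HC X0] := inM_curve n2 n3 A0 B0 Ea Eb HR.
move=> /(hRE HR).
have [p [q [q0 cpq EX]]] := pf_coprime_ex X.
have p0 : p != 0 by apply: contraNneq X0 => E0; rewrite EX E0 rmorph0 mul0r.
rewrite EX => /(small_deg p0 q0 cpq) [sp sq sp2].
have qn : pf q != 0 by rewrite pf_eq0.
have {}sq : size q = 1%N.
  have q1 : (0 < size q)%N by rewrite size_poly_gt0.
  have q3 : (size q < 3)%N by move: sq; case: (size q) => [|[|[|n]]] //; clear; lia.
  apply/eqP; move: q1 q3; case Es: (size q) => [|[|[|n]]] // _ _.
  have [r rq] : exists r, root q r by apply/closed_rootP; rewrite Es.
  have mq : mup r q = 1%N.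
    apply/eqP; rewrite eqn_leq -XsubC_dvd // dvdp_XsubCl rq andbT mup_leq //.
    by apply/negP => /(dvdp_leq q0); rewrite size_exp_XsubC Es.
  have pr : ~~ root p r.
    by apply/negP => pr; have := coprimep_root cpq pr; rewrite (rootP rq) eqxx.
  pose N : {poly k} := 'X^2 * p ^+ 3 + (A *: 'X + B%:P) * q ^+ 3.
  have HN : (Y * pf q ^+ 2) ^+ 2 = pf (N * q).
    rewrite exprMn HC EX /N !(rmorphM, rmorphD, rmorphXn) -mul_polyC rmorphM /= pfX !pfC.
    exact: clear_pole.
  have [z Ez] := pf_sqr HN; move: HN; rewrite Ez -(rmorphXn pf) => /pf_inj HN.
  (* N has multiplicity 0 at r, except that it is 2 if r = 0, because of the factor u^2. *)
  have [N0 mN] : N != 0 /\ ~~ odd (mup r N).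
    have nz (f : {poly k}) x : ~~ root f x -> f != 0 by apply: contraNneq => ->; rewrite root0.
    have [r0|r0] := eqVneq r 0; last first.
      suff rN : ~~ root N r by split; [exact: nz rN | rewrite mupNroot].
      rewrite /root /N hornerD [('X^2 * _).[_]]hornerM hornerXn [(_ * q ^+ 3).[_]]hornerM !horner_exp.
      by rewrite (rootP rq) expr0n mulr0 addr0 mulf_neq0 ?expf_neq0.
    rewrite r0 in rq pr *; have /factor_theorem [q' Eq'] := rq.
    pose M : {poly k} := p ^+ 3 + (A *: 'X + B%:P) * q' ^+ 3 * 'X.
    have NE : N = 'X^2 * M by rewrite /N Eq' /M subr0; ring.
    have rM : ~~ root M 0.
      rewrite /root /M hornerD horner_exp [(_ * 'X).[_]]hornerM hornerX mulr0 addr0.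
      by rewrite expf_eq0.
    have X2 : 'X^2 != 0 :> {poly k} by rewrite monic_neq0 ?monicXn.
    rewrite NE; split; first exact: mulf_neq0 X2 (nz _ _ rM).
    rewrite (mupMl _ rM).
    by have := mup_XsubCX 2 (0 : k) 0; rewrite subr0 eqxx => ->.
  have z00 : z != 0 by move: (mulf_neq0 N0 q0); rewrite -HN expf_eq0.
  have := congr1 (fun f => odd (mup r f)) HN.
  by rewrite /= mupX // mupM // mq oddM oddD (negPf mN).
have {sp2} /eqP sp1 : size p == 1%N.
  rewrite eqn_leq size_poly_gt0 p0 andbT; move: (sp2 sq).
  by case: (size p) => [|[|n]] //; clear; lia.
have {EX} [c EX] : exists c, X = cst c.
  exists (p`_0 / q`_0); rewrite EX (size1_polyC (eq_leq sp1)) (size1_polyC (eq_leq sq)) !pfC fmorph_div.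
  by rewrite !coefC.
have HY : Y ^+ 2 = pf ((c ^+ 3) *: 'X^2 + A *: 'X + B%:P).
  rewrite HC EX -!mul_polyC !(rmorphXn, rmorphM, rmorphD) /= pfX !pfC.
  by rewrite [u ^+ 2 * _]mulrC addrA.
have [y Ey] := pf_sqr HY; move: (HY); rewrite Ey -(rmorphXn pf) => /pf_inj Hy.
have sy : (size y <= 2)%N.
  apply: (dle_sqr (a := 1)); rewrite Hy.
  apply: (dleD (a := 2) (b := 0)) => //; last by rewrite /dle size_polyC; case: (_ != _).
  apply: (dleD (a := 2) (b := 1)) => //.
    by rewrite /dle (leq_trans (size_scale_leq _ _)) // size_polyXn.
  by rewrite /dle (leq_trans (size_scale_leq _ _)) // size_polyX.
have Ey2 : y = y`_1 *: 'X + (y`_0)%:P.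
  apply/polyP => -[|[|i]]; rewrite coefD coefZ coefX coefC /= ?(mulr1, mulr0, add0r, addr0) //.
  by rewrite nth_default // (leq_trans sy).
move: (y`_0) (y`_1) Ey2 => y0 y1 Ey2.
have E3 : (y1 ^+ 2) *: 'X^2 + (2%:R * y0 * y1) *: 'X + (y0 ^+ 2)%:P =
     (c ^+ 3) *: 'X^2 + A *: 'X + B%:P.
  by rewrite -Hy Ey2 -!mul_polyC !(rmorphM, rmorphXn, rmorph_nat) /=; ring.
have Ec i := congr1 (fun f : {poly k} => f`_i) E3.
have := Ec 0%N; have := Ec 1%N; have := Ec 2%N.
rewrite !(coefD, coefZ, coefXn, coefX, coefC) /= !(mulr1, mulr0, add0r, addr0) => E2 E1 E0.
have y00 : y0 != 0 by apply: contraNneq B0 => E4; rewrite -E0 E4 expr0n.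
have Ecc : c ^+ 3 = c0 ^+ 3.
  rewrite Ec0 -E2 -E1 -E0; have n4 : 4%:R != 0 :> k by rewrite (natrM _ 2 2) mulf_neq0.
  by field; rewrite y00 n4.
apply: (span_coords HP HR); first by rewrite EX -!(rmorphXn cst) /= Ecc.
by rewrite HC EX (yline2_sqr Ez0) -!(rmorphXn cst) /= Ecc.
Qed.

Lemma M2_span R : inM 2 R -> eis_span P R.
Proof.
move=> mR; apply: (descent (Hom0 := Hom0) (Ea := Ea) (m := 2) (h := 4) (S := eis_span P) _ _ _ mR).
- by move=> R1 R2; exact: span_phi.
- exact: M2_small.
pose y2 z : {poly k} := (2%:R * z)^-1 *: (A *: 'X^6 + (2%:R * B)%:P).
apply: (step n2 n3 (A0 := A0) B0 Hom0 Ea Eb (z0 := z0) (X2 := cst c0) (Y2 := fun z => yline2 (- z))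
  (c := fun z => (2%:R * - z)^-1) (x2 := c0 *: 'X^4) (y2 := fun z => y2 (- z))) => //.
- by move=> z Ez; apply: yline2_sqr; rewrite sqrrN.
- move=> z Ez; have zn : z != 0 by apply: contraNneq B0 => E0; rewrite -Ez E0 expr0n.
  split; first by rewrite invr_eq0 mulf_neq0 // oppr_eq0.
  rewrite /yline2 rmorphM rmorphD rmorphM /= !iw_cst iw_u -Ez.
  have n2F : 2%:R != 0 :> F by rewrite -(rmorph_nat cst) cst_eq0.
  have zF : cst z != 0 by rewrite cst_eq0.
  rewrite !(fmorphV, rmorphM, rmorphN, rmorphXn, rmorph_nat) /=.
  exact: iw_alg.
- by rewrite it_cst -mul_polyC rmorphM rmorphXn /= pfX pfC mulrC.
- by rewrite /dle (leq_trans (size_scale_leq _ _)) // size_polyXn.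
- move=> z Ez; split.
    rewrite /yline2 /y2 rmorphM rmorphD rmorphM /= !it_cst it_u -!mul_polyC.
    by rewrite !(rmorphM pf, rmorphD pf, rmorphXn pf) /= pfX !pfC.
  rewrite /dle (leq_trans (size_scale_leq _ _)) //; apply: (dleD (a := 6) (b := 0)) => //.
    by rewrite /dle (leq_trans (size_scale_leq _ _)) // size_polyXn.
  by rewrite /dle size_polyC; case: (_ != _).
- exact: span0.
- by move=> R1; exact: spanN.
move=> R1 z Ez HR1; apply: (span_coords HP HR1) => //.
by rewrite !yline2_sqr // sqrrN.
Qed.

End LineTwo.

End Spans.

(** * Decomposition under t -> zeta t *)

Section Derivation.

Variable R : idomainType.
Local Notation F := {fraction {poly R}}.
Local Notation frac := (@FracField.tofrac {poly R}).

Definition fder : F -> F := locked_with frac_lift_key (fun x =>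
  let a := \n_(repr x) in let b := \d_(repr x) in
  frac (a^`() * b - a * b^`()) / frac (b ^+ 2)).

Lemma fder_div a b : b != 0 ->
  fder (frac a / frac b) = frac (a^`() * b - a * b^`()) / frac (b ^+ 2).
Proof.
move=> b0; rewrite /fder unlock /=; set x := frac a / frac b.
have d0 := denom_ratioP (repr x).
move: (frac_reprE x) d0; rewrite {1}/x; move: \n_(repr x) \d_(repr x) => c d E d0.
move/eqP: E; rewrite eqr_div ?tofrac_eq0 // -!rmorphM tofrac_eq => /eqP E.
apply/eqP; rewrite eqr_div ?tofrac_eq0 ?expf_neq0 // -!rmorphM tofrac_eq; apply/eqP.
have Ed : a^`() * d + a * d^`() = c^`() * b + c * b^`() by rewrite -!derivM E.
have -> : (a^`() * b - a * b^`()) * d ^+ 2 =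
   b * d * (a^`() * d + a * d^`()) - b * d ^`() * (a * d) - b^`() * d * (a * d) by ring.
rewrite Ed E; ring.
Qed.

Lemma fder_frac p : fder (frac p) = frac p^`().
Proof.
rewrite -[frac p]divr1 -(rmorph1 frac) fder_div ?oner_neq0 //.
by rewrite expr1n rmorph1 divr1 mulr1 derivC mulr0 subr0.
Qed.

Lemma fderD : {morph fder : x y / x + y}.
Proof.
move=> x y; have [a [b [b0 ->]]] := frac_ex x; have [c [d [d0 ->]]] := frac_ex y.
rewrite addf_div ?tofrac_eq0 // -!rmorphM -rmorphD !fder_div ?mulf_neq0 //.
rewrite addf_div ?tofrac_eq0 ?expf_neq0 // -!rmorphM -rmorphD.
apply/eqP; rewrite eqr_div ?tofrac_eq0 ?mulf_neq0 ?expf_neq0 ?mulf_neq0 //.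
rewrite -!rmorphM tofrac_eq !derivE; apply/eqP; ring.
Qed.

Lemma fderM x y : fder (x * y) = fder x * y + x * fder y.
Proof.
have [a [b [b0 ->]]] := frac_ex x; have [c [d [d0 ->]]] := frac_ex y.
rewrite mulf_div -!rmorphM !fder_div ?mulf_neq0 // !mulf_div -!rmorphM.
rewrite addf_div ?tofrac_eq0 ?mulf_neq0 ?expf_neq0 // -!rmorphM -rmorphD.
apply/eqP; rewrite eqr_div ?tofrac_eq0 ?mulf_neq0 ?expf_neq0 ?mulf_neq0 //.
rewrite -!rmorphM tofrac_eq !derivE; apply/eqP; ring.
Qed.

End Derivation.

Section FixedField.

Variable k : closedFieldType.
Local Notation F := (RF k).
Local Notation t := (@tv k).
Local Notation it := (@it k).

Definition der : F -> F := @fder k.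

Lemma derD : {morph der : x y / x + y}. Proof. exact: fderD. Qed.
Lemma derM x y : der (x * y) = der x * y + x * der y. Proof. exact: fderM. Qed.
Lemma der_pf p : der (pf p) = pf p^`(). Proof. exact: fder_frac. Qed.

Lemma der_cst c : der (cst c) = 0.
Proof. by rewrite -pfC der_pf derivC rmorph0. Qed.

Lemma der_t : der t = 1.
Proof. by rewrite -pfX der_pf derivX rmorph1. Qed.

Lemma der_sub (g : F) (gt : transc g) x : der (sub gt x) = der g * sub gt (der x).
Proof.
have H p : der (sub gt (pf p)) = der g * sub gt (der (pf p)).
  rewrite der_pf !sub_pf; elim/poly_ind: p => [|p c IH].
    by rewrite deriv0 !rmorph0 -(rmorph0 cst) der_cst mulr0.
  rewrite derivD derivM derivX derivC mulr1 addr0 !rmorphD !rmorphM /= derD derM IH.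
  by rewrite evpX evpC der_cst addr0 mulrDr mulrA [der g * evp g p]mulrC.
have [a [b [b0 Ex]]] := pf_ex x.
have bn : pf b != 0 by rewrite pf_eq0.
have Sb : sub gt (pf b) != 0 by rewrite fmorph_eq0.
have Ea : pf a = x * pf b by rewrite Ex divfK.
have := H a; rewrite Ea derM rmorphD !rmorphM /= derM H.
move/eqP; rewrite mulrDr [der g * (sub gt x * _)]mulrCA (inj_eq (addIr _)) mulrA.
by rewrite (inj_eq (mulIf Sb)) => /eqP.
Qed.

Lemma fixed_t6 (z : k) (zt : transc (cst z * t)) (f : F) :
  (forall i : nat, z ^+ i = 1 -> (6 %| i)%N) -> sub zt f = f ->
  exists g, f = it g.
Proof.
move=> Hz; have [a [b [b0 cab ->]]] := pf_coprime_ex f.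
have z0 : z != 0.
  by apply: contraNneq (zt 0) => ->; rewrite !rmorph0 mul0r.
have Ez p : sub zt (pf p) = pf (p \Po (z *: 'X)).
  by rewrite sub_pf -pfC -pfX -rmorphM mul_polyC evp_pf.
have sz : size (z *: 'X : {poly k}) = 2 by rewrite size_scale ?size_polyX.
pose s p := p \Po (z *: 'X : {poly k}).
have sn p : p != 0 -> s p != 0 by move=> p0; rewrite comp_poly2_eq0.
have coefs p i : (s p)`_i = z ^+ i * p`_i.
  rewrite /s comp_polyE coef_sum.
  have [ip|ip] := ltnP i (size p); last first.
    rewrite big1 ?nth_default ?mulr0 // => j _.
    rewrite exprZn coefZ coefZ coefXn.
    by case: eqP => [E|]; [move: (ltn_ord j); rewrite -E ltnNge ip | rewrite !mulr0].
  rewrite (bigD1 (Ordinal ip)) //= big1 => [|j nj].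
    by rewrite exprZn !coefZ coefXn eqxx mulr1 addr0 mulrC.
  rewrite exprZn !coefZ coefXn; case: eqP => [E|]; last by rewrite !mulr0.
  by case/eqP: nj; apply: val_inj; rewrite /= E.
rewrite fmorph_div /= !Ez => /eqP; rewrite eqr_div ?pf_eq0 ?sn //.
rewrite -!rmorphM pf_eq => /eqP E.
have db : b %| s b.
  have cba : coprimep b a by rewrite coprimep_sym.
  by rewrite -(Gauss_dvdpr _ cba) -E dvdp_mulIr.
have [c Eb] : exists c, s b = c *: b.
  have : b %= s b by rewrite -dvdp_size_eqp // size_comp_poly2.
  case/eqpP => -[c1 c2] /= /andP[c10 c20] Ec; exists (c2^-1 * c1).
  by rewrite -scalerA Ec scalerA mulVf // scale1r.
have Ea : s a = c *: a.
  by apply: (mulIf b0); rewrite E -/(s b) Eb -scalerAr -scalerAl.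
have c1 : c = 1.
  have [nb|nb] := eqVneq b`_0 0.
    have na : a`_0 != 0.
      have rb : root b 0 by rewrite /root horner_coef0 nb.
      by have := coprimep_root (_ : coprimep b a) rb; rewrite horner_coef0 coprimep_sym; apply.
    have := coefs a 0%N; rewrite Ea coefZ expr0; exact: (mulIf na).
  by have := coefs b 0%N; rewrite Eb coefZ expr0; exact: (mulIf nb).
have fx p : s p = p -> exists q, p = q \Po 'X^6.
  move=> Ep; exists (\poly_(i < size p) p`_(6 * i)).
  apply/polyP => i; rewrite coef_comp_poly_Xn //.
  case: ifPn => [/dvdnP [j ->]|ni].
    rewrite mulnK // coef_poly mulnC; case: ltnP => // le; rewrite nth_default //.
    by apply: leq_trans le _; rewrite leq_pmull.
  apply/eqP; have := coefs p i; rewrite Ep => /eqP.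
  rewrite -subr_eq0 -{1}[p`_i]mul1r -mulrBl mulf_eq0 subr_eq0 eq_sym.
  by case/orP => // /eqP /Hz; rewrite (negPf ni).
have [|p ->] := fx a; first by rewrite Ea c1 scale1r.
have [|q ->] := fx b; first by rewrite Eb c1 scale1r.
by exists (pf p / pf q); rewrite fmorph_div /= !it_pf.
Qed.

End FixedField.

Section Even.

Variable k : closedFieldType.
Hypothesis n2 : 2%:R != 0 :> k.
Hypothesis n3 : 3%:R != 0 :> k.
Variables (A B om0 : k).
Hypothesis A0 : A != 0.
Hypothesis B0 : B != 0.
Hypothesis Hom0 : om0 ^+ 2 + om0 + 1 = 0.
Local Notation F := (RF k).
Local Notation t := (@tv k).
Local Notation u := (@tv k).
Local Notation D := (pf (pD A B)).
Variable E : elliptic_curve F.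
Hypothesis Ea : ec_a E = 0.
Hypothesis Eb : ec_b E = D.
Local Notation w := (cst om0).
Local Notation om := (om Ea (Hw Hom0)).
Local Notation W := (cst A * u + cst B).
Local Notation inM := (@inM k E).
Local Notation it := (@it k).
Local Notation eis_span := (@eis_span k om0 Hom0 E Ea).

Lemma om0_neq0 : om0 != 0. Proof. by apply: (w_neq0 (K := k)). Qed.

Lemma transc_wt : transc (w * t).
Proof.
move=> c; apply: contra (transc_tv (om0^-1 * c)) => /eqP H.
by rewrite rmorphM fmorphV /= -H mulKf // cst_eq0 om0_neq0.
Qed.

Definition tau : F -> F := sub transc_wt.
HB.instance Definition _ := GRing.RMorphism.copy tau (sub transc_wt).

Lemma tau_t : tau t = w * t. Proof. exact: sub_tv. Qed.
Lemma tau_cst c : tau (cst c) = cst c. Proof. exact: sub_cst. Qed.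
Lemma w3 : w ^+ 3 = 1. Proof. exact: (w3E (Hw Hom0)). Qed.

Lemma tauK x : tau (tau (tau x)) = x.
Proof.
apply: (RF_morph_eq (f1 := tau \o tau \o tau) (f2 := idfun)) => [c|] /=.
  by rewrite !tau_cst.
rewrite !(tau_t, tau_cst, rmorphM) /= !(tau_t, tau_cst, rmorphM) /= !(tau_t, tau_cst).
by rewrite -[RHS]mul1r -w3; ring.
Qed.

Lemma tau_D : tau D = D.
Proof.
by rewrite pf_pD rmorphD rmorphM rmorphXn /= !tau_cst tau_t exprMn (exprM w 3 2) w3 expr1n mul1r.
Qed.

Lemma cw_D : cw D = D.
Proof. by rewrite pf_pD rmorphD rmorphM rmorphXn /= !cw_cst cw_w; congr (_ * _ + _); ring. Qed.

Section Galois.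
Variable f : {rmorphism F -> F}.
Hypothesis fD : f D = D.

Lemma gal_a : ec_a E = 1 ^+ 4 * f (ec_a E).
Proof. by rewrite Ea rmorph0 mulr0. Qed.
Lemma gal_b : ec_b E = 1 ^+ 6 * f (ec_b E).
Proof. by rewrite Eb fD expr1n mul1r. Qed.

Definition gal : ec_point E -> ec_point E := tw gal_a gal_b (oner_neq0 F).
HB.instance Definition _ := GRing.Additive.copy gal (tw gal_a gal_b (oner_neq0 F)).

Lemma galE P x y : ec_coords P = Some (x, y) -> ec_coords (gal P) = Some (f x, f y).
Proof. by move=> H; rewrite /= H /= !expr1n !mul1r. Qed.

Lemma gal_om P : f w = w -> gal (om P) = om (gal P).
Proof.
move=> fw; case H: (ec_coords P) => [[x y]|]; last by rewrite (coords0 H) !raddf0.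
apply: val_inj; rewrite [LHS](galE (omE _ _ H)) [RHS](omE _ _ (galE H)).
by rewrite rmorphM fw.
Qed.

End Galois.

Local Notation nu := (gal (f := @cw k) cw_D).
Local Notation ta := (gal (f := tau) tau_D).

Lemma ta_om P : ta (om P) = om (ta P). Proof. by apply: gal_om; exact: tau_cst. Qed.
Lemma nu_om P : nu (om P) = om (nu P). Proof. by apply: gal_om; exact: cw_cst. Qed.

Lemma taK P : ta (ta (ta P)) = P.
Proof.
case H: (ec_coords P) => [[x y]|]; last by rewrite (coords0 H) !raddf0.
by apply: val_inj; rewrite [LHS](galE _ (galE _ (galE _ H))) [RHS]H /= !tauK.
Qed.

Lemma cw_tau x : cw (tau x) = tau (cw x).
Proof.
apply: (RF_morph_eq (f1 := @cw k \o tau) (f2 := tau \o @cw k)) => [c|] /=.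
  by rewrite tau_cst cw_cst tau_cst.
by rewrite tau_t cw_w rmorphM rmorphN /= tau_t cw_w cw_cst mulrN.
Qed.

Lemma ta_nu P : ta (nu P) = nu (ta P).
Proof.
case H: (ec_coords P) => [[x y]|]; last by rewrite (coords0 H) !raddf0.
apply: val_inj; rewrite [LHS](galE _ (galE _ H)) [RHS](galE _ (galE _ H)).
by rewrite /= !cw_tau.
Qed.

Lemma sixth_root (i : nat) : (- om0 ^+ 2) ^+ i = 1 -> (6 %| i)%N.
Proof.
have H := w2E Hom0; have H3 := w3E Hom0.
have E2 : (- om0 ^+ 2) ^+ 2 = om0 by rewrite sqrrN -exprM (exprD om0 3 1) H3 mul1r.
have E6 : (- om0 ^+ 2) ^+ 6 = 1 by rewrite (exprM _ 2 3) E2.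
rewrite {1}(divn_eq i 6) exprD mulnC exprM E6 expr1n mul1r.
have : (i %% 6 < 6)%N by rewrite ltn_mod.
have o1 := w_neq1 Ea (Hw Hom0).
have {}o1 : om0 != 1 by apply: contraNneq o1 => ->; rewrite rmorph1.
have o0 := om0_neq0.
rewrite /dvdn; case: (i %% 6)%N => [|[|[|[|[|[|j]]]]]] // _ /eqP; rewrite -subr_eq0.
- by rewrite expr1 H (_ : - (- om0 - 1) - 1 = om0) ?(negPf o0) //; ring.
- by rewrite E2 subr_eq0 (negPf o1).
- rewrite exprS E2 mulNr -exprSr H3 -opprD oppr_eq0 => /eqP E0.
  by have := n2; rewrite -E0 eqxx.
- rewrite (exprM _ 2 2) E2 subr_eq0 => /eqP E0; have := H3.
  by rewrite exprS E0 mulr1 => /eqP; rewrite (negPf o1).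
rewrite (exprS _ 4) (exprM _ 2 2) E2 mulNr -exprD (exprD om0 3 1) H3 mul1r expr1.
rewrite subr_eq0 eqr_oppLR => /eqP E0; have := Hom0.
by rewrite E0 sqrrN expr1n subrr add0r => /eqP; rewrite oner_eq0.
Qed.

Lemma transc_zt : transc (cst (- om0 ^+ 2) * t).
Proof.
have z0 : - om0 ^+ 2 != 0 by rewrite oppr_eq0 expf_neq0 // om0_neq0.
move=> c; apply: contra (transc_tv ((- om0 ^+ 2)^-1 * c)) => /eqP H.
by rewrite rmorphM fmorphV /= -H mulKf // cst_eq0.
Qed.

(** Composing t -> - t with two copies of t -> w t gives t -> - w^2 t, and - w^2 is a primitive
    sixth root of unity. *)
Lemma fixed_it f : cw f = f -> tau f = f -> exists g, f = it g.
Proof.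
move=> Hc Ht; apply: (fixed_t6 (zt := transc_zt) sixth_root).
rewrite -[RHS]Hc -{2}Ht -{2}Ht.
apply: (RF_morph_eq (f1 := sub transc_zt) (f2 := @cw k \o (tau \o tau))) => [c|] /=.
  by rewrite sub_cst !tau_cst cw_cst.
rewrite sub_tv tau_t rmorphM /= tau_cst tau_t !rmorphM /= cw_w !cw_cst.
by rewrite rmorphN rmorphXn /=; ring.
Qed.

Lemma inM_crit m R x y : ec_coords R = Some (x, y) -> nu R = R ->
  cw x = x -> tau y = y -> tau x = w ^+ (2 * m) * x -> inM m R.
Proof.
move=> H Hn cx ty tx.
have cy : cw y = y.
  by have := congr1 (@ec_coords _ _) Hn; rewrite (galE _ H) H => -[_ ->].
have [Y EY] := fixed_it cy ty.
have [|| X EX] := @fixed_it (x / t ^+ (2 * m)).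
- rewrite fmorph_div rmorphXn /= cx cw_w exprM sqrrN -exprM //.
- rewrite fmorph_div rmorphXn /= tx tau_t exprMn -mulf_div divff ?mul1r //.
  by rewrite expf_neq0 // cst_eq0 om0_neq0.
right; exists X, Y; rewrite H -EX -EY; congr (Some (_, _)).
by rewrite mulrC divfK // t2m_neq0.
Qed.

(** The eigenvalue says that x is multiplied by w^(2m) under t -> w t, exactly like t^(2m); so x /
    t^(2m) and y are functions of t^6. *)
Lemma inM_eig m R : nu R = R -> ta R = iter (2 * m) om R -> inM m R.
Proof.
move=> Hn Ht; case H: (ec_coords R) => [[x y]|]; last by left; exact: coords0.
have Hi n : ec_coords (iter n om R) = Some (w ^+ n * x, y).
  elim: n => [|n IH]; first by rewrite /= expr0 mul1r.
  by rewrite iterS (omE _ _ IH) mulrA -exprS.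
have := congr1 (@ec_coords _ _) Ht; rewrite (galE _ H) Hi => -[tx ty].
have := congr1 (@ec_coords _ _) Hn; rewrite (galE _ H) H => -[cx _].
exact: (inM_crit H Hn cx ty tx).
Qed.

Local Notation omsum := (om_sum Ea (Hw Hom0) (E_x0 n2 n3 A0 B0 Ea Eb)).

Lemma om3 P : om (om (om P)) = P.
Proof. exact: (omK Ea (Hw Hom0) (E_x0 n2 n3 A0 B0 Ea Eb)). Qed.

Variables (P1 P2 : ec_point E).
Hypothesis HP1 : forall R, inM 1 R -> eis_span P1 R.
Hypothesis HP2 : forall R, inM 2 R -> eis_span P2 R.

(** [e0], [e1], [e2] are three times the projections to the eigenspaces of [ta], an operator of
    order 3 commuting with Z[w]. Their sum is 3 R by [om_sum], and [e0] vanishes by the case m =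
    0. *)
Lemma even_decomp R : nu R = R -> exists R1 R2, [/\ R *+ 3 = R1 + R2, eis_span P1 R1 & eis_span P2 R2].
Proof.
move=> Hn.
have nt : nu (ta R) = ta R by rewrite -ta_nu Hn.
have ntt : nu (ta (ta R)) = ta (ta R) by rewrite -ta_nu nt.
pose e0 := R + ta R + ta (ta R).
pose e1 := R + om (ta R) + om (om (ta (ta R))).
pose e2 := R + om (om (ta R)) + om (ta (ta R)).
have E0 : e0 = 0.
  apply: (M0_trivial n2 n3 A0 B0 Hom0 Ea Eb); apply: inM_eig.
    by rewrite /e0 !raddfD /= Hn nt ntt.
  by rewrite /e0 !raddfD /= taK addrC addrA.
exists e1, e2; split.
- have E12 : e1 + e2 = (R + R) + (om (ta R) + om (om (ta R))) +
                        (om (om (ta (ta R))) + om (ta (ta R))).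
    by rewrite /e1 /e2 addrACA (addrACA R).
  rewrite -[RHS]add0r -{1}E0 E12 /e0 addrACA [X in _ = X + _]addrACA.
  rewrite [ta R + _]addrA omsum [om (om (ta (ta R))) + _]addrC [ta (ta R) + _]addrA omsum !addr0.
  by rewrite -mulr2n -mulrS.
- apply: HP1; apply: inM_eig.
    by rewrite /e1 !raddfD /= !nu_om Hn nt ntt.
  rewrite /e1 /= !raddfD /= !ta_om taK !om3.
  by rewrite addrC addrA.
apply: HP2; apply: inM_eig.
  by rewrite /e2 !raddfD /= !nu_om Hn nt ntt.
by rewrite /e2 /= !raddfD /= !om3 !ta_om taK addrC addrA.
Qed.

End Even.

(** * Values of delta on the geometric points *)

Lemma delta_alg1 (K : fieldType) (a z t D : K) : 3%:R != 0 :> K -> z != 0 -> D != 0 ->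
  D = a ^+ 3 * t ^+ 6 + z ^+ 2 ->
  (3%:R * D * (- a * (2%:R * t)) - (- a * t ^+ 2) * (a ^+ 3 * (6%:R * t ^+ 5))) / (3%:R * D * z) =
  - (2%:R * a * z) * (t / D).
Proof.
move=> n3 z0 D0 ED; rewrite (_ : _ - _ = 3%:R * (- (2%:R * a * z ^+ 2) * t)).
  by field; rewrite n3 z0 D0.
by rewrite ED; ring.
Qed.

Lemma delta_alg2 (K : fieldType) (c a z t D : K) :
  3%:R != 0 :> K -> 2%:R != 0 :> K -> z != 0 -> D != 0 ->
  a * t ^+ 6 + 2%:R * z ^+ 2 != 0 -> D = a * t ^+ 6 + z ^+ 2 ->
  (3%:R * D * (c * (4%:R * t ^+ 3)) - (c * t ^+ 4) * (a * (6%:R * t ^+ 5))) /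
     (3%:R * D * ((2%:R * z)^-1 * (a * t ^+ 6 + 2%:R * z ^+ 2))) =
  4%:R * c * z * (t ^+ 3 / D).
Proof.
move=> n3 n2 z0 D0 y0 ED.
rewrite (_ : _ - _ = 6%:R * c * t ^+ 3 * (a * t ^+ 6 + 2%:R * z ^+ 2)).
  by field; rewrite n3 z0 D0 y0 n2.
by rewrite ED; ring.
Qed.

Section Full.

Variable k : closedFieldType.
Hypothesis char0 : forall n : int, n%:~R = 0 :> k -> n = 0.
Variable om0 : k.
Hypothesis Hom0 : om0 ^+ 2 + om0 + 1 = 0.
Local Notation F := (RF k).
Local Notation t := (@tv k).

Lemma char0_2 : 2%:R != 0 :> k.
Proof. by apply/eqP => /(char0 (n := 2)). Qed.
Lemma char0_3 : 3%:R != 0 :> k.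
Proof. by apply/eqP => /(char0 (n := 3)). Qed.
Local Notation n2 := char0_2.
Local Notation n3 := char0_3.

Definition eisenstein (m : k) := exists a b : int, m = a%:~R + b%:~R * om0.

(** The norm a^2 - a b + b^2 vanishes, and four times it is (2 a - b)^2 + 3 b^2. *)
Lemma eisenstein0 (a b : int) : a%:~R + b%:~R * om0 = 0 -> a = 0 /\ b = 0.
Proof.
move=> E; have : (a * a - a * b + b * b)%:~R = 0 :> k.
  have := congr1 (fun x => x * (a%:~R - b%:~R - b%:~R * om0)) E; rewrite mul0r => <-.
  rewrite !(rmorphD, rmorphB, rmorphM) /=.
  by ring: (w2E Hom0).
move/char0 => H.
have : (a + a - b) * (a + a - b) + (b * b) *+ 3 = 0.
  by rewrite -[RHS](mul0rn _ 4) -H; ring.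
nia.
Qed.

Section OneCurve.
Variables (A B : k).
Hypothesis A0 : A != 0.
Hypothesis B0 : B != 0.
Local Notation D := (pf (pD A B)).
Variable E : elliptic_curve F.
Hypothesis Ea : ec_a E = 0.
Hypothesis Eb : ec_b E = D.
Local Notation om := (om Ea (Hw Hom0)).
Local Notation dl := (delta (@der k) (E := E)).
Local Notation Ey0 := (E_y0 n2 n3 A0 B0 Ea Eb).

Lemma D_neq0 : D != 0. Proof. by rewrite pf_eq0 pD_neq0. Qed.

Lemma der_D : der D = cst A * (6%:R * t ^+ 5).
Proof.
rewrite pf_pD derD der_cst addr0 derM der_cst mul0r add0r -pfX -rmorphXn der_pf.
by rewrite derivXn rmorphMn rmorphXn /= pfX mulr_natl.
Qed.

Lemma der_tn (n : nat) : der (t ^+ n.+1) = n.+1%:R * t ^+ n.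
Proof. by rewrite -pfX -rmorphXn der_pf derivXn rmorphMn rmorphXn /= pfX mulr_natl. Qed.

Lemma dlD : {morph dl : P Q / P + Q}.
Proof. exact: (@deltaD F (@der k) E (@derD k) (@derM k) Ea Ey0). Qed.

Lemma dl0 : dl 0 = 0. Proof. by []. Qed.

Lemma dlN P : dl (- P) = - dl P.
Proof. by apply: (addIr (dl P)); rewrite -dlD !addNr dl0. Qed.

Lemma dlMn P n : dl (P *+ n) = dl P *+ n.
Proof. by elim: n => [|n IH]; rewrite ?mulr0n ?dl0 // !mulrS dlD IH. Qed.

Lemma dlMz P (z : int) : dl (P *~ z) = dl P *~ z.
Proof. by case: z => n; rewrite ?NegzE ?mulrNz ?dlN dlMn. Qed.

Lemma dl_om P : dl (om P) = cst om0 * dl P.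
Proof.
have Hc (x : F) : der (idfun x) = 1 * idfun (der x) by rewrite mul1r.
have s0 := om_s0 (Hw Hom0).
rewrite [LHS](@delta_tw F F idfun _ E E s0 (om_a _ Ea) (om_b E (Hw Hom0)) (@der k) (@der k) 1 (@derD k) (@derM k) Hc Ea Ey0).
rewrite /= div1r; congr (_ * _); apply: (mulfI s0).
by rewrite divff // -exprSr (w3E (Hw Hom0)).
Qed.

Lemma eis_delta P R : eis_span Hom0 Ea P R ->
  exists m, [/\ eisenstein m, dl R = cst m * dl P & m = 0 -> R = 0].
Proof.
case=> a [b ->]; exists (a%:~R + b%:~R * om0); split; first by exists a, b.
  rewrite dlD !dlMz dl_om rmorphD rmorphM /= !rmorph_int mulrDl.
  by rewrite -mulrA !mulrzl.
by case/eisenstein0 => -> ->; rewrite !mulr0z addr0.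
Qed.

Local Notation nu := (gal Ea Eb (f := @cw k) (cw_D A B)).

Section Generators.
Variables a1 z0 c0 : k.
Hypothesis Ea1 : a1 ^+ 3 = A.
Hypothesis Ez0 : z0 ^+ 2 = B.
Hypothesis Ec0 : c0 ^+ 3 = A ^+ 2 / (4%:R * B).

Lemma z0_neq0 : z0 != 0.
Proof. by apply: contraNneq B0 => E0; rewrite -Ez0 E0 expr0n. Qed.

Lemma gen1_eq : cst z0 ^+ 2 = t ^+ 1 * cst (- a1) ^+ 3 + (cst A * t + cst B).
Proof.
rewrite -!(rmorphXn cst) /= exprNn Ea1 Ez0 -signr_odd !expr1 mulN1r rmorphN mulrN.
by rewrite addrA [_ * t]mulrC addNr add0r.
Qed.

Definition gen1 : ec_point E := mkM Ea Eb gen1_eq.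

Lemma gen2_eq : yline2 A B z0 ^+ 2 = t ^+ 2 * cst c0 ^+ 3 + (cst A * t + cst B).
Proof. exact: (yline2_sqr n2 B0 Ec0 Ez0). Qed.

Definition gen2 : ec_point E := mkM Ea Eb gen2_eq.

Lemma dl_coords (P : ec_point E) c n y : ec_coords P = Some (cst c * t ^+ n.+1, y) ->
  dl P = (3%:R * D * (cst c * (n.+1%:R * t ^+ n)) - (cst c * t ^+ n.+1) * (cst A * (6%:R * t ^+ 5)))
         / (3%:R * D * y).
Proof. by rewrite /delta => -> /=; rewrite Eb der_D derM der_cst mul0r add0r der_tn. Qed.

Lemma dl_gen1 : dl gen1 = cst (- (2%:R * a1 * z0)) * (t / D).
Proof.
rewrite (@dl_coords gen1 (- a1) 1 (cst z0)); last by rewrite /= !it_cst mulrC.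
have n3F : 3%:R != 0 :> F by rewrite -(rmorph_nat cst) cst_eq0 n3.
have zF : cst z0 != 0 by rewrite cst_eq0 z0_neq0.
have ED : D = cst a1 ^+ 3 * t ^+ 6 + cst z0 ^+ 2.
  by rewrite pf_pD -!(rmorphXn cst) /= Ea1 Ez0.
rewrite !(rmorphN, rmorphM, rmorph_nat) /= -(delta_alg1 n3F zF D_neq0 ED).
by rewrite -(rmorphXn cst) /= Ea1.
Qed.

Lemma dl_gen2 : dl gen2 = cst (4%:R * c0 * z0) * (t ^+ 3 / D).
Proof.
rewrite (@dl_coords gen2 c0 3 ((2%:R * cst z0)^-1 * (cst A * t ^+ 6 + 2%:R * cst z0 ^+ 2))); last first.
  rewrite /= it_cst mulrC /yline2 -Ez0 rmorphM rmorphD rmorphM /= !it_cst it_u.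
  by rewrite !(fmorphV, rmorphM, rmorphXn, rmorph_nat).
have n3F : 3%:R != 0 :> F by rewrite -(rmorph_nat cst) cst_eq0 n3.
have n2F : 2%:R != 0 :> F by rewrite -(rmorph_nat cst) cst_eq0 n2.
have zF : cst z0 != 0 by rewrite cst_eq0 z0_neq0.
have ED : D = cst A * t ^+ 6 + cst z0 ^+ 2.
  by rewrite pf_pD -!(rmorphXn cst) /= Ez0.
have y0 : cst A * t ^+ 6 + 2%:R * cst z0 ^+ 2 != 0.
  have -> : cst A * t ^+ 6 + 2%:R * cst z0 ^+ 2 = pf (pD A (2%:R * B)).
    by rewrite pf_pD rmorphM rmorph_nat -Ez0 rmorphXn.
  by rewrite pf_eq0 pD_neq0.
by rewrite !(rmorphM, rmorph_nat) /= -(delta_alg2 (cst c0) n3F n2F zF D_neq0 y0 ED).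
Qed.

Lemma even_delta R : nu R = R -> exists m1 m2, [/\ eisenstein m1, eisenstein m2,
  dl R *+ 3 = cst (m1 * - (2%:R * a1 * z0)) * (t / D) + cst (m2 * (4%:R * c0 * z0)) * (t ^+ 3 / D) &
  m1 = 0 -> m2 = 0 -> R *+ 3 = 0].
Proof.
move=> Hn; have HP1 := M1_span n2 n3 A0 B0 Hom0 Ea Eb Ea1 Ez0 (P := gen1) erefl.
have HP2 := M2_span n2 n3 A0 B0 Hom0 Ea Eb Ez0 Ec0 (P := gen2) erefl.
have [R1 [R2 [ER S1 S2]]] := even_decomp n2 n3 A0 B0 HP1 HP2 Hn.
have [m1 [e1 E1 Z1]] := eis_delta S1; have [m2 [e2 E2 Z2]] := eis_delta S2.
exists m1, m2; split=> //; last by move=> /Z1 R10 /Z2 R20; rewrite ER R10 R20 addr0.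
by rewrite -dlMn ER dlD E1 E2 dl_gen1 dl_gen2 !rmorphM !mulrA.
Qed.

End Generators.

End OneCurve.

End Full.

Lemma mirror_alg (K : fieldType) (a b t D : K) : t != 0 -> D != 0 ->
  - (t^-1) ^+ 3 * (a * (t^-1 / (D / t ^+ 6)) + b * ((t^-1) ^+ 3 / (D / t ^+ 6))) =
  - (a * (t ^+ 2 / D)) - b * (t ^+ 0 / D).
Proof. by move=> t0 D0; field; rewrite t0 D0. Qed.

Lemma mirror_unit (K : fieldType) (t : K) : t != 0 -> - t^-1 ^+ 3 * (- t ^+ 2 * t) = 1.
Proof. by move=> t0; field. Qed.

Lemma full_alg (K : fieldType) (m0 m1 m2 m3 x0 x1 x2 x3 q0 q1 q2 q3 : K) :
  m1 * (- x1) * q1 + m3 * x3 * q3 + (- (m2 * (- x2) * q2) - m0 * x0 * q0) =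
  - m0 * x0 * q0 + - m1 * x1 * q1 + m2 * x2 * q2 + m3 * x3 * q3.
Proof. by ring. Qed.

Section Full.

Variable k : closedFieldType.
Hypothesis char0 : forall n : int, n%:~R = 0 :> k -> n = 0.
Variable om0 : k.
Hypothesis Hom0 : om0 ^+ 2 + om0 + 1 = 0.
Local Notation F := (RF k).
Local Notation t := (@tv k).
Local Notation n2 := (char0_2 char0).
Local Notation n3 := (char0_3 char0).
Local Notation eisenstein := (@eisenstein k om0).

Definition recip : F -> F := sub (transcV (@transc_tv k)).
HB.instance Definition _ := GRing.RMorphism.copy recip (sub (transcV (@transc_tv k))).

Lemma recip_t : recip t = t^-1. Proof. exact: sub_tv. Qed.
Lemma recip_cst c : recip (cst c) = cst c. Proof. exact: sub_cst. Qed.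

Lemma recipK x : recip (recip x) = x.
Proof.
apply: (RF_morph_eq (f1 := recip \o recip) (f2 := idfun)) => [c|] /=.
  by rewrite !recip_cst.
by rewrite recip_t fmorphV /= recip_t invrK.
Qed.

Lemma cw_recip x : cw (recip x) = recip (cw x).
Proof.
apply: (RF_morph_eq (f1 := @cw k \o recip) (f2 := recip \o @cw k)) => [c|] /=.
  by rewrite recip_cst cw_cst recip_cst.
by rewrite recip_t cw_w fmorphV rmorphN /= recip_t cw_w invrN.
Qed.

Lemma der_tV : der t^-1 = - (t^-1) ^+ 2.
Proof.
have t0 := tv0 k; apply: (mulfI t0); apply: (addrI (t^-1)).
rewrite -{1}[t^-1]mul1r -{1}(der_t k) -derM divff // -(rmorph1 cst) der_cst.
by rewrite expr2 mulrN mulrA divff // mul1r subrr.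
Qed.

Lemma der_recip x : der (recip x) = - (t^-1) ^+ 2 * recip (der x).
Proof. by rewrite /recip der_sub der_tV. Qed.

Lemma recip_D A B : t ^+ 6 * recip (pf (pD A B)) = pf (pD B A).
Proof.
have t0 := tv0 k; rewrite !pf_pD rmorphD rmorphM rmorphXn /= !recip_cst recip_t.
by rewrite mulrDr exprVn mulrCA divff ?expf_neq0 // mulr1 addrC [_ * cst B]mulrC.
Qed.

Variables (A B : k).
Hypothesis A0 : A != 0.
Hypothesis B0 : B != 0.
Local Notation D := (pf (pD A B)).
Variables E E' : elliptic_curve F.
Hypothesis Ea : ec_a E = 0.
Hypothesis Eb : ec_b E = D.
Hypothesis Ea' : ec_a E' = 0.
Hypothesis Eb' : ec_b E' = pf (pD B A).
Local Notation dl := (delta (@der k) (E := E)).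
Local Notation dl' := (delta (@der k) (E := E')).
Local Notation nu := (gal Ea Eb (f := @cw k) (cw_D A B)).
Local Notation nu' := (gal Ea' Eb' (f := @cw k) (cw_D B A)).

Lemma mir_a : ec_a E' = t ^+ 4 * recip (ec_a E).
Proof. by rewrite Ea Ea' rmorph0 mulr0. Qed.
Lemma mir_b : ec_b E' = t ^+ 6 * recip (ec_b E).
Proof. by rewrite Eb Eb' recip_D. Qed.

Definition mir : ec_point E -> ec_point E' := tw mir_a mir_b (tv0 k).
HB.instance Definition _ := GRing.Additive.copy mir (tw mir_a mir_b (tv0 k)).

Lemma mir_eq0 P : mir P = 0 -> P = 0.
Proof.
move=> H; apply: coords0; move: (congr1 (@ec_coords _ _) H) => /=.
by case: (ec_coords P) => [[x y]|].
Qed.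

Lemma mirE P x y : ec_coords P = Some (x, y) ->
  ec_coords (mir P) = Some (t ^+ 2 * recip x, t ^+ 3 * recip y).
Proof. by move=> H; rewrite /= H. Qed.

(** The sign comes from the factor t^3 on the ordinate. Consequently [mir] carries odd points of one
    curve to even points of the other. *)
Lemma nu_mir P : nu' (mir P) = - mir (nu P).
Proof.
case H: (ec_coords P) => [[x y]|]; last by rewrite (coords0 H) !raddf0.
have Hm := mirE H.
have Hn := galE Ea Eb (cw_D A B) H.
have Hmn := mirE Hn.
apply: val_inj; rewrite [LHS](galE Ea' Eb' (cw_D B A) Hm) [RHS](oppE Hmn) /=.
rewrite !(rmorphXn, rmorphM) /= cw_w !cw_recip sqrrN exprNn -signr_odd expr1.
by rewrite !mulNr mul1r.
Qed.

Lemma nuK P : nu (nu P) = P.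
Proof.
case H: (ec_coords P) => [[x y]|]; last by rewrite (coords0 H) !raddf0.
have cwK z : cw (cw z) = z :> F.
  apply: (RF_morph_eq (f1 := @cw k \o @cw k) (f2 := idfun)) => [c|] /=.
    by rewrite !cw_cst.
  by rewrite cw_w rmorphN /= cw_w opprK.
by apply: val_inj; rewrite [LHS](galE _ _ _ (galE _ _ _ H)) [RHS]H /= !cwK.
Qed.

(** The chain rule for 1/t contributes - t^-2 and the twist by t another t^-1. Thus t^i / D'
    corresponds to - t^(3-i) / D, where D' = B t^6 + A, and the exponents 1 and 3 of the even part
    yield 2 and 0. *)
Lemma dl_mir P : dl P = - (t^-1) ^+ 3 * recip (dl' (mir P)).
Proof.
have y0 := E_y0 n2 n3 B0 A0 Ea' Eb'.
have -> : dl' (mir P) = - (t^-1) ^+ 2 / t * recip (dl P).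
  exact: (@delta_tw F F recip t E E' (tv0 k) mir_a mir_b (@der k) (@der k) (- (t^-1) ^+ 2)
         (@derD k) (@derM k) der_recip Ea y0 P).
rewrite rmorphM /= recipK fmorph_div rmorphN rmorphXn fmorphV /= recip_t invrK.
by rewrite mulrA (mirror_unit (tv0 k)) mul1r.
Qed.

Section Values.
Variables (a1 z0 c0 b1 y0 d0 : k).
Hypothesis Ea1 : a1 ^+ 3 = A.
Hypothesis Ez0 : z0 ^+ 2 = B.
Hypothesis Ec0 : c0 ^+ 3 = A ^+ 2 / (4%:R * B).
Hypothesis Eb1 : b1 ^+ 3 = B.
Hypothesis Ey0 : y0 ^+ 2 = A.
Hypothesis Ed0 : d0 ^+ 3 = B ^+ 2 / (4%:R * A).

(** 2 P = (P + nu P) + (P - nu P): [even_delta] is applied to the first summand on E, and to the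
    mirror of the second on E'. *)
Lemma full_delta P : exists m0 m1 m2 m3,
  [/\ [/\ eisenstein m0, eisenstein m1, eisenstein m2 & eisenstein m3],
   dl P *+ 6 = cst (m0 * (4%:R * d0 * y0)) * (t ^+ 0 / D) + cst (m1 * (2%:R * a1 * z0)) * (t ^+ 1 / D)
             + cst (m2 * (2%:R * b1 * y0)) * (t ^+ 2 / D) + cst (m3 * (4%:R * c0 * z0)) * (t ^+ 3 / D) &
   m0 = 0 -> m1 = 0 -> m2 = 0 -> m3 = 0 -> P *+ 6 = 0].
Proof.
pose Pp := P + nu P; pose Pm := P - nu P.
have EP : P *+ 2 = Pp + Pm by rewrite /Pp /Pm addrACA subrr addr0.
have np : nu Pp = Pp by rewrite /Pp raddfD /= nuK addrC.
have nm : nu' (mir Pm) = mir Pm.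
  by rewrite nu_mir -raddfN /= /Pm raddfB /= nuK opprB.
have [m1 [m3 [e1 e3 H1 Z1]]] := even_delta char0 Hom0 A0 B0 Ea1 Ez0 Ec0 np.
have [m2 [m0 [e2 e0 H2 Z2]]] := even_delta char0 Hom0 B0 A0 Eb1 Ey0 Ed0 nm.
have eN m : eisenstein m -> eisenstein (- m).
  by case=> a [b ->]; exists (- a), (- b); rewrite !rmorphN /= mulNr opprD.
exists (- m0), (- m1), m2, m3; split; first by split; [exact: eN | exact: eN | |].
  have -> : dl P *+ 6 = dl Pp *+ 3 + dl Pm *+ 3.
    rewrite -(dlMn char0 A0 B0 Ea Eb) (mulrnA P 2 3) EP mulrnDl (dlD char0 A0 B0 Ea Eb).
    by rewrite !(dlMn char0 A0 B0 Ea Eb).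
  have Einv : recip (pf (pD B A)) = D / t ^+ 6.
    by rewrite -(recip_D B A) mulrAC divff ?mul1r //; exact: expf_neq0 (tv0 k).
  rewrite H1 (dl_mir Pm) -mulrnAr -(rmorphMn recip) /= H2 rmorphD !(rmorphXn, rmorphM) !fmorphV /= ?rmorphXn /=.
  rewrite !recip_cst recip_t Einv (mirror_alg _ _ (tv0 k) (D_neq0 B A0)).
  by rewrite !(rmorphN, rmorphM) /= expr1 full_alg.
move=> /eqP + /eqP + m20 m30; rewrite !oppr_eq0 => /eqP m00 /eqP m10.
rewrite (mulrnA P 2 3) EP mulrnDl Z1 // add0r; apply: mir_eq0.
by rewrite raddfMn Z2.
Qed.

End Values.

End Full.

(** * From C(t) to Q(t) *)

Local Notation F := (RF algC).
Local Notation t := (@tv algC).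

Definition pinc : {poly rat} -> F := fun p => pf (map_poly ratr p).
HB.instance Definition _ := GRing.RMorphism.copy pinc (@pf algC \o map_poly ratr).

Lemma pinc_neq0 p : p != 0 -> pinc p != 0.
Proof. by move=> p0; rewrite pf_eq0 map_poly_eq0. Qed.

Definition inc : Qt -> F := frac_lift pinc_neq0.
Arguments inc : simpl never.
HB.instance Definition _ := GRing.isZmodMorphism.Build Qt F inc (frac_lift_is_zmod pinc_neq0).
HB.instance Definition _ := GRing.isMonoidMorphism.Build Qt F inc (frac_lift_is_monoid pinc_neq0).

Local Notation qf := (@FracField.tofrac {poly rat} : {poly rat} -> Qt).

Lemma inc_qf p : inc (qf p) = pf (map_poly ratr p).
Proof. exact: frac_lift_frac. Qed.

Lemma inc_t : inc Qt_var = t.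
Proof. by rewrite inc_qf map_polyX. Qed.

Lemma inc_int (n : int) : inc n%:~R = cst n%:~R.
Proof. by rewrite !rmorph_int. Qed.

Lemma inc_D (A B : int) :
  inc (A%:~R * Qt_var ^+ 6 + B%:~R) = pf (pD (A%:~R : algC) B%:~R).
Proof. by rewrite pf_pD rmorphD rmorphM rmorphXn /= inc_t !inc_int. Qed.

Lemma der_inc x : der (inc x) = 1 * inc (fder x).
Proof.
rewrite mul1r; have H (p : {poly rat}) : der (inc (qf p)) = inc (fder (qf p)).
  by rewrite inc_qf der_pf fder_frac inc_qf deriv_map.
have [a [b [b0 Ex]]] := frac_ex x.
have Sb : inc (qf b) != 0 by rewrite fmorph_eq0 tofrac_eq0.
have Ea : qf a = x * qf b by rewrite Ex divfK // tofrac_eq0.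
have := H a; rewrite Ea fderM rmorphM rmorphD !rmorphM /= derM H.
by move/addIr/(mulIf Sb).
Qed.

Lemma RF_disc (A B : algC) : A != 0 ->
  - 16%:R * (4%:R * 0 ^+ 3 + 27%:R * pf (pD A B) ^+ 2) != 0 :> F.
Proof.
move=> A0; rewrite expr0n mulr0 add0r !mulf_neq0 ?expf_neq0 ?oppr_eq0 ?pf_eq0 ?pD_neq0 //.
  by rewrite -(rmorph_nat cst) cst_eq0 pnatr_eq0.
by rewrite -(rmorph_nat cst) cst_eq0 pnatr_eq0.
Qed.

Definition EC (A B : algC) (A0 : A != 0) : elliptic_curve F := EllipticCurve (RF_disc B A0).

Lemma on_short (K : fieldType) (E : elliptic_curve K) x y : ec_a E = 0 ->
  y ^+ 2 = x ^+ 3 + ec_b E -> on_curve E (Some (x, y)).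
Proof. by move=> Ea /= ->; rewrite Ea mul0r addr0. Qed.

Section Embedding.

Variables A B : int.
Hypothesis hA : A != 0.
Hypothesis hB : B != 0.
Local Notation Ac := (A%:~R : algC).
Local Notation Bc := (B%:~R : algC).
Fact hAc : Ac != 0. Proof. by rewrite intr_eq0. Qed.
Fact hBc : Bc != 0. Proof. by rewrite intr_eq0. Qed.
Local Notation G := (ec_point (E_AB B hA)).
Local Notation E := (EC Bc hAc).
Local Notation D := (pf (pD Ac Bc)).
Local Notation dl := (delta (@der algC) (E := E)).

Lemma algC_char0 (n : int) : n%:~R = 0 :> algC -> n = 0.
Proof. by move/eqP; rewrite intr_eq0 => /eqP. Qed.

Lemma incP_a : ec_a E = 1 ^+ 4 * inc (ec_a (E_AB B hA)).
Proof. by rewrite /= rmorph0 mulr0. Qed.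
Lemma incP_b : ec_b E = 1 ^+ 6 * inc (ec_b (E_AB B hA)).
Proof. by rewrite /= inc_D expr1n mul1r. Qed.

Definition incP : G -> ec_point E := tw incP_a incP_b (oner_neq0 F).
HB.instance Definition _ := GRing.Additive.copy incP (tw incP_a incP_b (oner_neq0 F)).

Lemma incP_eq0 P : incP P = 0 -> P = 0.
Proof.
move=> H; apply: val_inj; move: (congr1 (@ec_coords _ _) H) => /=.
by case: (ec_coords P) => [[x y]|].
Qed.

Lemma incP_image (Q : ec_point E) x y : ec_coords Q = Some (inc x, inc y) ->
  exists P, incP P = Q.
Proof.
move=> HQ; have Hxy := @on_eq F E erefl _ _ (on_coords HQ).
have oP : on_curve (E_AB B hA) (Some (x, y)).
  apply: on_short; first by [].
  by apply: (fmorph_inj inc); rewrite rmorphXn rmorphD rmorphXn /= inc_D Hxy.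
exists (EcPoint oP); apply: val_inj; rewrite [RHS]HQ /=.
by rewrite !expr1n !mul1r.
Qed.

Lemma dl_incP P : dl (incP P) = inc (delta (@fder rat) P).
Proof.
have n2 := char0_2 algC_char0; have n3 := char0_3 algC_char0.
have y0 := E_y0 n2 n3 hAc hBc (E := E) erefl erefl.
have := @delta_tw Qt F inc 1 (E_AB B hA) E (oner_neq0 F) incP_a incP_b (@fder rat) (@der algC) 1
         (@derD algC) (@derM algC) der_inc erefl y0 P.
by rewrite divr1 mul1r.
Qed.

(** Divisibility of polynomials with rational coefficients does not change under extension of the
    field. *)
Lemma inc_poly (z : Qt) (g : {poly algC}) : inc z = pf g ->
  exists h : {poly rat}, z = qf h /\ map_poly ratr h = g.
Proof.
have [a [b [b0 ->]]] := frac_ex z; rewrite fmorph_div /= !inc_qf.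
have bn : pf (map_poly (@ratr algC) b) != 0 by rewrite pf_eq0 map_poly_eq0.
move/(canRL (divfK bn)); rewrite -rmorphM => /pf_inj E.
have : map_poly (@ratr algC) b %| map_poly ratr a by rewrite E dvdp_mulIr.
rewrite dvdp_map => /dvdpP [h Eh]; exists h; split.
  by rewrite Eh rmorphM mulfK // tofrac_eq0.
have bn' : map_poly (@ratr algC) b != 0 by rewrite map_poly_eq0.
by apply: (mulIf bn'); rewrite -E Eh rmorphM.
Qed.

End Embedding.

(** * Cubes, squares and sixth powers in Q(sqrt (-3)) *)

Definition is_cube (x : rat) := exists p, x = p ^+ 3.
(* The rationals which are squares in Q(sqrt (-3)). *)
Definition is_sq3 (x : rat) := exists p, x = p ^+ 2 \/ x = - 3%:R * p ^+ 2.

Section QuadraticField.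
Variables (L : numFieldType) (r : L).
Hypothesis Hr : r ^+ 2 = - 3%:R.

Definition inK (z : L) := exists p q : rat, z = ratr p + ratr q * r.

Lemma inK_rat p : inK (ratr p).
Proof. by exists p, 0; rewrite rmorph0 mul0r addr0. Qed.

Lemma inKM x y : inK x -> inK y -> inK (x * y).
Proof.
case=> [p [q ->]] [p' [q' ->]]; exists (p * p' - 3%:R * (q * q')), (p * q' + q * p').
by rewrite !(rmorphB, rmorphD, rmorphM, rmorph_nat) /=; ring: Hr.
Qed.

Lemma norm0 (p q : rat) : p ^+ 2 + 3%:R * q ^+ 2 = 0 -> p = 0 /\ q = 0.
Proof.
move=> H; have p2 : 0 <= p ^+ 2 by exact: sqr_ge0.
have q2 : 0 <= 3%:R * q ^+ 2 by rewrite mulr_ge0 ?sqr_ge0.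
move/eqP: H; rewrite (paddr_eq0 p2 q2) expf_eq0 mulf_eq0 expf_eq0 /=.
by case/andP => /eqP -> /eqP ->.
Qed.

Lemma inK_eq0 (p q : rat) : ratr p + ratr q * r = 0 -> p = 0 /\ q = 0.
Proof.
move=> H; apply: norm0; apply: (fmorph_inj (ratr : rat -> L)).
rewrite !(rmorphD, rmorphXn, rmorphM, rmorph_nat, rmorph0) /=.
have := congr1 (fun x => x * (ratr p - ratr q * r)) H; rewrite mul0r => <-.
by ring: Hr.
Qed.

Lemma inKV x : inK x -> inK x^-1.
Proof.
case=> [p [q Ex]]; have [->|x0] := eqVneq x 0; first by rewrite invr0 -(rmorph0 ratr); exact: inK_rat.
pose n := p ^+ 2 + 3%:R * q ^+ 2.
have n0 : n != 0.
  apply: contraNneq x0 => /norm0 [p0 q0].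
  by rewrite Ex p0 q0 rmorph0 mul0r addr0.
have n0' : ratr n != 0 :> L by rewrite fmorph_eq0.
exists (p / n), (- q / n); apply: (mulfI x0); rewrite divff // Ex.
have En : ratr n = (ratr p + ratr q * r) * (ratr p - ratr q * r) :> L.
  by rewrite /n !(rmorphD, rmorphXn, rmorphM, rmorph_nat) /=; ring: Hr.
apply: (mulfI n0'); rewrite mulr1 !(fmorph_div, rmorphN) /= {1}En.
by field.
Qed.

(** The irrational part 3 q (p^2 - q^2) of the cube of p + q r must vanish. If q = p or q = - p the
    cube is that of - 2 p, because 1 + r and 1 - r have cube - 8. *)
Lemma inK_cube z x : inK z -> z ^+ 3 = ratr x -> is_cube x.
Proof.
case=> [p [q ->]] H.
have [] := @inK_eq0 (p ^+ 3 - 9%:R * (p * q ^+ 2) - x) (3%:R * (q * (p ^+ 2 - q ^+ 2))).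
  rewrite !(rmorphB, rmorphD, rmorphXn, rmorphM, rmorph_nat) /= -H.
  by ring: Hr.
move/eqP; rewrite subr_eq0 => /eqP <- /eqP.
rewrite mulf_eq0 /= mulf_eq0 subr_eq0 eqf_sqr => /or3P [/eqP q0|/eqP pq|/eqP pq].
- by exists p; rewrite q0; ring.
- by exists (- 2%:R * p); rewrite pq; ring.
by exists (- 2%:R * p); rewrite pq; ring.
Qed.

Lemma inK_sqr z x : inK z -> z ^+ 2 = ratr x -> is_sq3 x.
Proof.
case=> [p [q ->]] H.
have [] := @inK_eq0 (p ^+ 2 - 3%:R * q ^+ 2 - x) (2%:R * (p * q)).
  by rewrite !(rmorphB, rmorphD, rmorphXn, rmorphM, rmorph_nat) /= -H; ring: Hr.
move/eqP; rewrite subr_eq0 => /eqP <- /eqP.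
rewrite mulf_eq0 /= mulf_eq0 => /orP [/eqP p0|/eqP q0].
  by exists q; right; rewrite p0; ring.
by exists p; left; rewrite q0; ring.
Qed.

(** The exponents 3 and 2 are coprime, so the product determines its factors: (x z)^3 = X Z z puts z
    in the field, and then x. *)
Lemma inK_cube_sqr (n : nat) x z (X Z : rat) : (0 < n)%N -> X != 0 -> Z != 0 ->
  x ^+ 3 = ratr X -> z ^+ 2 = ratr Z -> inK (n%:R * x * z) -> is_cube X /\ is_sq3 Z.
Proof.
move=> n0 X0 Z0 EX EZ HK.
have nn : n%:R != 0 :> L by rewrite pnatr_eq0 -lt0n.
have XZ : ratr (X * Z) != 0 :> L by rewrite fmorph_eq0 mulf_neq0.
have z0 : z != 0.
  have : ratr Z != 0 :> L by rewrite fmorph_eq0.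
  by rewrite -EZ; apply: contraNneq => ->; rewrite expr0n.
have Kn : inK (n%:R^-1) by apply: inKV; rewrite -(rmorph_nat ratr); exact: inK_rat.
have Kxz : inK (x * z) by rewrite -[x * z](mulKf nn) [_ * (x * z)]mulrA; exact: inKM Kn HK.
have Kz : inK z.
  rewrite (_ : z = (x * z) * ((x * z) * (x * z)) * (ratr (X * Z))^-1).
    exact: inKM (inKM Kxz (inKM Kxz Kxz)) (inKV (inK_rat _)).
  apply: (mulIf XZ); rewrite mulfVK // rmorphM /= -EX -EZ; ring.
split; last exact: inK_sqr Kz EZ.
apply: inK_cube EX; rewrite -[x](mulfK z0).
by apply: inKM => //; exact: inKV.
Qed.

End QuadraticField.

Fact dvd432 (d : nat) : (d ^ 6 %| 432)%N -> d = 1%N.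
Proof.
move=> H; have : (d < 3)%N.
  rewrite ltnNge; apply/negP => d3; have := @dvdn_leq (d ^ 6) 432 isT H.
  by rewrite leqNgt => /negP; apply; apply: leq_trans (_ : 3 ^ 6 <= _)%N; rewrite ?leq_exp2r.
by case: d H => [|[|[|]]].
Qed.

Fact clear_denom (c x : int) (b : rat) k : c%:~R * b ^+ k = x%:~R ->
  c * numq b ^+ k = x * denq b ^+ k.
Proof.
move=> H; apply: (@intr_inj rat).
by rewrite !(rmorphXn, rmorphM) /= -H numqE exprMn mulrA.
Qed.

(** 432 = 2^4 3^3 has no sixth power factor, so the denominator of b is 1. It is a common multiple
    of the constants 1, 16, - 27 and - 432 of the cases. *)
Lemma int_root (b : rat) (x : int) : 432%:~R * b ^+ 6 = x%:~R -> exists c : int, b = c%:~R.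
Proof.
move=> H; exists (numq b); have Ed : denq b = 1; last by rewrite -[LHS]divq_num_den Ed divr1.
have {}H := clear_denom H.
have : (denq b ^+ 6 %| 432 * numq b ^+ 6)%Z by rewrite H dvdz_mull.
rewrite Gauss_dvdzl; last first.
  rewrite coprimezE !abszX coprimeXl ?coprimeXr // coprime_sym; exact: coprime_num_den.
rewrite dvdzE abszX => /dvd432 E.
by have := denq_gt0 b; lia.
Qed.

Lemma four_not_cube : ~ is_cube 4%:R.
Proof.
move=> [y H].
have {}H : 4 * denq y ^+ 3 = numq y ^+ 3.
  by rewrite -[RHS]mul1r; apply/esym/clear_denom; rewrite mul1r -H.
have : (denq y ^+ 3 %| numq y ^+ 3)%Z by rewrite -H dvdz_mull.
rewrite dvdzE !abszX dvdn_pexp2r // => Hd.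
have c := coprime_num_den y.
have d1 : denq y = 1.
  have : (`|denq y| %| 1)%N by rewrite -(eqP c) dvdn_gcd Hd dvdnn.
  rewrite dvdn1 => /eqP E; by have := denq_gt0 y; lia.
move: H; rewrite d1 expr1n mulr1 => /(congr1 absz); rewrite abszX /=.
case: `|numq y|%N => [|[|m]] // H.
have : (2 ^ 3 <= m.+2 ^ 3)%N by rewrite leq_exp2r.
by rewrite -H.
Qed.

Definition special (A B : int) := exists alpha beta : int, rank3_case A B alpha beta.

Section Special.
Variables A B : int.
Hypothesis A0 : A != 0.
Hypothesis B0 : B != 0.
Local Notation a := (A%:~R : rat).
Local Notation b := (B%:~R : rat).

(** For x = c^3, write x = x^3 / c^6 and replace x^3 by p^6 or by - 27 p^6. *)
Fact sixth_power (x : rat) : x != 0 -> is_cube x -> is_sq3 x ->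
  exists s, x = s ^+ 6 \/ x = (- 27)%:~R * s ^+ 6.
Proof.
move=> x0 [c Ec] [p Ep]; exists (p / c).
have c0 : c != 0 by apply: contraNneq x0 => c0; rewrite Ec c0 expr0n.
have E2 : x * c ^+ 6 = x ^+ 3 by rewrite Ec; ring.
case: Ep => Ep; [left | right]; apply: (mulIf (expf_neq0 6 c0)); rewrite E2.
  by rewrite Ep; field.
by rewrite Ep; field.
Qed.

(** For 4 x = c^3, x = 16 x^3 / c^6; the 16 is the 2^4 of the four cases. *)
Fact sixth_power16 (x : rat) : x != 0 -> is_cube (4%:R * x) -> is_sq3 x ->
  exists s, x = 16%:~R * s ^+ 6 \/ x = (- 432)%:~R * s ^+ 6.
Proof.
move=> x0 [c Ec] [p Ep]; exists (p / c).
have c0 : c != 0.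
  by apply: contraNneq x0 => c0; rewrite -(mulrI_eq0 _ (mulfI (isT : 4%:R != 0 :> rat))) Ec c0 expr0n.
have E2 : x * c ^+ 6 = 16%:R * x ^+ 3 by rewrite (exprM c 3 2) -Ec; ring.
case: Ep => Ep; [left | right]; apply: (mulIf (expf_neq0 6 c0)); rewrite E2.
  by rewrite Ep; field.
by rewrite Ep; field.
Qed.

Fact int_sixth_power (x n m : int) (s : rat) : x%:~R = n%:~R * s ^+ 6 -> m * n = 432 ->
  exists c : int, x = n * c ^+ 6.
Proof.
move=> Ex En; have [c Ec] : exists c : int, s = c%:~R.
  by apply: (@int_root s (m * x)); rewrite rmorphM /= Ex mulrA -rmorphM En.
by exists c; apply: (@intr_inj rat); rewrite Ex Ec !(rmorphXn, rmorphM).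
Qed.

(** As a is a cube, the last condition says that 4 b is a cube. The two alternatives for a and the
    two for b then make up the four cases. *)
Lemma special_criterion : is_cube a -> is_sq3 a -> is_sq3 b -> is_cube (a ^+ 2 / (4%:R * b)) ->
  special A B.
Proof.
have a0 : a != 0 by rewrite intr_eq0.
have b0 : b != 0 by rewrite intr_eq0.
move=> ca sa sb [c Ec]; have [e Ee] := ca.
have c0 : c != 0.
  apply: contraTneq (_ : a ^+ 2 / (4%:R * b) != 0) => [c0|]; first by rewrite Ec c0 expr0n eqxx.
  by rewrite mulf_neq0 ?expf_neq0 // invr_eq0 mulf_neq0.
have cb : is_cube (4%:R * b).
  exists (e ^+ 2 / c); have : 4%:R * b * c ^+ 3 = a ^+ 2 by rewrite -Ec; field.
  rewrite Ee => H; apply: (mulIf (expf_neq0 3 c0)); rewrite H; field.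
  exact: c0.
have [s Es] := sixth_power a0 ca sa; have [u Eu] := sixth_power16 b0 cb sb.
have [al Eal] : exists al : int, A = al ^+ 6 \/ A = - (3%:R ^+ 3 * al ^+ 6).
  case: Es => Es.
    have [al E] := @int_sixth_power A 1 432 s (etrans Es (esym (mul1r _))) erefl.
    by exists al; left; rewrite E mul1r.
  by have [al E] := @int_sixth_power A (- 27) (- 16) s Es erefl; exists al; right; rewrite E; ring.
have [be Ebe] : exists be : int, B = 2%:R ^+ 4 * be ^+ 6 \/ B = - (3%:R ^+ 3 * 2%:R ^+ 4 * be ^+ 6).
  case: Eu => Eu.
    by have [be E] := @int_sixth_power B 16 27 u Eu erefl; exists be; left; rewrite E; ring.
  by have [be E] := @int_sixth_power B (- 432) (- 1) u Eu erefl; exists be; right; rewrite E; ring.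
exists al, be; case: Eal => Ea; case: Ebe => Eb.
- by constructor 1.
- by constructor 4; split=> //; rewrite Eb; ring.
- by constructor 2.
by constructor 3.
Qed.

(** From a = p^3, b = q^3 and s^3 = a^2 / (4 b) follows 4 = (p^2 / (q s))^3. *)
Lemma cubes_absurd : is_cube a -> is_cube b -> ~ is_cube (a ^+ 2 / (4%:R * b)).
Proof.
have a0 : a != 0 by rewrite intr_eq0.
have b0 : b != 0 by rewrite intr_eq0.
move=> [p Ep] [q Eq] [s Es]; apply: four_not_cube; exists (p ^+ 2 / (q * s)).
have p0 : p != 0 by apply: contraNneq a0 => E; rewrite Ep E expr0n.
have q0 : q != 0 by apply: contraNneq b0 => E; rewrite Eq E expr0n.
have s0 : s != 0.
  apply: contraTneq (_ : a ^+ 2 / (4%:R * b) != 0) => [s0|]; first by rewrite Es s0 expr0n eqxx.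
  by rewrite mulf_neq0 ?expf_neq0 // invr_eq0 mulf_neq0.
have : (p ^+ 2) ^+ 3 = 4%:R * q ^+ 3 * s ^+ 3.
  by rewrite -Es -Eq Ep; field; exact: b0.
by rewrite expr_div_n => ->; field; rewrite s0 q0.
Qed.

End Special.

(** * The upper bound for the rank *)

Local Notation n2 := (char0_2 algC_char0).
Local Notation n3 := (char0_3 algC_char0).

Lemma clear_alg (K : fieldType) (x0 x1 x2 x3 t D : K) : D != 0 ->
  (x0 * (t ^+ 0 / D) + x1 * (t ^+ 1 / D) + x2 * (t ^+ 2 / D) + x3 * (t ^+ 3 / D)) * D =
  x0 + x1 * t ^+ 1 + x2 * t ^+ 2 + x3 * t ^+ 3.
Proof. by move=> D0; field. Qed.

Lemma int_relation (n m : nat) (M : 'I_n -> 'I_m -> rat) : (m < n)%N ->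
  exists2 c : 'I_n -> int, exists i, c i != 0 & forall j, \sum_i (c i)%:~R * M i j = 0.
Proof.
move=> lt_mn; pose N := \matrix_(i, j) M i j.
have /rowV0Pn [u /sub_kermxP Hu u0] : kermx N != 0.
  rewrite kermx_eq0 /row_free; apply: contraTneq lt_mn => <-.
  by rewrite -leqNgt rank_leq_col.
(* The kernel vector is viewed as a polynomial in order to clear its denominators. *)
have [q [a a0 Eq]] := rat_poly_scale (rVpoly u).
have a0' : a%:~R != 0 :> rat by rewrite intr_eq0.
have Ei (i : 'I_n) : (q`_i)%:~R = a%:~R * u 0 i.
  have := congr1 (fun p : {poly rat} => p`_i) Eq.
  by rewrite /= coef_rVpoly_ord coefZ coef_map /= => ->; rewrite mulVKf.
exists (fun i => q`_i).
  have [i ui] : exists i, u 0 i != 0.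
    by apply/existsP; apply: contraNT u0 => /existsPn H; apply/eqP/rowP => i; rewrite mxE; apply/eqP/negPn/H.
  by exists i; rewrite -(intr_eq0 rat) Ei mulf_neq0.
move=> j; under eq_bigr => i _ do rewrite Ei -mulrA.
rewrite -mulr_sumr; have := congr1 (fun w : 'rV_m => w 0 j) Hu; rewrite !mxE => H.
rewrite (_ : \sum_i _ = 0) ?mulr0 //; apply: etrans H.
by apply: eq_bigr => i _; rewrite mxE.
Qed.

Section Upper.

Variables A B : int.
Hypothesis hA : A != 0.
Hypothesis hB : B != 0.
Local Notation Ac := (A%:~R : algC).
Local Notation Bc := (B%:~R : algC).
Local Notation G := (ec_point (E_AB B hA)).
Local Notation E := (EC Bc (hAc hA)).
Local Notation D := (pf (pD Ac Bc)).
Local Notation dl := (delta (@der algC) (E := E)).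
Local Notation incP := (@incP A B hA).

Variables om0 a1 z0 c0 b1 y0 d0 : algC.
Hypothesis Hom0 : om0 ^+ 2 + om0 + 1 = 0.
Hypothesis Ea1 : a1 ^+ 3 = Ac.
Hypothesis Ez0 : z0 ^+ 2 = Bc.
Hypothesis Ec0 : c0 ^+ 3 = Ac ^+ 2 / (4%:R * Bc).
Hypothesis Eb1 : b1 ^+ 3 = Bc.
Hypothesis Ey0 : y0 ^+ 2 = Ac.
Hypothesis Ed0 : d0 ^+ 3 = Bc ^+ 2 / (4%:R * Ac).
Local Notation eisenstein := (@eisenstein algC om0).

(* The coefficient of [t^i] in [6 D delta (P)] is an Eisenstein integer times [kappa`_i]. *)
Definition kappa := [:: 4%:R * d0 * y0; 2%:R * a1 * z0; 2%:R * b1 * y0; 4%:R * c0 * z0].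

Fact root_neq0 (n : nat) (x y : algC) : x ^+ n.+1 = y -> y != 0 -> x != 0.
Proof. by move=> <-; apply: contraNneq => ->; rewrite expr0n. Qed.

Lemma kappa_neq0 i : (i < 4)%N -> kappa`_i != 0.
Proof.
have A0 := hAc hA; have B0 := hBc hB.
have q (x y : algC) : x != 0 -> y != 0 -> x ^+ 2 / (4%:R * y) != 0.
  by move=> x0 y0'; rewrite mulf_neq0 ?expf_neq0 // invr_eq0 mulf_neq0 // pnatr_eq0.
have ha := root_neq0 Ea1 A0; have hz := root_neq0 Ez0 B0; have hc := root_neq0 Ec0 (q _ _ A0 B0).
have hb := root_neq0 Eb1 B0; have hy := root_neq0 Ey0 A0; have hd := root_neq0 Ed0 (q _ _ B0 A0).
by case: i => [|[|[|[|i]]]] //= _; rewrite !mulf_neq0 ?pnatr_eq0.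
Qed.

(** 6 D delta (P) is a polynomial over the algebraic numbers by [full_delta] and lies in Q(t)
    because P does; hence its coefficients are rational. As no kappa vanishes, g = 0 forces all the
    Eisenstein multipliers to be 0. *)
Lemma coefs (P : G) : exists g : {poly rat},
  [/\ dl (incP P) *+ 6 * D = pf (map_poly ratr g),
      forall i, exists2 m, eisenstein m & ratr g`_i = m * kappa`_i &
      g = 0 -> P *+ 6 = 0].
Proof.
have A0 := hAc hA; have B0 := hBc hB.
have [m0 [m1 [m2 [m3 [[e0 e1 e2 e3] Ed Z]]]]] :=
  full_delta algC_char0 Hom0 A0 B0 (E := E) (E' := EC Ac B0) erefl erefl erefl erefl
     Ea1 Ez0 Ec0 Eb1 Ey0 Ed0 (incP P).
pose ms := [:: m0; m1; m2; m3].
pose p : {poly algC} := \poly_(i < 4) (ms`_i * kappa`_i).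
have Ep : dl (incP P) *+ 6 * D = pf p.
  rewrite Ed (clear_alg _ _ _ _ _ (D_neq0 Bc A0)) /p poly_def !big_ord_recr big_ord0 /=.
  rewrite add0r expr0 -!mul_polyC mulr1 !(rmorphD, rmorphM, rmorphXn) /= pfX.
  by rewrite !pfC.
have [g [Eg Eh]] : exists h : {poly rat}, delta (@fder rat) P *+ 6 * (A%:~R * Qt_var ^+ 6 + B%:~R) =
    @FracField.tofrac {poly rat} h /\ map_poly ratr h = p.
  by apply: inc_poly; rewrite rmorphM rmorphMn /= -dl_incP // inc_D Ep.
have Cg i : ratr g`_i = p`_i by rewrite -Eh coef_map.
exists g; split; first by rewrite Ep Eh.
- move=> i; rewrite Cg coef_poly.
  case: ifP => [|_]; last by exists 0; [exists 0, 0; rewrite mul0r addr0 | rewrite mul0r].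
  case: i => [|[|[|[|i]]]] // _; first by exists m0. 1: by exists m1. 1: by exists m2. by exists m3.
move=> g0; have Em i : (i < 4)%N -> ms`_i = 0.
  move=> i4; have := Cg i; rewrite g0 coef0 rmorph0 coef_poly i4 => /esym/eqP.
  by rewrite mulf_eq0 (negPf (kappa_neq0 i4)) orbF => /eqP.
apply: (incP_eq0 (hA := hA)); rewrite raddfMn /=.
by apply: Z; [exact: (Em 0%N) | exact: (Em 1%N) | exact: (Em 2%N) | exact: (Em 3%N)].
Qed.

Local Notation r := (om0 - om0 ^+ 2).
Local Notation aq := (A%:~R : rat).
Local Notation bq := (B%:~R : rat).

Lemma root3_sqr : r ^+ 2 = - 3%:R.
Proof. by ring: (w2E Hom0). Qed.

Lemma eisenstein_inK m : eisenstein m -> inK r m.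
Proof.
case=> a [b ->]; exists (a%:~R - b%:~R / 2%:R), (b%:~R / 2%:R).
rewrite !(rmorphB, rmorphM, fmorphV, rmorph_nat, rmorph_int) /=.
have n2' := n2; field: (w2E Hom0).
by [].
Qed.

(* [kappa`_i] lies in Q(sqrt (-3)). *)
Definition kappa_cond (i : nat) : Prop := match i with
  | 0 => is_cube (bq ^+ 2 / (4%:R * aq)) /\ is_sq3 aq
  | 1 => is_cube aq /\ is_sq3 bq
  | 2 => is_cube bq /\ is_sq3 aq
  | _ => is_cube (aq ^+ 2 / (4%:R * bq)) /\ is_sq3 bq end.

Lemma kappa_condP i m (x : rat) : (i < 4)%N -> eisenstein m -> x != 0 ->
  ratr x = m * kappa`_i -> kappa_cond i.
Proof.
move=> i4 em x0 E; have a0 : aq != 0 by rewrite intr_eq0.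
have b0 : bq != 0 by rewrite intr_eq0.
have q (u v : rat) : u != 0 -> v != 0 -> u ^+ 2 / (4%:R * v) != 0.
  by move=> u0 v0; rewrite mulf_neq0 ?expf_neq0 // invr_eq0 mulf_neq0.
have x0' : ratr x != 0 :> algC by rewrite fmorph_eq0.
have m0 : m != 0 by apply: contraNneq x0' => m0; rewrite E m0 mul0r.
have Kk : inK r kappa`_i.
  rewrite -[kappa`_i](mulKf m0) -E; apply: (inKM root3_sqr); last exact: inK_rat.
  exact: (inKV root3_sqr) (eisenstein_inK em).
case: i i4 Kk {E} => [|[|[|[|i]]]] //= _ Kk.
- apply: (inK_cube_sqr root3_sqr (n := 4) _ (q _ _ b0 a0) a0 _ _ Kk) => //.
    by rewrite Ed0 !(fmorph_div, rmorphM, rmorphXn, rmorph_nat, rmorph_int).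
  by rewrite Ey0 rmorph_int.
- apply: (inK_cube_sqr root3_sqr (n := 2) _ a0 b0 _ _ Kk) => //.
    by rewrite Ea1 rmorph_int.
  by rewrite Ez0 rmorph_int.
- apply: (inK_cube_sqr root3_sqr (n := 2) _ b0 a0 _ _ Kk) => //.
    by rewrite Eb1 rmorph_int.
  by rewrite Ey0 rmorph_int.
apply: (inK_cube_sqr root3_sqr (n := 4) _ (q _ _ a0 b0) b0 _ _ Kk) => //.
  by rewrite Ec0 !(fmorph_div, rmorphM, rmorphXn, rmorph_nat, rmorph_int).
by rewrite Ez0 rmorph_int.
Qed.

Definition delta6 (P : G) : F := dl (incP P) *+ 6 * D.

Fact delta6_is_zmod : zmod_morphism delta6.
Proof.
have A0 := hAc hA; have B0 := hBc hB => P Q.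
rewrite /delta6 raddfB /= (dlD algC_char0 A0 B0 (E := E) erefl erefl).
by rewrite (dlN algC_char0 A0 B0 (E := E) erefl erefl) mulrnBl mulrBl.
Qed.
HB.instance Definition _ := GRing.isZmodMorphism.Build G F delta6 delta6_is_zmod.

Lemma delta6_sum n (v : 'I_n -> G) (c : 'I_n -> int) :
  delta6 (\sum_i v i *~ c i) = \sum_i delta6 (v i) *~ c i.
Proof. by rewrite raddf_sum /=; apply: eq_bigr => i _; rewrite raddfMz. Qed.

(** The coefficients outside S are 0, so the points map to a rational vector space of dimension |S|
    with torsion kernel. More than |S| points therefore have a vanishing combination of coefficients
    with integer multipliers, and 6 times it is a relation between the points. *)
Lemma independent_leq (S : {set 'I_4}) n (v : 'I_n -> G) :
  (forall i : 'I_4, kappa_cond i -> i \in S) -> Z_independent v -> (n <= #|S|)%N.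
Proof.
move=> HS Hv; rewrite leqNgt; apply/negP => lt_Sn.
have [g Hg] := fin_all_exists (fun i => coefs (v i)).
have [c [i0 ci0] Hc] := int_relation (fun i (j : 'I_#|S|) => (g i)`_(enum_val j)) lt_Sn.
pose P := \sum_i v i *~ c i; have [h [Eh _ Zh]] := coefs P.
have Eg : h = \sum_i g i *~ c i.
  apply: (map_inj_poly (fmorph_inj (ratr : rat -> algC)) (rmorph0 _)).
  apply: pf_inj; rewrite -Eh -/(delta6 P) delta6_sum !raddf_sum /=.
  apply: eq_bigr => i _; have [Ei _ _] := Hg i.
  by rewrite !raddfMz /= -Ei.
have /Zh : h = 0.
  apply/polyP => j; rewrite coef0 Eg coef_sum.
  have Ecoef i : (g i *~ c i)`_j = (c i)%:~R * (g i)`_j.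
    by rewrite -scaler_int coefZ.
  rewrite (eq_bigr _ (fun i _ => Ecoef i)).
  have [j4|j4] := ltnP j 4; last first.
    apply: big1 => i _; have [_ Hm _] := Hg i; have [m _] := Hm j.
    by rewrite [kappa`_j]nth_default // mulr0 => /eqP; rewrite fmorph_eq0 => /eqP ->; rewrite mulr0.
  have [jS|jS] := boolP (Ordinal j4 \in S).
    by have := Hc (enum_rank_in jS (Ordinal j4)); rewrite enum_rankK_in.
  apply: big1 => i _; have [_ Hm _] := Hg i; have [m em Em] := Hm j.
  have [->|gn] := eqVneq (g i)`_j 0; first by rewrite mulr0.
  by case/negP: jS; apply: HS; exact: (kappa_condP j4 em gn Em).
move=> P0; case/negP: ci0; apply/eqP.
have H6 : \sum_i v i *~ (c i * 6) = 0.
  apply: etrans P0; rewrite /P -sumrMnl; apply: eq_bigr => i _.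
  by rewrite mulrzA.
by have := Hv _ H6 i0; lia.
Qed.

End Upper.

(** * Points defined over Q(t) *)

Local Notation rc := (@recip algC).

Definition inI (z : F) := exists x, z = inc x.

Lemma inI_nat n : inI n%:R.
Proof. by exists n%:R; rewrite rmorph_nat. Qed.

Lemma inI_cst q : inI (cst (ratr q)).
Proof. by exists (@FracField.tofrac {poly rat} q%:P); rewrite inc_qf map_polyC. Qed.

Lemma inI_t : inI t.
Proof. by exists Qt_var; rewrite inc_t. Qed.

Lemma inID x y : inI x -> inI y -> inI (x + y).
Proof. by case=> [a ->] [b ->]; exists (a + b); rewrite rmorphD. Qed.

Lemma inIN x : inI x -> inI (- x).
Proof. by case=> [a ->]; exists (- a); rewrite rmorphN. Qed.

Lemma inIM x y : inI x -> inI y -> inI (x * y).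
Proof. by case=> [a ->] [b ->]; exists (a * b); rewrite rmorphM. Qed.

Lemma inIV x : inI x -> inI x^-1.
Proof. by case=> [a ->]; exists a^-1; rewrite fmorphV. Qed.

Lemma inIX x n : inI x -> inI (x ^+ n).
Proof. by case=> [a ->]; exists (a ^+ n); rewrite rmorphXn. Qed.

Lemma inI_recip x : inI x -> inI (rc x).
Proof.
have H (p : {poly rat}) : inI (rc (pf (map_poly ratr p))).
  elim/poly_ind: p => [|p q IH]; first by exists 0; rewrite !rmorph0.
  rewrite rmorphD rmorphM /= map_polyX map_polyC /= rmorphD rmorphM /=.
  rewrite pfX pfC rmorphD rmorphM /= recip_t recip_cst.
  exact: inID (inIM IH (inIV inI_t)) (inI_cst q).
case=> z ->; have [a [b [_ ->]]] := frac_ex z.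
rewrite !fmorph_div /= !inc_qf; exact: inIM (H a) (inIV (H b)).
Qed.

Lemma phi_y_alg (K : fieldType) (x y r D : K) : x != 0 -> r != 0 -> 9%:R != 0 :> K ->
  r ^+ 4 = 9%:R ->
  y * (x ^+ 3 - 8%:R * D) / (r ^+ 3 * x ^+ 3) = r * y * (x ^+ 3 - 8%:R * D) / (9%:R * x ^+ 3).
Proof. by move=> x0 r0 n9 E; rewrite -E in n9 *; field; rewrite x0 r0. Qed.

Lemma mirror_solve (K : fieldType) (t X c z : K) i : t != 0 -> (i <= 3)%N -> X != 0 ->
  c * (t^-1 ^+ i / X) = - t ^+ 3 * z -> z = - c * (t ^+ (3 - i) / (t ^+ 6 * X)).
Proof.
move=> t0 i3 X0 H; have ti : t ^+ i != 0 by exact: expf_neq0.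
have t3 : - t ^+ 3 != 0 by rewrite oppr_eq0 expf_neq0.
apply: (mulfI t3); rewrite -H exprVn.
rewrite (_ : t ^+ 6 = t ^+ 3 * (t ^+ (3 - i) * t ^+ i)); last first.
  by rewrite -exprD subnK // -exprD.
have ti' : t ^+ (3 - i) != 0 by exact: expf_neq0.
move: (t ^+ i) (t ^+ (3 - i)) ti ti' => u v u0 v0.
by field; rewrite X0 v0 u0 t0.
Qed.

Fact fmorph_neq0 (K L : fieldType) (f : {rmorphism K -> L}) x : x != 0 -> f x != 0.
Proof. by rewrite fmorph_eq0. Qed.

Section Points.

Variable om0 : algC.
Hypothesis Hom0 : om0 ^+ 2 + om0 + 1 = 0.
Local Notation r := (om0 - om0 ^+ 2).

Section OneCurve.
Variables A B : int.
Hypothesis hA : A != 0.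
Hypothesis hB : B != 0.
Local Notation Ac := (A%:~R : algC).
Local Notation Bc := (B%:~R : algC).
Local Notation A0 := (hAc hA).
Local Notation B0 := (hBc hB).
Local Notation E := (EC Bc (hAc hA)).
Local Notation D := (pf (pD Ac Bc)).
Local Notation dl := (delta (@der algC) (E := E)).

Definition has_pt (i : nat) := exists P (c : algC),
  c != 0 /\ dl (@incP A B hA P) = cst c * (t ^+ i / D).

Lemma inI_D : inI D.
Proof. by rewrite -inc_D; eexists. Qed.

(** If only r y is rational, phi (Q) takes the place of Q: since r^4 = 9, the factor 1 / r^3 in its
    ordinate is r / 9. This multiplies delta by r and leaves the exponent of t unchanged. *)
Lemma has_pt_of (Q : ec_point E) x y c i : ec_coords Q = Some (x, y) ->
  inI x -> inI y \/ inI (cst r * y) -> c != 0 -> dl Q = cst c * (t ^+ i / D) -> has_pt i.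
Proof.
move=> HQ Ix [Iy|Iry] c0 Ed.
  case: Ix HQ => x' -> HQ; case: Iy HQ => y' -> HQ.
  by have [P EP] := incP_image HQ; exists P, c; rewrite EP.
have Ea : ec_a E = 0 := erefl; have Eb : ec_b E = D := erefl.
have ex0 := E_x0 n2 n3 A0 B0 Ea Eb.
have HP := phiE Ea (Hw Hom0) ex0 HQ.
have xn : x != 0 := ex0 _ _ (on_coords HQ).
have rn : r != 0.
  apply/eqP => r0; have := root3_sqr Hom0; rewrite r0 expr0n /= => /eqP.
  by rewrite eq_sym oppr_eq0 pnatr_eq0.
have rF : cst r != 0 by rewrite cst_eq0.
have n9 : 9%:R != 0 :> F by rewrite -(rmorph_nat cst) cst_eq0 pnatr_eq0.
have E9 : cst r ^+ 4 = 9%:R.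
  rewrite -rmorphXn (exprM r 2 2) (root3_sqr Hom0) -(rmorph_nat cst).
  by congr cst; ring.
have Er : cst om0 - cst om0 ^+ 2 = cst r by rewrite rmorphB rmorphXn.
rewrite Er (phi_y_alg _ _ xn rF n9 E9) in HP.
have Ix' : inI (- (x ^+ 3 + 4%:R * D) / (3%:R * x ^+ 2)).
  apply: inIM; first exact: inIN (inID (inIX 3 Ix) (inIM (inI_nat 4) inI_D)).
  exact: inIV (inIM (inI_nat 3) (inIX 2 Ix)).
have Iy' : inI (cst r * y * (x ^+ 3 - 8%:R * D) / (9%:R * x ^+ 3)).
  apply: inIM; last exact: inIV (inIM (inI_nat 9) (inIX 3 Ix)).
  exact: inIM Iry (inID (inIX 3 Ix) (inIN (inIM (inI_nat 8) inI_D))).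
case: Ix' HP => x' -> HP; case: Iy' HP => y' -> HP.
have [P EP] := incP_image HP; exists P, (r * c); split; first exact: mulf_neq0.
rewrite EP /phi (dlD algC_char0 A0 B0 Ea Eb) (dlN algC_char0 A0 B0 Ea Eb).
rewrite !(dl_om algC_char0 Hom0 A0 B0 Ea Eb) Ed (rmorphM cst) /= -Er.
move: (cst om0) (cst c) (t ^+ i / D) => w c' q; ring.
Qed.

Section Generators.
Variables a1 z0 c0 : algC.
Hypothesis Ea1 : a1 ^+ 3 = Ac.
Hypothesis Ez0 : z0 ^+ 2 = Bc.
Hypothesis Ec0 : c0 ^+ 3 = Ac ^+ 2 / (4%:R * Bc).
Hypothesis Iz : inI (cst z0) \/ inI (cst r * cst z0).

Lemma has_pt1 : inI (cst a1) -> has_pt 1.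
Proof.
move=> Ia; have Ea : ec_a E = 0 := erefl; have Eb : ec_b E = D := erefl.
pose Q := gen1 Ea Eb Ea1 Ez0.
have HQ : ec_coords Q = Some (t ^+ 2 * cst (- a1), cst z0) by rewrite /= !it_cst.
have Hd : dl Q = cst (- (2%:R * a1 * z0)) * (t ^+ 1 / D) := dl_gen1 algC_char0 A0 B0 Ea Eb Ea1 Ez0.
apply: (has_pt_of HQ _ Iz _ Hd).
  rewrite rmorphN; exact: inIM (inIX 2 inI_t) (inIN Ia).
rewrite oppr_eq0 !mulf_neq0 ?pnatr_eq0 //; first exact: root_neq0 Ea1 A0.
exact: root_neq0 Ez0 B0.
Qed.

Lemma has_pt3 : inI (cst c0) -> has_pt 3.
Proof.
move=> Ic; have Ea : ec_a E = 0 := erefl; have Eb : ec_b E = D := erefl.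
pose Q := gen2 algC_char0 B0 Ea Eb Ez0 Ec0.
have zn : z0 != 0 := root_neq0 Ez0 B0.
have cn : c0 != 0.
  apply: (root_neq0 Ec0); rewrite mulf_neq0 ?expf_neq0 ?A0 //.
  by rewrite invr_eq0 mulf_neq0 ?B0 // pnatr_eq0.
(* As 1 / (2 z0) = z0 / (2 B), the ordinate of the generator is z0 times the rational function S, so
   its irrationality is that of z0. *)
pose S := (cst Ac * t ^+ 6 + cst (2%:R * Bc)) / cst (2%:R * Bc).
have IB (n : int) : inI (cst n%:~R) by exists n%:~R; rewrite inc_int.
have IS : inI S.
  have I2B : inI (cst (2%:R * Bc)) by rewrite rmorphM rmorph_nat; exact: inIM (inI_nat 2) (IB B).
  exact: inIM (inID (inIM (IB A) (inIX 6 inI_t)) I2B) (inIV I2B).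
have HQ : ec_coords Q = Some (t ^+ 4 * cst c0, cst z0 * S).
  rewrite /= it_cst /yline2 rmorphM rmorphD rmorphM /= !it_cst it_u; congr (Some (_, _)).
  have -> : cst (2%:R * z0)^-1 = cst z0 / cst (2%:R * Bc).
    rewrite -(fmorph_div cst) -Ez0; congr cst.
    by field; rewrite zn.
  by rewrite /S mulrAC mulrA.
have Hd : dl Q = cst (4%:R * c0 * z0) * (t ^+ 3 / D) := dl_gen2 algC_char0 A0 B0 Ea Eb Ez0 Ec0.
apply: (has_pt_of HQ _ _ _ Hd).
- exact: inIM (inIX 4 inI_t) Ic.
- case: Iz => Iz'; [left | right]; first exact: inIM Iz' IS.
  by rewrite mulrA; exact: inIM Iz' IS.
by rewrite !mulf_neq0 ?pnatr_eq0.
Qed.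

End Generators.

End OneCurve.

(** Inversion of t preserves Q(t), so the mirror of a rational point is rational on the curve with A
    and B exchanged. *)
Lemma has_pt_mirror (A B : int) (hA : A != 0) (hB : B != 0) i : (i <= 3)%N ->
  has_pt B hA i -> has_pt A hB (3 - i).
Proof.
move=> i3 [P [c [c0 Ed]]]; have A0 := hAc hA; have B0 := hBc hB; have t0 := tv0 algC.
have D0 : pf (pD (A%:~R : algC) B%:~R) != 0 := D_neq0 _ A0.
have D'0 : pf (pD (B%:~R : algC) A%:~R) != 0 := D_neq0 _ B0.
pose E := EC (B%:~R : algC) (hAc hA); pose E' := EC (A%:~R : algC) (hAc hB).
have Ea : ec_a E = 0 := erefl; have Eb : ec_b E = pf (pD A%:~R B%:~R) := erefl.
have Ea' : ec_a E' = 0 := erefl; have Eb' : ec_b E' = pf (pD B%:~R A%:~R) := erefl.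
pose Q := mir Ea Eb Ea' Eb' (incP P).
have [x [y HP]] : exists x y, ec_coords (incP P) = Some (inc x, inc y).
  case H: (ec_coords P) => [[x y]|]; first by exists x, y; rewrite /= H /= !expr1n !mul1r.
  have P0 : P = 0 by apply: val_inj.
  have cF : cst c != 0 by rewrite cst_eq0.
  case/eqP: (mulf_neq0 cF (mulf_neq0 (expf_neq0 i t0) (invr_neq0 D0))).
  by rewrite -Ed P0 raddf0.
have HQ := mirE Ea Eb Ea' Eb' HP.
have Ed' : delta (@der algC) Q = cst (- c) * (t ^+ (3 - i) / pf (pD B%:~R A%:~R)).
  have := dl_mir algC_char0 A0 B0 Ea Eb Ea' Eb' (incP P); rewrite Ed.
  have Einv := recip_D (A%:~R : algC) B%:~R.
  move/(congr1 rc); rewrite !(rmorphN, rmorphXn, rmorphM) /= !fmorphV /= recipK recip_cst recip_t ?invrK.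
  move/(mirror_solve t0 i3 (fmorph_neq0 rc D0)) => ->.
  by rewrite Einv.
have Iinv z : inI (rc (inc z)) by apply: inI_recip; exists z.
apply: (has_pt_of hA HQ _ _ _ Ed').
- exact: inIM (inIX 2 inI_t) (Iinv x).
- by left; exact: inIM (inIX 3 inI_t) (Iinv y).
by rewrite oppr_eq0.
Qed.

(** The exponents 1 and 3 have explicit generators; 2 and 0 are their mirrors. For C = - 3 p^2 the
    root z0 = r p is taken, so that r z0 = - 3 p is rational. *)
Lemma kappa_cond_has_pt (A B : int) (hA : A != 0) (hB : B != 0) i : (i < 4)%N ->
  kappa_cond A B i -> has_pt B hA i.
Proof.
have sq (C : int) : is_sq3 C%:~R -> exists z0 : algC,
    z0 ^+ 2 = C%:~R /\ (inI (cst z0) \/ inI (cst r * cst z0)).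
  case=> p [] Ep; rewrite -(ratr_int algC) Ep.
    by exists (ratr p); rewrite rmorphXn; split=> //; left; exact: inI_cst.
  exists (r * ratr p); split.
    by rewrite exprMn (root3_sqr Hom0) !(rmorphN, rmorphXn, rmorphM, rmorph_nat).
  right; rewrite rmorphM mulrA -expr2 -rmorphXn (root3_sqr Hom0) -(rmorph_nat ratr).
  by rewrite -rmorphN; exact: inIM (inI_cst _) (inI_cst _).
have P1 (C C' : int) (hC : C != 0) (hC' : C' != 0) : is_cube C%:~R -> is_sq3 C'%:~R -> has_pt C' hC 1.
  move=> [p Ep] /sq [z0 [Ez Iz]].
  have Ea : ratr p ^+ 3 = C%:~R :> algC by rewrite -rmorphXn -Ep rmorph_int.
  exact: (has_pt1 hC hC' Ea Ez Iz (inI_cst p)).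
have P3 (C C' : int) (hC : C != 0) (hC' : C' != 0) :
    is_cube (C%:~R ^+ 2 / (4%:R * C'%:~R)) -> is_sq3 C'%:~R -> has_pt C' hC 3.
  move=> [p Ep] /sq [z0 [Ez Iz]].
  have Ec : ratr p ^+ 3 = C%:~R ^+ 2 / (4%:R * C'%:~R) :> algC.
    by rewrite -rmorphXn -Ep !(fmorph_div, rmorphXn, rmorphM, rmorph_int, rmorph_nat).
  exact: (has_pt3 hC hC' Ez Ec Iz (inI_cst p)).
case: i => [|[|[|[|i]]]] //= _ [].
- by move=> c s; apply: (has_pt_mirror hA (i := 3) isT); exact: P3.
- exact: P1.
- by move=> c s; apply: (has_pt_mirror hA (i := 1) isT); exact: P1.
exact: P3.
Qed.

End Points.

(* The values of [delta] at these points are multiples of distinct powers of [t]. *)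
Lemma independent_pts (A B : int) (hA : A != 0) (hB : B != 0) n (e : 'I_n -> nat) : injective e ->
  (forall i, has_pt B hA (e i)) -> exists v : 'I_n -> ec_point (E_AB B hA), Z_independent v.
Proof.
move=> inj_e He; have [v Hv] := fin_all_exists He; exists v => z Hz i0.
have [c Hc] := fin_all_exists Hv.
have D0 := D_neq0 (B%:~R : algC) (hAc hA).
have Lv i : delta6 (v i) = pf ((c i)%:P * 'X^(e i)) *+ 6.
  have [_ Ei] := Hc i; rewrite /delta6 Ei mulrnAl mulrA divfK //.
  by rewrite rmorphM rmorphXn /= pfC pfX.
have La0 : delta6 (0 : ec_point (E_AB B hA)) = 0 by rewrite /delta6 raddf0 mul0rn mul0r.
have : \sum_i ((c i)%:P * 'X^(e i)) *+ 6 *~ z i = 0.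
  apply: pf_inj; rewrite rmorph0 -La0 -Hz delta6_sum // raddf_sum /=.
  by apply: eq_bigr => i _; rewrite raddfMz raddfMn /= Lv.
move/(congr1 (fun p : {poly algC} => p`_(e i0))); rewrite coef0 coef_sum (bigD1 i0) //=.
rewrite big1 => [|i ni]; last first.
  rewrite -scaler_int -scaler_nat !coefZ coefCM coefXn (inj_eq inj_e) eq_sym (negPf ni).
  by rewrite !mulr0.
rewrite addr0 -scaler_int -scaler_nat !coefZ coefCM coefXn eqxx mulr1 => /eqP.
have [c0 _] := Hc i0; rewrite !mulf_eq0 (negPf c0) pnatr_eq0 !orbF intr_eq0.
by move/eqP.
Qed.

(** * The four conditions and the cases of the theorem *)

Lemma special_kappa_cond (A B : int) : A != 0 -> B != 0 -> special A B ->
  [/\ kappa_cond A B 0, kappa_cond A B 1 & kappa_cond A B 3].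
Proof.
move=> hA hB [al [be Hs]]; pose x : rat := al%:~R; pose y : rat := be%:~R.
have tw (u : rat) : u = 1 \/ u = - 3%:R -> forall s, is_sq3 (u ^+ 3 * s ^+ 2).
  by case=> -> s; [exists s; left | exists (3%:R * s); right]; ring.
(* Since - 27 = (- 3)^3, the four cases are treated at once with u and v in {1, - 3}. *)
have [u [v [hu hv EA EB]]] : exists u v : rat, [/\ u = 1 \/ u = - 3%:R, v = 1 \/ v = - 3%:R,
    A%:~R = u ^+ 3 * x ^+ 6 & B%:~R = 16%:R * v ^+ 3 * y ^+ 6].
  case: Hs => -[-> ->]; [exists 1, 1 | exists (- 3%:R), 1 | exists (- 3%:R), (- 3%:R) | exists 1, (- 3%:R)];
    by split; [left + right | left + right | |] => //;
      rewrite !(rmorphN, rmorphXn, rmorphM) /=; ring.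
have x0 : x != 0 by apply: contraNneq hA => H; rewrite -(intr_eq0 rat) EA H expr0n mulr0.
have y0 : y != 0 by apply: contraNneq hB => H; rewrite -(intr_eq0 rat) EB H expr0n mulr0.
have u0 : u != 0 by apply: contraNneq hA => H; rewrite -(intr_eq0 rat) EA H expr0n mul0r.
have v0 : v != 0 by apply: contraNneq hB => H; rewrite -(intr_eq0 rat) EB H expr0n mulr0 mul0r.
have sA : is_sq3 A%:~R by have := tw u hu (x ^+ 3); rewrite EA -exprM.
have sB : is_sq3 B%:~R.
  have := tw v hv (4%:R * y ^+ 3); rewrite EB; congr is_sq3; ring.
split=> /=; split=> //; rewrite ?EA ?EB.
- by exists (4%:R * v ^+ 2 * y ^+ 4 / (u * x ^+ 2)); field; rewrite u0 x0.
- by exists (u * x ^+ 2); ring.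
by exists (u ^+ 2 * x ^+ 4 / (4%:R * v * y ^+ 2)); field; rewrite v0 y0.
Qed.

Theorem theorem1p3 (A B : int) (hA : A != 0) (hB : B != 0) :
  exists r : nat,
    has_rank (ec_point (E_AB B hA)) r /\
    ((exists alpha beta : int,
        rank3_case A B alpha beta \/ rank3_case B A alpha beta) -> r = 3%N) /\
    (~ (exists alpha beta : int,
          rank3_case A B alpha beta \/ rank3_case B A alpha beta) ->
     (r <= 2)%N).
Proof.
have ratC0 : A%:~R != 0 :> algC := hAc hA.
have root n (c : algC) : (0 < n)%N -> exists x, x ^+ n = c by move=> n0; exists (n.-root c); exact: rootCK.
have [om0 Hom0] : exists om0 : algC, om0 ^+ 2 + om0 + 1 = 0.
  have [s Es] := root 2 (- 3%:R : algC) isT; exists ((s - 1) / 2%:R).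
  by field: Es.
have [a1 Ea1] := root 3 A%:~R isT; have [z0 Ez0] := root 2 B%:~R isT.
have [c0 Ec0] := root 3 (A%:~R ^+ 2 / (4%:R * B%:~R)) isT.
have [b1 Eb1] := root 3 B%:~R isT; have [y0 Ey0] := root 2 A%:~R isT.
have [d0 Ed0] := root 3 (B%:~R ^+ 2 / (4%:R * A%:~R)) isT.
(* The conditions are mere propositions; excluded middle turns them into a finite set, whose
   cardinal will be the rank. *)
have [S HS] : exists S : {set 'I_4}, forall i : 'I_4, i \in S <-> kappa_cond A B i.
  have Hb (i : 'I_4) : exists b : bool, b <-> kappa_cond A B i.
    case: (classic (kappa_cond A B i)) => H; first by exists true.
    by exists false; split=> // /H.
  have {Hb} [b Hb] := fin_all_exists Hb.
  by exists [set i | b i] => i; rewrite inE.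
pose o0 : 'I_4 := @Ordinal 4 0 isT; pose o1 : 'I_4 := @Ordinal 4 1 isT.
pose o2 : 'I_4 := @Ordinal 4 2 isT; pose o3 : 'I_4 := @Ordinal 4 3 isT.
(* Conditions 1 and 2 make A and B cubes, and either of the others would then make 4 a cube. So the
   rank never reaches 4, and if it is 3 the missing index is 1 or 2. *)
have not12 : ~ ((o1 \in S) && (o2 \in S) && ((o0 \in S) || (o3 \in S))).
  case/andP=> /andP [/HS [cA _] /HS [cB _]] /orP [] /HS [c _].
    exact: (cubes_absurd hB hA cB cA c).
  exact: (cubes_absurd hA hB cA cB c).
have cardS : #|S| = ((o0 \in S) + (o1 \in S) + (o2 \in S) + (o3 \in S))%N.
  rewrite -sum1_card big_mkcond /= !big_ord_recr big_ord0 /= add0n.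
  by congr (_ + _ + _ + _)%N; rewrite -[RHS]mulr1n; congr (if _ \in S then _ else _); apply: val_inj.
exists #|S|; split; last split.
- split.
    apply: (independent_pts hB (e := fun i : 'I_#|S| => enum_val i : nat)).
      by move=> i j /val_inj /enum_val_inj.
    by move=> i; apply: (kappa_cond_has_pt Hom0 hA hB (ltn_ord _)); apply/HS; exact: enum_valP.
  move=> n v; apply: (independent_leq hB Hom0 Ea1 Ez0 Ec0 Eb1 Ey0 Ed0) => i.
  by move/HS.
- case=> al [be Hs]; rewrite cardS.
  have [in0 in3 in12] : [/\ o0 \in S, o3 \in S & (o1 \in S) || (o2 \in S)].
    case: Hs => Hs.
      have [|C0 C1 C3] := special_kappa_cond hA hB; first by exists al, be.
      by rewrite (proj2 (HS o3) C3) (proj2 (HS o0) C0) (proj2 (HS o1) C1).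
    (* Exchanging A and B turns condition i into condition 3 - i. *)
    have [|C3 C2 C0] := special_kappa_cond hB hA; first by exists al, be.
    by rewrite (proj2 (HS o3) C3) (proj2 (HS o0) C0) (proj2 (HS o2) C2) orbT.
  by move: not12 in12; rewrite in0 in3; case: (o1 \in S); case: (o2 \in S) => // [] [].
move=> ns; rewrite leqNgt; apply/negP => S3; apply: ns.
have [in0 in3 in12] : [/\ o0 \in S, o3 \in S & (o1 \in S) || (o2 \in S)].
  by move: S3 not12; rewrite cardS; case: (o0 \in S); case: (o1 \in S); case: (o2 \in S); case: (o3 \in S) => // _ [].
have [c0B sA] := proj1 (HS o0) in0; have [c0A sB] := proj1 (HS o3) in3.
case/orP: in12 => /HS [c _].
  by have [al [be H]] := special_criterion hA hB c sA sB c0A; exists al, be; left.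
by have [al [be H]] := special_criterion hB hA c sB sA c0B; exists al, be; right.
Qed.
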